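(* Assume $\beta_1\beta_2=(1-\alpha_1)(1-\alpha_2)$ and let $(\lambda,\mu)\in\mathbb{R}^2$. Then: (i) If $0<\alpha_1,\alpha_2<1$, then $(\lambda,\mu)\in-(\overline{\mathcal{R}_1}\setminus\mathcal{C}_1)$ if and only if (WMP) associated to (S) holds in $\Omega$. (ii) If $\alpha_1=0$ and $0<\alpha_2<1$, then $(\lambda,\mu)\in\overline{\mathcal{R}_2}\setminus\mathcal{C}_2$ if and only if (WMP) associated to (S) holds in $\Omega$. (iii) If $\alpha_2=0$ and $0<\alpha_1<1$, then $(\lambda,\mu)\in-(\overline{\mathcal{R}_2}\setminus\mathcal{C}_2)$ if and only if (WMP) associated to (S) holds in $\Omega$.
   Context: Let $n\ge1$, $p>n$, and let $\Omega\subset\mathbb{R}^n$ be a bounded open set with $C^{1,1}$ boundary and outward unit normal $\nu$. For $l=1,2$ let $\mathcal{L}_l=a^l_{ij}(x)\partial_{ij}+b^l_i(x)\partial_i+c_l(x)$ (summation convention), where $a^l_{ij}\in C(\overline\Omega)$, $b^l_i,c_l\in L^\infty(\Omega)$, and there are constants $c_0,C_0,T>0$ with $c_0|\xi|^2\le a^l_{ij}(x)\xi_i\xi_j\le C_0|\xi|^2$ and $|b^l_i(x)|,|c_l(x)|\le T$ for all $x\in\Omega$, $\xi\in\mathbb{R}^n$ and all $i$. Standing assumption: each $\mathcal{L}_l$ satisfies the scalar weak maximum principle in $\Omega$ (if $w\in W^{2,p}(\Omega)$, $\mathcal{L}_lw\le0$ a.e. in $\Omega$ and $w\ge0$ on $\partial\Omega$,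 then $w\ge0$ in $\Omega$) and the scalar strong maximum principle in $\Omega$ (for such $w$, either $w\equiv0$ in $\Omega$, or $w>0$ in $\Omega$ and $\partial_\nu w(x_0)<0$ at every $x_0\in\partial\Omega$ with $w(x_0)=0$). Let $a,b\in L^p(\Omega)$ with $\operatorname{ess\,inf}_\Omega a>0$ and $\operatorname{ess\,inf}_\Omega b>0$. Let $0\le\alpha_1,\alpha_2<1$ and $\beta_1,\beta_2>0$. Convention: for $\gamma>0$, $|w|^{\gamma-1}w$ is the signed power ($0$ where $w=0$); for $\gamma=0$ the factor $|w|^{\gamma-1}w$ is read as the constant $1$. Equations and differential inequalities hold a.e. The system (S) with parameters $(\lambda,\mu)\in\mathbb{R}^2$ is $$-\mathcal{L}_1u=\lambda a(x)|u|^{\alpha_1-1}u|v|^{\beta_1-1}v,\quad -\mathcal{L}_2v=\mu b(x)|v|^{\alpha_2-1}v|u|^{\beta_2-1}u\ \text{ in }\Omega,\qquad u=v=0\ \text{ on }\partial\Omega.$$ A principal eigenvalue of (S) is a pair $(\lambda,\mu)$ for which (S) has a strong solution $(\varphi,\psi)\in(W^{2,p}(\Omega))^2$ with $\varphi,\psi>0$ in $\Omega$. Principal curve: $\mathcal{C}_1$ is the set of principal eigenvalues of (S); it is known that $\mathcal{C}_1=\{(\lambda,\mu)\in(0,\infty)^2:\lambda^{1/\sqrt{\beta_1(1-\alpha_1)}}\mu^{1/\sqrt{\beta_2(1-\alpha_2)}}=\Lambda_0\}$ for some constant $\Lambda_0>0$. $\mathcal{R}_1$ is the open region of the first quadrant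 below $\mathcal{C}_1$ (same expression with $<\Lambda_0$ in place of $=\Lambda_0$). $\mathcal{C}_2:=\{(\lambda,\mu):(\lambda,-\mu)\in\mathcal{C}_1\}$, and $\mathcal{R}_2:=\{(\lambda,\mu):(\lambda,-\mu)\in\mathcal{R}_1\}$ is the open region of the fourth quadrant above $\mathcal{C}_2$. For $E\subset\mathbb{R}^2$, $-E=\{-x:x\in E\}$. A supersolution of (S) is a pair $(u,v)\in(W^{2,p}(\Omega))^2$ with $-\mathcal{L}_1u\ge\lambda a|u|^{\alpha_1-1}u|v|^{\beta_1-1}v$ and $-\mathcal{L}_2v\ge\mu b|v|^{\alpha_2-1}v|u|^{\beta_2-1}u$ in $\Omega$ and $u,v\ge0$ on $\partial\Omega$. (WMP) associated to (S) (for the given $(\lambda,\mu)$) holds in $\Omega$ if every supersolution satisfies $u,v\ge0$ in $\Omega$. *)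

(* Defs.v *)
From HB Require Import structures.
From mathcomp Require Import all_boot all_order all_algebra.
From mathcomp Require Import all_classical all_reals all_analysis.
From mathcomp Require Import ess_sup_inf.

Set Implicit Arguments.
Unset Strict Implicit.
Unset Printing Implicit Defensive.

Import Order.TTheory GRing.Theory Num.Theory.
Import numFieldNormedType.Exports.

Local Open Scope classical_set_scope.
Local Open Scope ring_scope.

(* Row vectors carry the product sigma-algebra, generated by the coordinates
   (on R^n this is the Borel sigma-algebra). *)
Definition measure_rV_display : measure_display.
Proof. exact: default_measure_display. Qed.

Section measurable_rV.
Context {R : realType} {n : nat}.

Let coord (i : 'I_n) (x : 'rV[R]_n) : measurableTypeR R := x ord0 i.

Let rV_set0 : g_sigma_preimage coord set0.
Proof. exact: sigma_algebra0. Qed.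

Let rV_setC A : g_sigma_preimage coord A -> g_sigma_preimage coord (~` A).
Proof. exact: sigma_algebraC. Qed.

Let rV_bigcup (F : _^nat) : (forall i, g_sigma_preimage coord (F i)) ->
  g_sigma_preimage coord (\bigcup_i F i).
Proof. exact: sigma_algebra_bigcup. Qed.

HB.instance Definition _ := @isMeasurable.Build measure_rV_display
  'rV[R]_n (g_sigma_preimage coord) rV_set0 rV_setC rV_bigcup.

Lemma measurable_coord_rV (i : 'I_n) :
  measurable_fun [set: 'rV[R]_n] (fun x => x ord0 i : measurableTypeR R).
Proof.
move=> _ Y mY; rewrite setTI; apply: sub_sigma_algebra => /=.
rewrite -bigcup_seq/=; exists i => /=; first by rewrite mem_index_enum.
by exists Y => //; rewrite setTI.
Qed.

Lemma measurable_fun_rV d (T : measurableType d) (f : T -> 'rV[R]_n) :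
  (forall i, measurable_fun setT (fun t => f t ord0 i : measurableTypeR R)) ->
  measurable_fun setT f.
Proof.
move=> mf.
have h : <<s \big[setU/set0]_(i < n) preimage_set_system setT (coord i) measurable >>
    `<=` [set A | measurable (f @^-1` A)].
  apply: smallest_sub.
    split => /=.
    - by rewrite preimage_set0.
    - by move=> A mA; rewrite setTD preimage_setC; exact: measurableC.
    - by move=> A mA; rewrite preimage_bigcup; exact: bigcup_measurable.
  rewrite -bigcup_seq; apply: bigcup_sub => i _ _ [B mB <-] /=.
  by rewrite setTI; have := mf i measurableT B mB; rewrite setTI.
by move=> _ Y mY; rewrite setTI; exact: h.
Qed.

End measurable_rV.

Section lebesgue_rV.
Context {R : realType}.

Definition cons_rV n (z : measurableTypeR R * 'rV[R]_n) : 'rV[R]_n.+1 :=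
  row_mx (const_mx z.1 : 'rV[R]_1) z.2.

Definition uncons_rV n (x : 'rV[R]_n.+1) : measurableTypeR R * 'rV[R]_n :=
  (x ord0 ord0, \row_i x ord0 (lift ord0 i)).

Lemma cons_rVE0 n z : @cons_rV n z ord0 ord0 = z.1.
Proof. by rewrite /cons_rV mxE; case: splitP => // j _; rewrite mxE. Qed.

Lemma cons_rVES n z i : @cons_rV n z ord0 (lift ord0 i) = z.2 ord0 i.
Proof.
rewrite /cons_rV mxE; case: splitP => j /=; first by rewrite ord1.
by rewrite /bump/= => -[ij]; congr (z.2 _ _); exact/val_inj.
Qed.

Lemma cons_rVK n : cancel (@cons_rV n) (@uncons_rV n).
Proof.
move=> [x t]; rewrite /uncons_rV cons_rVE0; congr (_, _).
by apply/rowP => i; rewrite mxE cons_rVES.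
Qed.

Lemma measurable_cons_rV n : measurable_fun setT (@cons_rV n).
Proof.
apply: measurable_fun_rV => i.
have [->|[j ->]] : i = ord0 \/ exists j, i = lift ord0 j.
  by case: (unliftP ord0 i) => [j|] ->; [right; exists j|left].
- by rewrite (_ : (fun _ => _) = fst) //; apply/funext => z; exact: cons_rVE0.
- rewrite (_ : (fun _ => _) =
      (fun x : 'rV[R]_n => x ord0 j : measurableTypeR R) \o snd).
    by apply: measurableT_comp => //; exact: measurable_coord_rV.
  by apply/funext => z; exact: cons_rVES.
Qed.

Lemma measurable_uncons_rV n : measurable_fun setT (@uncons_rV n).
Proof.
apply/measurable_fun_pairP; split; first exact: measurable_coord_rV.
apply: measurable_fun_rV => i /=.
under eq_fun do rewrite mxE.
exact: measurable_coord_rV.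
Qed.

Section step.
Context {n : nat} (mu : {sigma_finite_measure set 'rV[R]_n -> \bar R}).

Definition lebesgue_rV_step : set 'rV[R]_n.+1 -> \bar R :=
  pushforward (lebesgue_measure \x mu)%E (@cons_rV n).

Let step0 : lebesgue_rV_step set0 = 0%E.
Proof. by rewrite /lebesgue_rV_step /pushforward preimage_set0 measure0. Qed.

Let step_ge0 A : (0 <= lebesgue_rV_step A)%E.
Proof. by rewrite /lebesgue_rV_step /pushforward measure_ge0. Qed.

Let step_sigma_additive : semi_sigma_additive lebesgue_rV_step.
Proof.
have m := @measurable_cons_rV n.
move=> F mF tF mUF; rewrite /lebesgue_rV_step /pushforward preimage_bigcup.
apply: measure_semi_sigma_additive.
- by move=> k; rewrite -[X in measurable X]setTI; exact: m.
- apply/trivIsetP => /= i j _ _ ij; rewrite -preimage_setI.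
  by move/trivIsetP : tF => /(_ _ _ _ _ ij) ->//; rewrite preimage_set0.
- by rewrite -preimage_bigcup -[X in measurable X]setTI; exact: m.
Qed.

HB.instance Definition _ := isMeasure.Build _ _ _
  lebesgue_rV_step step0 step_ge0 step_sigma_additive.

Let step_sigma_finite : sigma_finite setT lebesgue_rV_step.
Proof.
have /sigma_finiteP[F [TF ndF Foo]] := sigma_finiteT (@lebesgue_measure R).
have /sigma_finiteP[G [TG ndG Goo]] := sigma_finiteT mu.
exists (fun i => @uncons_rV n @^-1` (F i `*` G i)).
  rewrite -preimage_bigcup (_ : \bigcup_i _ = setT) ?preimage_setT//.
  apply/seteqP; split => // -[x y] _.
  have [i _ Fx] : (\bigcup_i F i) x by rewrite -TF.
  have [j _ Gy] : (\bigcup_i G i) y by rewrite -TG.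
  exists (maxn i j) => //; split => /=.
  - by move: x Fx; exact/subsetPset/ndF/leq_maxl.
  - by move: y Gy; exact/subsetPset/ndG/leq_maxr.
move=> i; have [mF Foi] := Foo i; have [mG Goi] := Goo i; split.
  rewrite -[X in measurable X]setTI; apply: measurable_uncons_rV => //.
  exact: measurableX.
rewrite /lebesgue_rV_step /pushforward -comp_preimage.
rewrite (_ : _ \o _ = id) ?preimage_id; last first.
  by apply/funext => z; exact: cons_rVK.
by rewrite product_measure1E// lte_mul_pinfty// ge0_fin_numE.
Qed.

HB.instance Definition _ := Measure_isSigmaFinite.Build _ _ _
  lebesgue_rV_step step_sigma_finite.

End step.

Fixpoint lebesgue_rV (n : nat) : {sigma_finite_measure set 'rV[R]_n -> \bar R} :=
  match n with
  | 0 => [the {sigma_finite_measure set _ -> \bar R} of \d_(0 : 'rV[R]_0)]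
  | m.+1 => [the {sigma_finite_measure set _ -> \bar R} of
              lebesgue_rV_step (lebesgue_rV m)]
  end.

End lebesgue_rV.

Section sobolev.
Context {R : realType} {n : nat}.
Implicit Types (Omega : set 'rV[R]_n) (f g u : 'rV[R]_n -> R).

(* Euclidean inner product; the library norm on 'rV[R]_n is the sup norm. *)
Definition dotr (x y : 'rV[R]_n) : R := \sum_(i < n) x ord0 i * y ord0 i.

Definition partial (i : 'I_n) f (x : 'rV[R]_n) : R :=
  'D_(delta_mx ord0 i : 'rV[R]_n) f x.

Definition boundary Omega : set 'rV[R]_n := closure Omega `\` Omega°.

Definition smooth f : Prop :=
  forall (s : seq 'I_n) (x : 'rV[R]_n), differentiable (foldr partial f s) x.

Definition test_function Omega f : Prop :=
  [/\ smooth f, compact (closure [set x | f x != 0]) &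
      closure [set x | f x != 0] `<=` Omega].

Definition weak_partial Omega (i : 'I_n) u g : Prop :=
  forall phi, test_function Omega phi ->
    \int[lebesgue_rV n]_(x in Omega) (u x * partial i phi x) =
    - \int[lebesgue_rV n]_(x in Omega) (g x * phi x).

Definition inLp Omega (p : \bar R) f : Prop := f \_ Omega \in Lfun (lebesgue_rV n) p.

Definition ess_inf_on Omega f : \bar R :=
  ess_inf (lebesgue_rV n) (patch (cst +oo%E) Omega (EFin \o f)).

(* An element of W^{2,p}(Omega) for p > n and Omega bounded of class C^{1,1},
   together with its weak derivatives.  By Morrey's embedding
   W^{2,p}(Omega) `<=` C^1(closure Omega), each class modulo null sets has a
   unique representative in C^1(closure Omega); it is the representative
   recorded here, so that boundary values and normal derivatives are pointwise.
   Values outside closure Omega (outside Omega for the second derivatives) are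
   irrelevant. *)
Record sobolev2 Omega (p : R) := Sobolev2 {
  sob_val :> 'rV[R]_n -> R;
  sob_grad : 'I_n -> 'rV[R]_n -> R;
  sob_hess : 'I_n -> 'I_n -> 'rV[R]_n -> R;
  sob_val_Lp : inLp Omega p%:E sob_val;
  sob_grad_Lp : forall i, inLp Omega p%:E (sob_grad i);
  sob_hess_Lp : forall i j, inLp Omega p%:E (sob_hess i j);
  sob_grad_weak : forall i, weak_partial Omega i sob_val (sob_grad i);
  sob_hess_weak : forall i j, weak_partial Omega j (sob_grad i) (sob_hess i j);
  sob_val_cont : {within closure Omega, continuous sob_val};
  sob_grad_cont : forall i, {within closure Omega, continuous (sob_grad i)};
  sob_grad_classical : forall i x, Omega x ->
    is_derive x (delta_mx ord0 i : 'rV[R]_n) sob_val (sob_grad i x)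
}.

(* Near x0, Omega is the region above the graph, over the hyperplane orthogonal
   to the unit vector e, of the C^{1,1} function gamma; gamma is extended to
   the whole space so as to be constant along e. *)
Definition C11_chart Omega (x0 e : 'rV[R]_n) (gamma : 'rV[R]_n -> R) : Prop :=
  [/\ dotr e e = 1,
      forall x t, gamma (x + t *: e) = gamma x,
      forall x, differentiable gamma x,
      exists K, forall i x y,
        `|partial i gamma x - partial i gamma y| <= K * `|x - y| &
      exists2 r, 0 < r &
        forall x, ball x0 r x -> (Omega x <-> gamma x < dotr x e)].

Definition C11_boundary Omega : Prop :=
  forall x0, boundary Omega x0 -> exists e gamma, C11_chart Omega x0 e gamma.

(* The outward direction is the gradient of x |-> gamma x - dotr x e, which is
   negative in Omega near x0. *)
Definition outward_normal Omega (x0 nu : 'rV[R]_n) : Prop :=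
  exists e gamma, C11_chart Omega x0 e gamma /\
    let N := \row_i partial i gamma x0 - e in
    nu = (Num.sqrt (dotr N N))^-1 *: N.

Definition normal_derivative Omega p (w : sobolev2 Omega p)
    (nu x0 : 'rV[R]_n) : R :=
  \sum_(i < n) nu ord0 i * sob_grad w i x0.

Record operator := Operator {
  coef2 : 'I_n -> 'I_n -> 'rV[R]_n -> R;
  coef1 : 'I_n -> 'rV[R]_n -> R;
  coef0 : 'rV[R]_n -> R
}.

Definition op_apply (L : operator) Omega p (w : sobolev2 Omega p)
    (x : 'rV[R]_n) : R :=
  \sum_(i < n) \sum_(j < n) coef2 L i j x * sob_hess w i j x
  + \sum_(i < n) coef1 L i x * sob_grad w i x + coef0 L x * w x.

Definition elliptic Omega (c0 C0 T : R) (L : operator) : Prop :=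
  [/\ forall i j, {within closure Omega, continuous (coef2 L i j)},
      forall i, inLp Omega +oo%E (coef1 L i),
      inLp Omega +oo%E (coef0 L),
      forall x (xi : 'rV[R]_n), Omega x ->
        c0 * dotr xi xi
          <= \sum_(i < n) \sum_(j < n) coef2 L i j x * xi ord0 i * xi ord0 j
          <= C0 * dotr xi xi &
      forall x, Omega x -> (forall i, `|coef1 L i x| <= T) /\ `|coef0 L x| <= T].

Definition ae_on Omega (P : 'rV[R]_n -> Prop) : Prop :=
  {ae lebesgue_rV n, forall x, Omega x -> P x}.

Definition scalar_supersolution Omega p (L : operator) (w : sobolev2 Omega p)
    : Prop :=
  ae_on Omega (fun x => op_apply L w x <= 0) /\
  forall x, boundary Omega x -> 0 <= w x.

Definition scalar_wmp Omega (p : R) (L : operator) : Prop :=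
  forall w : sobolev2 Omega p, scalar_supersolution L w ->
    forall x, Omega x -> 0 <= w x.

Definition scalar_smp Omega (p : R) (L : operator) : Prop :=
  forall w : sobolev2 Omega p, scalar_supersolution L w ->
    (forall x, Omega x -> w x = 0) \/
    ((forall x, Omega x -> 0 < w x) /\
     forall x0 nu, boundary Omega x0 -> outward_normal Omega x0 nu ->
       w x0 = 0 -> normal_derivative w nu x0 < 0).

End sobolev.

Arguments operator : clear implicits.

Section system.
Context {R : realType} {n : nat}.

(* |w|^(gamma - 1) w, read as 1 when gamma = 0.  For 0 < gamma the formula gives
   0 at w = 0, whatever the value of the power. *)
Definition signed_pow (gamma w : R) : R :=
  if gamma == 0 then 1 else `|w| `^ (gamma - 1) * w.

Record system := System {
  op1 : operator R n;
  op2 : operator R n;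
  weight1 : 'rV[R]_n -> R;
  weight2 : 'rV[R]_n -> R;
  alpha1 : R;
  alpha2 : R;
  beta1 : R;
  beta2 : R
}.

Variables (Omega : set 'rV[R]_n) (p : R) (S : system).
Implicit Types (u v : sobolev2 Omega p) (lm : R * R).

Definition rhs1 lm u v (x : 'rV[R]_n) : R :=
  lm.1 * weight1 S x * signed_pow (alpha1 S) (u x) * signed_pow (beta1 S) (v x).

Definition rhs2 lm u v (x : 'rV[R]_n) : R :=
  lm.2 * weight2 S x * signed_pow (alpha2 S) (v x) * signed_pow (beta2 S) (u x).

Definition is_solution lm u v : Prop :=
  [/\ ae_on Omega (fun x => - op_apply (op1 S) u x = rhs1 lm u v x),
      ae_on Omega (fun x => - op_apply (op2 S) v x = rhs2 lm u v x) &
      forall x, boundary Omega x -> u x = 0 /\ v x = 0].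

Definition is_supersolution lm u v : Prop :=
  [/\ ae_on Omega (fun x => rhs1 lm u v x <= - op_apply (op1 S) u x),
      ae_on Omega (fun x => rhs2 lm u v x <= - op_apply (op2 S) v x) &
      forall x, boundary Omega x -> 0 <= u x /\ 0 <= v x].

Definition WMP lm : Prop :=
  forall u v, is_supersolution lm u v -> forall x, Omega x -> 0 <= u x /\ 0 <= v x.

Definition principal_eigenvalue lm : Prop :=
  exists u v, is_solution lm u v /\ forall x, Omega x -> 0 < u x /\ 0 < v x.

Definition curve1 : set (R * R) := [set lm | principal_eigenvalue lm].

Definition curve_expr lm : R :=
  lm.1 `^ (Num.sqrt (beta1 S * (1 - alpha1 S)))^-1 *
  lm.2 `^ (Num.sqrt (beta2 S * (1 - alpha2 S)))^-1.

Definition region1 (Lambda0 : R) : set (R * R) :=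
  [set lm | [/\ 0 < lm.1, 0 < lm.2 & curve_expr lm < Lambda0]].

Definition curve2 : set (R * R) := [set lm | curve1 (lm.1, - lm.2)].

Definition region2 (Lambda0 : R) : set (R * R) :=
  [set lm | region1 Lambda0 (lm.1, - lm.2)].

End system.

Arguments system : clear implicits.

Definition opp_set {R : realType} (E : set (R * R)) : set (R * R) :=
  [set - x | x in E].

(* Main.v *)
From mathcomp Require Import all_boot all_order all_algebra.
From mathcomp Require Import all_classical all_reals all_analysis.
From mathcomp Require Import measurable_realfun ess_sup_inf ring lra.
Require Import Defs.

Set Implicit Arguments.
Unset Strict Implicit.
Unset Printing Implicit Defensive.

Import Order.TTheory GRing.Theory Num.Theory.
Import numFieldNormedType.Exports.

Local Open Scope classical_set_scope.
Local Open Scope ring_scope.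

(** The proof compares supersolutions with the principal eigenfunctions. Let l
    be lambda if alpha1 = 0 and - lambda otherwise, and let m be mu if alpha2 = 0
    and - mu otherwise. In the three cases the weak maximum principle holds if
    and only if l, m >= 0 and (l, m) lies strictly below the principal curve.

    If (l, m) lies on or above the curve, or has a negative coordinate, then the
    weak maximum principle is violated by a pair (- phi, - psi), (- phi, s psi)
    or (s phi, - psi), where phi and psi are principal eigenfunctions and s is
    large.

    Otherwise some point (l1, m1) of the curve
    satisfies l <= l1 and m < m1; let phi and psi be its eigenfunctions. For a
    supersolution (u, v), Hopf's lemma for phi and psi gives least t, s >= 0 with
    u >= - t phi and v >= - s psi (optimal_lower_bound). Inserting these bounds
    into the equations at the points where u < 0, respectively v < 0, yields
      t <= (l / l1) t^alpha1 s^beta1,   s <= (m / m1) s^alpha2 t^beta2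
    (bound_improvement), and criticality makes these inequalities homogeneous,
    so that m / m1 < 1 forces t = s = 0 (critical_inequalities).

    The delicate point is that the differential inequality for u is only useful
    where u < 0, whereas the scalar maximum principle is assumed on Omega only.
    It is localized by truncation (scalar_comparison). Put
    Psi = psi + tau sqrt(psi) and z = v + kappa Psi, and test the maximum
    principle with w = min(z, 0)^3 / Psi^2. The function w is concave and
    homogeneous of degree one in (v, Psi), and nondecreasing in v, so L w is
    controlled by L v and L Psi on the set z < 0 and no term in the unsigned
    zeroth-order coefficient survives except through the concave perturbation
    sqrt(psi), where it is absorbed near the boundary because the gradient of
    psi does not vanish there. That perturbation also dominates psi near the
    boundary, hence z > 0 there and w has compact support in Omega.

    That w belongs to W^{2,p} rests on the product rule for weak derivatives
    (weak_partial_mul, sobolev_build). Since weak derivatives are tested against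
    smooth functions, it requires approximating a compactly supported function of
    class C^1, together with one partial derivative, by smooth ones
    (test_function_approx); the smooth functions come from an explicit partition
    of unity on a lattice. *)


(** * Directional derivatives *)

Section directional.
Context {R : realType} {V : normedModType R}.
Implicit Types (f g : V -> R) (x v : V).

Lemma is_derive_lineP f x v d :
  is_derive x v f d <-> is_derive (0 : R) 1 (fun h : R => f (h *: v + x)) d.
Proof.
have e : 'D_v f x = 'D_1 (fun h : R => f (h *: v + x)) (0 : R).
  rewrite /derive; set g1 := fun h => h^-1 *: _; set g2 := fun h => h^-1 *: _.
  suff -> : g1 = g2 by [].
  by apply/funext => h /=; rewrite /g1 /g2/= addr0 scale0r add0r [_ *: 1]mulr1.
split=> -[df <-].
- by split; [exact: (derivable1P f x v).1|rewrite e].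
- by split; [exact: (derivable1P f x v).2|rewrite e].
Qed.

End directional.

Section directional_rules.
Context {R : realType} {V : normedModType R}.
Implicit Types (f g : V -> R) (x v : V).

Lemma is_derive_line f x v (t : R) d : is_derive (t *: v + x) v f d ->
  is_derive t 1 (fun h : R => f (h *: v + x)) d.
Proof.
move=> /is_derive_lineP fd.
apply: (is_derive_lineP (fun h : R => f (h *: v + x)) t (1 : R) d).2.
rewrite (_ : (fun _ => _) = (fun h : R => f (h *: v + (t *: v + x)))) //.
by apply/funext => h; rewrite [_ *: 1]mulr1 scalerDl addrA.
Qed.

Lemma is_derive_funD f g x v df dg : is_derive x v f df ->
  is_derive x v g dg -> is_derive x v (fun y => f y + g y) (df + dg).
Proof. exact: is_deriveD. Qed.

Lemma is_derive_funM f g x v df dg : is_derive x v f df ->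
  is_derive x v g dg -> is_derive x v (fun y => f y * g y) (f x * dg + g x * df).
Proof. exact: is_deriveM. Qed.

Lemma is_derive_fun_comp (F : R -> R) f x v dF df : is_derive x v f df ->
  is_derive (f x) 1 F dF -> is_derive x v (fun y => F (f y)) (dF * df).
Proof.
move=> /is_derive_lineP fd Fd; apply/is_derive_lineP.
rewrite -[f x]add0r in Fd.
have := @is_derive1_comp _ F (fun h : R => f (h *: v + x)) 0 dF df.
by rewrite scale0r add0r; apply => //; rewrite -[f x]add0r.
Qed.

Lemma is_derive_funV f x v df : f x != 0 -> is_derive x v f df ->
  is_derive x v (fun y => (f y)^-1) (- (f x) ^- 2 * df).
Proof.
move=> fx0 fd; apply: (@is_derive_fun_comp GRing.inv) => //.
by have := @is_deriveV _ id (f x) 1 1 fx0 _; rewrite [_ *: 1]mulr1; apply.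
Qed.

Lemma is_derive_funX f x v df n : is_derive x v f df ->
  is_derive x v (fun y => (f y) ^+ n) (n%:R * f x ^+ n.-1 * df).
Proof.
move=> fd; have := is_deriveX n fd.
by rewrite (_ : f ^+ n = (fun y => f y ^+ n))//; apply/funext => y; rewrite fctE.
Qed.

End directional_rules.

Lemma is_derive_affine {R : realType} (f : R -> R) (a b x df : R) :
  is_derive (a * x + b) 1 f df -> is_derive x 1 (fun y => f (a * y + b)) (df * a).
Proof.
move=> fd; apply: (@is_derive1_comp _ f (fun y => a * y + b)) => //.
apply: (@is_derive_eq _ _ _ _ _ _ _ (a * 1 + x * 0 + 0)); ring.
Qed.

(** * Smooth functions of one variable *)

Section smooth1.
Context {R : realType}.
Implicit Types (f g : R -> R) (k : nat) (x a b : R).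

(** Phrased through the iterated derivative function so that closure under
    products and inverses goes by induction on k. *)
Fixpoint times_derivable k f : Prop :=
  if k is k'.+1 then (forall x, derivable f x 1) /\ times_derivable k' (derive1 f)
  else True.

Definition smooth1 f := forall k, times_derivable k f.

Lemma derive1_fun f f' : (forall x, is_derive x 1 f (f' x)) -> (derive1 f) = f'.
Proof. by move=> fd; apply/funext => x; rewrite derive1E; case: (fd x). Qed.

Lemma times_derivableS k f f' : (forall x, is_derive x 1 f (f' x)) ->
  times_derivable k f' -> times_derivable k.+1 f.
Proof.
by move=> fd kf'; split; [move=> x; case: (fd x)|rewrite (derive1_fun fd)].
Qed.

Lemma times_derivable_is_derive k f : times_derivable k.+1 f ->
  forall x, is_derive x 1 f (derive1 f x).
Proof. by move=> [fd _] x; rewrite derive1E; exact: derivableP. Qed.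

Lemma times_derivable_weaken k f : times_derivable k.+1 f -> times_derivable k f.
Proof. by elim: k f => //= k ih f [fd /ih]. Qed.

Lemma times_derivable_cst k (c : R) : times_derivable k (fun=> c).
Proof.
elim: k c => // k ih c; apply: (@times_derivableS _ _ (fun=> 0)) => //.
Qed.

Lemma times_derivableD k f g : times_derivable k f -> times_derivable k g ->
  times_derivable k (fun x => f x + g x).
Proof.
elim: k f g => // k ih f g fk gk.
apply: (@times_derivableS _ _ (fun x => derive1 f x + derive1 g x)).
  by move=> x; apply: is_derive_funD;
    [exact: times_derivable_is_derive fk x|exact: times_derivable_is_derive gk x].
by apply: ih; [case: fk|case: gk].
Qed.

Lemma times_derivableM k f g : times_derivable k f -> times_derivable k g ->
  times_derivable k (fun x => f x * g x).
Proof.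
elim: k f g => // k ih f g fk gk.
apply: (@times_derivableS _ _ (fun x => f x * derive1 g x + g x * derive1 f x)).
  by move=> x; apply: is_derive_funM;
    [exact: times_derivable_is_derive fk x|exact: times_derivable_is_derive gk x].
apply: times_derivableD; apply: ih.
- exact: times_derivable_weaken.
- by case: gk.
- exact: times_derivable_weaken.
- by case: fk.
Qed.

Lemma times_derivableV k f : (forall x, f x != 0) -> times_derivable k f ->
  times_derivable k (fun x => (f x)^-1).
Proof.
move=> f0; elim: k f f0 => // k ih f f0 fk.
apply: (@times_derivableS _ _ (fun x => (-1 * ((f x)^-1 * (f x)^-1)) * derive1 f x)).
  move=> x; rewrite mulN1r -expr2 exprVn.
  by apply: is_derive_funV => //; exact: times_derivable_is_derive fk x.
have fV := ih f f0 (times_derivable_weaken fk).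
apply: times_derivableM; last by case: fk.
by apply: times_derivableM; [exact: times_derivable_cst|exact: times_derivableM].
Qed.

Lemma times_derivable_affine k f a b : times_derivable k f ->
  times_derivable k (fun x => f (a * x + b)).
Proof.
elim: k f => // k ih f fk.
apply: (@times_derivableS _ _ (fun x => derive1 f (a * x + b) * a)).
  by move=> x; apply: is_derive_affine; exact: (times_derivable_is_derive fk).
by apply: times_derivableM; [apply: ih; case: fk|exact: times_derivable_cst].
Qed.

Lemma smooth1_antiderivative f f' : (forall x, is_derive x 1 f (f' x)) ->
  smooth1 f' -> smooth1 f.
Proof. by move=> fd sf' [|k] //; exact: times_derivableS fd (sf' k). Qed.

Lemma smooth1_derive1 f : smooth1 f -> smooth1 (derive1 f).
Proof. by move=> sf k; case: (sf k.+1). Qed.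

Lemma smooth1_is_derive f : smooth1 f -> forall x, is_derive x 1 f (derive1 f x).
Proof. by move=> sf; exact: times_derivable_is_derive (sf 1). Qed.

Lemma smooth1_continuous f : smooth1 f -> continuous f.
Proof.
move=> /smooth1_is_derive fd x.
by apply/differentiable_continuous/derivable1_diffP; case: (fd x).
Qed.

End smooth1.

(** * A smooth partition of unity on the line *)

Section flat.
Context {R : realType}.
Implicit Types (p : {poly R}) (t : R).

(** The functions p(1/t) exp(-1/t), extended by 0 to t <= 0, form a family
    stable under differentiation that contains exp(-1/t). *)
Definition flat p t : R := if 0 < t then p.[t^-1] * expR (- t^-1) else 0.

Lemma exprn_expRN_le n (y : R) : 0 <= y -> y ^+ n * expR (- y) <= n`!%:R.
Proof.
move=> y0; rewrite expRN ler_pdivrMr ?expR_gt0//.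
have [->|n0] := eqVneq n 0%N.
  by rewrite expr0 mul1r (le_trans _ (expR_ge1Dx _))// lerDl.
have := expR_ge1Dxn n.-1 y0; rewrite prednK ?lt0n// => h.
have f0 : 0 < n`!%:R :> R by rewrite ltr0n fact_gt0.
by rewrite mulrC -ler_pdivrMr//; apply: le_trans h; rewrite lerDr.
Qed.

Lemma horner_expRN_bounded p :
  exists2 C, 0 <= C & forall y, 0 <= y -> `|p.[y] * expR (- y)| <= C.
Proof.
exists (\sum_(i < size p) `|p`_i| * (i`!)%:R).
  by apply: sumr_ge0 => i _; rewrite mulr_ge0.
move=> y y0; rewrite horner_coef mulr_suml (le_trans (ler_norm_sum _ _ _))//.
apply: ler_sum => i _; rewrite -mulrA normrM ler_wpM2l//.
by rewrite ger0_norm ?exprn_expRN_le// mulr_ge0 ?exprn_ge0// expR_ge0.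
Qed.

(** All the derivatives vanish at the origin because exponential decay beats
    any power of 1/t. *)
Lemma flat_le_sqr p : exists2 C, 0 <= C & forall t, `|flat p t| <= C * t ^+ 2.
Proof.
have [C C0 hC] := horner_expRN_bounded ('X^2 * p); exists C => // t.
rewrite /flat; case: ifPn => [t0|_]; last first.
  by rewrite normr0 mulr_ge0// sqr_ge0.
have := hC t^-1; rewrite invr_ge0 (ltW t0) => /(_ isT).
rewrite hornerM hornerXn -mulrA normrM.
rewrite [`|_ ^+ 2|]ger0_norm ?sqr_ge0//.
by rewrite exprVn mulrC ler_pdivrMr ?exprn_gt0.
Qed.

Lemma is_derive_flat p t : is_derive t 1 (flat p) (flat ('X^2 * (p - p^`())) t).
Proof.
have [t0|t0|t0] := ltgtP 0 t.
- have dV : is_derive t (1:R) (fun u => u^-1) (- t ^- 2).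
    apply: (@is_derive_eq _ _ _ _ _ _ _ (- t ^- 2 * 1)); last by rewrite mulr1.
    by apply: (@is_derive_funV _ _ id); rewrite ?gt_eqF.
  have eflat : \forall u \near t, p.[u^-1] * expR (- u^-1) = flat p u.
    near=> u; rewrite /flat ifT//; near: u.
    exact: lt_nbhsr.
  apply: (near_eq_is_derive eflat).
  have dE : is_derive t (1:R) (fun u => expR (- u^-1)) (expR (- t^-1) * (t ^- 2)).
    have dN : is_derive t (1:R) (fun u => - u^-1) (t ^- 2).
      by rewrite -[t ^- 2]opprK; exact: is_deriveN.
    exact: (is_derive_fun_comp dN (is_derive_expR _)).
  have dP : is_derive t (1:R) (fun u => p.[u^-1]) (p^`().[t^-1] * - t ^- 2).
    exact: (is_derive_fun_comp dV (is_derive_poly p _)).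
  apply: (is_derive_eq (is_derive_funM dP dE)).
  rewrite /flat t0 hornerM hornerXn hornerD hornerN exprVn; ring.
- rewrite /flat ltNge (ltW t0)/=.
  have eflat : \forall u \near t, 0 = flat p u.
    near=> u; rewrite /flat ifF//; apply/negbTE; rewrite -leNgt ltW//; near: u.
    exact: lt_nbhsl.
  exact: (near_eq_is_derive eflat).
- rewrite -t0 {2}/flat ltxx.
  have [C C0 hC] := flat_le_sqr p.
  have cv : h^-1 *: (flat p (h *: 1 + 0) - flat p 0) @[h --> 0^'] --> (0 : R).
    apply/cvgr0Pnorm_le => e e0; near=> h.
    have h0 : h != 0 by near: h; exact: nbhs_dnbhs_neq.
    rewrite {2}/flat ltxx subr0 addr0 [_ *: 1]mulr1 normrZ normfV.
    rewrite ler_pdivrMl ?normr_gt0// (le_trans (hC h))//.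
    rewrite -real_normK ?num_real// expr2 mulrA mulrC ler_wpM2l//.
    have : `|h| <= e / (C + 1).
      near: h; apply: dnbhs0_le; rewrite divr_gt0// ltr_wpDl//.
    rewrite ler_pdivlMr ?ltr_wpDl// => hC1; apply: le_trans hC1.
    by rewrite mulrC ler_wpM2l// lerDl.
  split; first by apply/cvg_ex; exists 0.
  exact/cvg_lim.
Unshelve. all: by end_near. Qed.

Lemma smooth1_flat p : smooth1 (flat p).
Proof.
move=> k; elim: k p => // k ih p.
exact: times_derivableS (is_derive_flat p) (ih _).
Qed.

End flat.

Section hat.
Context {R : realType}.
Implicit Types t x : R.

Lemma flat1_gt0 t : 0 < t -> 0 < flat 1 t.
Proof. by move=> t0; rewrite /flat t0 hornerC mul1r expR_gt0. Qed.

Lemma flat1_ge0 t : 0 <= flat 1 t.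
Proof. by rewrite /flat; case: ifP => // _; rewrite hornerC mul1r expR_ge0. Qed.

Lemma flat1_le0 t : t <= 0 -> flat 1 t = 0.
Proof. by rewrite /flat leNgt => /negbTE ->. Qed.

Lemma flat1_homo : {homo flat (1 : {poly R}) : x y / x <= y}.
Proof.
move=> x y xy; have [x0|x0] := leP x 0; first by rewrite flat1_le0// flat1_ge0.
have y0 := lt_le_trans x0 xy.
by rewrite /flat x0 y0 !hornerC !mul1r ler_expR lerN2 lef_pV2.
Qed.

Definition step t : R := flat 1 t / (flat 1 t + flat 1 (1 - t)).

Let step_den_gt0 t : 0 < flat 1 t + flat 1 (1 - t).
Proof.
have [t0|t0] := ltP 0 t; first by rewrite ltr_pwDl ?flat1_gt0 ?flat1_ge0.
by rewrite ltr_wpDl ?flat1_ge0// flat1_gt0//; lra.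
Qed.

Lemma smooth1_step : smooth1 step.
Proof.
move=> k; apply: times_derivableM; first exact: smooth1_flat.
apply: times_derivableV; first by move=> t; rewrite gt_eqF ?step_den_gt0.
apply: times_derivableD; first exact: smooth1_flat.
rewrite (_ : (fun _ => _) = (fun t => flat 1 (-1 * t + 1))); last first.
  by apply/funext => t; rewrite mulN1r addrC.
exact/times_derivable_affine/smooth1_flat.
Qed.

Lemma step0 t : t <= 0 -> step t = 0.
Proof. by move=> t0; rewrite /step flat1_le0// mul0r. Qed.

Lemma step1 t : 1 <= t -> step t = 1.
Proof.
move=> t1; have := step_den_gt0 t; rewrite /step [flat 1 (1 - t)]flat1_le0 ?subr_le0//.
by rewrite addr0 => t0; rewrite divff// gt_eqF.
Qed.

Lemma step_homo : {homo step : x y / x <= y}.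
Proof.
move=> x y xy; rewrite /step ler_pdivrMr// mulrAC ler_pdivlMr//.
have h1 := flat1_homo xy.
have h2 : flat 1 (1 - y) <= flat 1 (1 - x) by apply: flat1_homo; lra.
have := ler_pM (flat1_ge0 x) (flat1_ge0 (1 - y)) h1 h2.
nra.
Qed.

(** The integer translates of this bump add up to 1, by telescoping. *)
Definition hat t : R := step (t + 1) - step t.

Lemma hat_ge0 t : 0 <= hat t.
Proof. by rewrite subr_ge0 step_homo// lerDl. Qed.

Lemma hat_eq0 t : 1 <= `|t| -> hat t = 0.
Proof.
rewrite /hat ler_normr lerNr => /orP[t1|t1]; last by rewrite !step0 ?subrr//; lra.
by rewrite !step1 ?subrr//; lra.
Qed.

Lemma smooth1_hat : smooth1 hat.
Proof.
move=> k; rewrite (_ : hat = fun t => step (1 * t + 1) + -1 * step t); last first.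
  by apply/funext => t; rewrite mul1r mulN1r.
apply: times_derivableD; first exact/times_derivable_affine/smooth1_step.
by apply: times_derivableM; [exact: times_derivable_cst|exact: smooth1_step].
Qed.

(** The sum runs over the integers between -N and N. *)
Lemma sum_hat (N : nat) t : `|t| <= N%:R ->
  \sum_(k < (N + N).+1) hat (t - (k%:R - N%:R)) = 1.
Proof.
rewrite ler_norml => /andP[Nt tN].
have tele M : \sum_(k < M) hat (t - (k%:R - N%:R)) =
    step (t + N%:R + 1) - step (t + N%:R + 1 - M%:R).
  elim: M => [|M ih]; first by rewrite big_ord0 subr0 subrr.
  rewrite big_ord_recr /= ih /hat -natr1.
  rewrite (_ : t - (M%:R - N%:R) + 1 = t + N%:R + 1 - M%:R); last by ring.
  rewrite (_ : t - (M%:R - N%:R) = t + N%:R + 1 - (M%:R + 1)); last by ring.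
  by ring.
rewrite tele -natr1 natrD step1; last by lra.
by rewrite step0 ?subr0//; lra.
Qed.

Lemma hat_antiderivative : exists H : R -> R, forall t, is_derive t 1 H (hat t).
Proof.
exists (fun x => \int[lebesgue_measure]_(t in [set` `[-2, x]]) hat t) => x.
(* hat vanishes on the left of -1, so the fundamental theorem is needed only
   away from the endpoint -2 *)
have [x1|x1] := ltP x (- 1); last first.
  have h : lebesgue_measure.-integrable `[-2, x + 1] (EFin \o hat).
    apply: continuous_compact_integrable; first exact: segment_compact.
    exact/continuous_subspaceT/smooth1_continuous/smooth1_hat.
  have [] := @continuous_FTC1_closed R hat (-2) x (x + 1) _ h.
  - by rewrite ltrDl.
  - by apply: lt_le_trans x1; lra.
  - exact: smooth1_continuous smooth1_hat _.
  by rewrite derive1E => dH <-; exact: derivableP.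
have e : \forall y \near x, 0 = \int[lebesgue_measure]_(t in [set` `[-2, y]]) hat t.
  near=> y.
  have y1 : y < -1 by near: y; exact: lt_nbhsl.
  rewrite (@eq_Rintegral _ _ _ _ _ (fun=> 0)) ?Rintegral_cst ?mul0r//.
  move=> t; rewrite inE/= in_itv/= => /andP[_ ty].
  by rewrite hat_eq0// ler0_norm; lra.
rewrite hat_eq0; last by rewrite ler0_norm; lra.
exact: (near_eq_is_derive e).
Unshelve. all: by end_near. Qed.

End hat.

(** * Smooth functions of several variables *)

Section rV_norm.
Context {R : realType} {n : nat}.
Implicit Types (x y : 'rV[R]_n) (i j : 'I_n).

Lemma coord_le_norm x i : `|x ord0 i| <= `|x|.
Proof.
rewrite [leRHS]/Num.norm/= mx_normrE.
exact: (@le_bigmax _ _ _ _ (fun ij : 'I_1 * 'I_n => `|x ij.1 ij.2|) (ord0, i)).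
Qed.

Lemma rV_norm_le x (r : R) : 0 <= r -> (forall i, `|x ord0 i| <= r) -> `|x| <= r.
Proof.
move=> r0 h; rewrite /Num.norm/= mx_normrE; apply/bigmax_leP; split => // -[a i] _.
by rewrite /= [a]ord1.
Qed.

Lemma rV_norm_lt x (r : R) : 0 < r -> (forall i, `|x ord0 i| < r) -> `|x| < r.
Proof.
move=> r0 h; rewrite /Num.norm/= mx_normrE; apply/bigmax_ltP; split => // -[a i] _.
by rewrite /= [a]ord1.
Qed.

Lemma ball_rVE x (r : R) y : ball x r y = (`|x - y| < r).
Proof. by rewrite -ball_normE. Qed.

Definition unit_rV i : 'rV[R]_n := delta_mx ord0 i.

End rV_norm.

Section smooth_rV.
Context {R : realType} {n : nat}.
Implicit Types (f g : 'rV[R]_n -> R) (k : nat) (x v : 'rV[R]_n) (i j : 'I_n).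

Fixpoint times_differentiable k f : Prop :=
  (forall x, differentiable f x) /\
  if k is k'.+1 then forall i, times_differentiable k' (partial i f) else True.

Lemma times_differentiable_weaken k f :
  times_differentiable k.+1 f -> times_differentiable k f.
Proof. by elim: k f => [f []//|k ih f [fd fk]]; split => // i; exact: ih. Qed.

Lemma times_differentiable_differentiable k f x :
  times_differentiable k f -> differentiable f x.
Proof. by case: k => [|k] []. Qed.

Lemma smoothP f : (forall k, times_differentiable k f) -> smooth f.
Proof.
move=> fk s; suff h k : times_differentiable k (foldr partial f s).
  by move=> x; exact: times_differentiable_differentiable (h 0%N).
by elim: s k => [|i s ih] k /=; [exact: fk|case: (ih k.+1) => _; exact].
Qed.

Lemma partial_is_derive i f x d : is_derive x (unit_rV i) f d -> partial i f x = d.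
Proof. by case. Qed.

Lemma is_derive_partial i f x : differentiable f x ->
  is_derive x (unit_rV i) f (partial i f x).
Proof. by move=> fd; apply: derivableP; exact: diff_derivable. Qed.

Lemma times_differentiable_cst k (c : R) : times_differentiable k (fun=> c).
Proof.
elim: k c => [|k ih] c; split => //.
move=> i; rewrite (_ : partial i _ = fun=> 0) //; apply/funext => x.
exact: partial_is_derive.
Qed.

Lemma times_differentiableD k f g : times_differentiable k f ->
  times_differentiable k g -> times_differentiable k (fun x => f x + g x).
Proof.
elim: k f g => [|k ih] f g [fd fk] [gd gk]; split => //.
- by move=> x; exact: differentiableD.
- by move=> x; exact: differentiableD.
move=> i; rewrite (_ : partial i _ = fun x => partial i f x + partial i g x).
  by apply: ih; [exact: fk|exact: gk].
apply/funext => x; apply/partial_is_derive/is_derive_funD; exact: is_derive_partial.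
Qed.

Lemma times_differentiableM k f g : times_differentiable k f ->
  times_differentiable k g -> times_differentiable k (fun x => f x * g x).
Proof.
elim: k f g => [|k ih] f g fk gk.
  by split => // x; apply: differentiableM; [case: fk|case: gk].
have fd x := times_differentiable_differentiable x fk.
have gd x := times_differentiable_differentiable x gk.
split; first by move=> x; exact: differentiableM.
move=> i.
rewrite (_ : partial i _ = fun x => f x * partial i g x + g x * partial i f x).
  apply: times_differentiableD; apply: ih.
  - exact: times_differentiable_weaken.
  - by case: gk => _; exact.
  - exact: times_differentiable_weaken.
  - by case: fk => _; exact.
by apply/funext => x; apply/partial_is_derive/is_derive_funM; exact: is_derive_partial.
Qed.

Lemma times_differentiable_sum k (I : Type) (s : seq I) (F : I -> 'rV[R]_n -> R) :
  (forall a, times_differentiable k (F a)) ->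
  times_differentiable k (fun x => \sum_(a <- s) F a x).
Proof.
move=> h; elim: s => [|a s ih].
  by under eq_fun do rewrite big_nil; exact: times_differentiable_cst.
by under eq_fun do rewrite big_cons; exact: times_differentiableD.
Qed.

Lemma times_differentiable_prod k (I : Type) (s : seq I) (F : I -> 'rV[R]_n -> R) :
  (forall a, times_differentiable k (F a)) ->
  times_differentiable k (fun x => \prod_(a <- s) F a x).
Proof.
move=> h; elim: s => [|a s ih].
  by under eq_fun do rewrite big_nil; exact: times_differentiable_cst.
by under eq_fun do rewrite big_cons; exact: times_differentiableM.
Qed.

Lemma is_derive_coord i j x :
  is_derive x (unit_rV i) (fun y : 'rV[R]_n => y ord0 j) (i == j)%:R.
Proof.
have d : differentiable (fun y : 'rV[R]_n => y ord0 j) x.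
  exact: differentiable_coord.
apply/is_derive_lineP; rewrite (_ : (fun _ => _) =
    (fun h : R => (i == j)%:R * h + x ord0 j)).
  have := @is_derive_affine _ id (i == j)%:R (x ord0 j) 0 1.
  by rewrite mul1r; apply.
by apply/funext => h; rewrite !mxE eqxx/= eq_sym mulrC.
Qed.

Lemma times_differentiable_coord k (F : R -> R) j : smooth1 F ->
  times_differentiable k (fun x => F (x ord0 j)).
Proof.
elim: k F => [|k ih] F sF; split => //.
- move=> x; apply: (@differentiable_comp _ _ _ _ (fun y : 'rV[R]_n => y ord0 j) F).
    exact: differentiable_coord.
  by apply/derivable1_diffP; case: (smooth1_is_derive sF (x ord0 j)).
- move=> x; apply: (@differentiable_comp _ _ _ _ (fun y : 'rV[R]_n => y ord0 j) F).
    exact: differentiable_coord.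
  by apply/derivable1_diffP; case: (smooth1_is_derive sF (x ord0 j)).
move=> i; rewrite (_ : partial i _ = fun x => derive1 F (x ord0 j) * (i == j)%:R).
  apply: times_differentiableM; last exact: times_differentiable_cst.
  exact/ih/smooth1_derive1.
apply/funext => x; apply: partial_is_derive.
exact: (is_derive_fun_comp (is_derive_coord i j x) (smooth1_is_derive sF _)).
Qed.

End smooth_rV.

(** * Approximation by smooth functions *)

Section lattice.
Context {R : realType} {n : nat}.
Variables (N : nat) (h : R).
Hypothesis h0 : 0 < h.
Implicit Types (F : 'rV[R]_n -> R) (x y : 'rV[R]_n) (i j : 'I_n).
Implicit Types k : {ffun 'I_n -> 'I_(N + N).+1}.

Let pos k i : R := (k i)%:R - N%:R.

Definition node k : 'rV[R]_n := \row_i (h * pos k i).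

(** One-dimensional factors of the partition of unity attached to the lattice
    of mesh h. *)
Definition bump k i x : R := hat (h^-1 * x ord0 i - pos k i).

Definition weight k x : R := \prod_i bump k i x.

Definition lattice_approx F x : R := \sum_k F (node k) * weight k x.

Lemma bump_ge0 k i x : 0 <= bump k i x.
Proof. exact: hat_ge0. Qed.

Lemma times_differentiable_bump m k i : times_differentiable m (bump k i).
Proof.
apply: (@times_differentiable_coord _ _ _ (fun t => hat (h^-1 * t - pos k i))).
by move=> l; apply: times_derivable_affine; exact: smooth1_hat.
Qed.

Lemma times_differentiable_lattice_approx m F :
  times_differentiable m (lattice_approx F).
Proof.
apply: times_differentiable_sum => k; apply: times_differentiableM.
  exact: times_differentiable_cst.
by apply: times_differentiable_prod => i; exact: times_differentiable_bump.
Qed.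

Lemma weight_ge0 k x : 0 <= weight k x.
Proof. by apply: prodr_ge0 => i _; exact: bump_ge0. Qed.

Lemma weight_neq0 k x : weight k x != 0 -> `|x - node k| < h.
Proof.
move=> wk; apply: rV_norm_lt => // i; rewrite !mxE ltNge; apply: contra wk => hx.
rewrite /weight (bigD1 i)//= {1}/bump hat_eq0 ?mul0r//.
rewrite (_ : _ - _ = h^-1 * (x ord0 i - h * pos k i)); last by field; rewrite gt_eqF.
by rewrite normrM gtr0_norm ?invr_gt0// ler_pdivlMl// mulr1.
Qed.

Lemma sum_weight x : `|x| <= N%:R * h -> \sum_k weight k x = 1.
Proof.
move=> xN; rewrite /weight /bump -(bigA_distr_bigA (fun i (a : 'I_(N + N).+1) =>
  hat (h^-1 * x ord0 i - (a%:R - N%:R))))/=.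
rewrite big1// => i _; apply: sum_hat.
rewrite normrM gtr0_norm ?invr_gt0// ler_pdivrMl// mulrC.
exact: le_trans (coord_le_norm x i) xN.
Qed.

Lemma lattice_approx_dist F x (y e : R) : `|x| <= N%:R * h ->
  (forall z, `|x - z| < h -> `|F z - y| <= e) -> `|lattice_approx F x - y| <= e.
Proof.
move=> xN Fy; rewrite -[y]mulr1 -(sum_weight xN) mulr_sumr -sumrB.
under eq_bigr do rewrite -mulrBl.
rewrite (le_trans (ler_norm_sum _ _ _))// -[leRHS]mulr1 -(sum_weight xN) mulr_sumr.
apply: ler_sum => k _; rewrite normrM (ger0_norm (weight_ge0 _ _)).
have [->|wk] := eqVneq (weight k x) 0; first by rewrite !mulr0.
by rewrite ler_wpM2r ?weight_ge0//; apply: Fy; exact: weight_neq0.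
Qed.

Lemma lattice_approx_eq0 F x : (forall z, `|x - z| < h -> F z = 0) ->
  lattice_approx F x = 0.
Proof.
move=> F0; rewrite /lattice_approx big1// => k _.
have [->|wk] := eqVneq (weight k x) 0; first by rewrite mulr0.
by rewrite F0 ?mul0r//; exact: weight_neq0.
Qed.

(** A primitive in one direction is obtained by replacing a single factor of
    each weight by its primitive, so that it is again smooth. *)
Lemma lattice_approx_primitive F j (b : R) : exists2 P : 'rV[R]_n -> R,
    (forall m, times_differentiable m P) &
    (forall x, is_derive x (unit_rV j) P (lattice_approx F x)) /\
    forall x, x ord0 j = b -> P x = 0.
Proof.
have [H dH] := @hat_antiderivative R.
have sH : smooth1 H := smooth1_antiderivative dH smooth1_hat.
pose G k (t : R) := h * (H (h^-1 * t - pos k j) - H (h^-1 * b - pos k j)).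
have sG k : smooth1 (G k).
  move=> m; apply: times_derivableM; first exact: times_derivable_cst.
  apply: times_derivableD; last exact: times_derivable_cst.
  exact: times_derivable_affine.
have dG k (t : R) : is_derive t 1 (G k) (hat (h^-1 * t - pos k j)).
  have := is_derive_affine (dH (h^-1 * t - pos k j)).
  move=> /is_derive_funD/(_ (is_derive_cst (- H (h^-1 * b - pos k j)) _ _)) d.
  have := is_derive_funM (is_derive_cst h t 1) d.
  by move=> /is_derive_eq; apply; rewrite /cst mulr0 !addr0; field; rewrite gt_eqF.
pose rest k x := \prod_(i | i != j) bump k i x.
pose P x := \sum_k F (node k) * (G k (x ord0 j) * rest k x).
have dGj k x : is_derive x (unit_rV j) (fun y => G k (y ord0 j)) (bump k j x).
  have := is_derive_fun_comp (is_derive_coord j j x) (dG k (x ord0 j)).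
  by rewrite eqxx mulr1.
(* the remaining factors do not depend on the coordinate j *)
have drest k x : is_derive x (unit_rV j) (rest k) 0.
  rewrite /rest; elim: (index_enum _) => [|i s ih].
    by under eq_fun do rewrite big_nil; exact: is_derive_cst.
  under eq_fun do rewrite big_cons.
  case ij: (i != j) => //.
  have di : is_derive x (unit_rV j) (bump k i) 0.
    have := is_derive_fun_comp (is_derive_coord j i x)
      (is_derive_affine (smooth1_is_derive smooth1_hat (h^-1 * x ord0 i - pos k i))).
    by rewrite eq_sym (negbTE ij) mulr0.
  by have := is_derive_funM di ih; rewrite !mulr0 addr0.
exists P.
  move=> m; apply: times_differentiable_sum => k.
  apply: times_differentiableM; first exact: times_differentiable_cst.
  apply: times_differentiableM; first exact: times_differentiable_coord.
  rewrite /rest; under eq_fun do rewrite big_mkcond/=.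
  apply: times_differentiable_prod => i; case: (i != j).
    exact: times_differentiable_bump.
  exact: times_differentiable_cst.
split=> [x|x xb]; last first.
  by rewrite /P big1// => k _; rewrite xb /G subrr mulr0 mul0r mulr0.
rewrite /P /lattice_approx; elim: (index_enum _) => [|k s ih].
  rewrite big_nil.
  by under eq_fun do rewrite big_nil; exact: is_derive_cst.
rewrite big_cons.
under eq_fun do rewrite big_cons.
apply: is_derive_funD => //.
have := is_derive_funM (is_derive_cst (F (node k)) x (unit_rV j))
  (is_derive_funM (dGj k x) (drest k x)).
move=> /is_derive_eq; apply.
by rewrite /cst !mulr0 add0r addr0 /weight [in RHS](bigD1 j)//= [rest _ _ * _]mulrC.
Qed.

End lattice.

Section compactness.
Context {R : realType}.

Lemma compact_continuous_bounded (T : topologicalType) (f : T -> R) (A : set T) :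
  compact A -> {within A, continuous f} ->
  exists2 C, 0 <= C & forall x, A x -> `|f x| <= C.
Proof.
move=> cA fA; have [->|A0] := eqVneq A set0; first by exists 0.
have /(compact_EVT_max _ cA)[|c _ fc] : {within A, continuous (fun x => `|f x|)}.
- by move=> x; apply: cvg_norm; exact: fA.
- exact/set0P.
by exists `|f c| => // x Ax; apply: fc; rewrite inE.
Qed.

Lemma compact_pos_min (T : topologicalType) (f : T -> R) (A : set T) :
  compact A -> {within A, continuous f} -> (forall x, A x -> 0 < f x) ->
  exists2 c, 0 < c & forall x, A x -> c <= f x.
Proof.
move=> cA fA f0; have [->|A0] := eqVneq A set0; first by exists 1.
have [|c + fc] := compact_EVT_min _ cA fA; first exact/set0P.
by rewrite inE => /f0 fc0; exists (f c) => // x Ax; apply: fc; rewrite inE.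
Qed.

Context {n : nat}.
Implicit Types (K Omega : set 'rV[R]_n).

Lemma compact_thickening K Omega : compact K -> open Omega -> K `<=` Omega ->
  exists2 r, 0 < r & forall x y, K x -> `|x - y| < r -> Omega y.
Proof.
move=> /compact_near_coveringP cK oO KO.
pose P (r : R) (x : 'rV[R]_n) := forall y, `|x - y| < r -> Omega y.
have KP : \forall r \near 0^'+, K `<=` P r.
  apply: cK => x Kx.
  have /nbhs_ballP[d /= d0 dO] := open_nbhs_nbhs (conj oO (KO _ Kx)).
  near=> x' r => y xy; apply: dO; rewrite ball_rVE.
  have xx' : `|x - x'| < d / 2.
    by rewrite -ball_rVE; near: x'; apply: nbhsx_ballx; exact: divr_gt0.
  have rd : r < d / 2 by near: r; apply: nbhs_right_lt; exact: divr_gt0.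
  rewrite (_ : x - y = (x - x') + (x' - y)); last by rewrite addrA subrK.
  by rewrite (le_lt_trans (ler_normD _ _))// [ltRHS]splitr ltrD// (lt_trans xy).
have [r [/= r0 Pr]] := filter_ex (filterI (nbhs_right_gt 0) KP).
by exists r => // x y Kx; exact: Pr.
Unshelve. all: by end_near. Qed.

Lemma compact_rV_norm_le K : compact K ->
  exists2 M, 0 <= M & forall x, K x -> `|x| <= M.
Proof.
move=> cK; have cn : {within K, continuous (fun x : 'rV[R]_n => `|x|)}.
  by apply: continuous_subspaceT => x; exact: norm_continuous.
have [M M0 KM] := compact_continuous_bounded cK cn.
by exists M => // x /KM; rewrite normr_id.
Qed.

Lemma uniform_modulus (f : 'rV[R]_n -> R) (B e : R) : continuous f -> 0 < e ->
  exists2 d, 0 < d &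
    forall x y, `|x| <= B -> `|x - y| < d -> `|f y - f x| <= e.
Proof.
move=> cf e0; pose A := [set x : 'rV[R]_n | `|x| <= B].
have /compact_near_coveringP cA : compact A.
  apply: bounded_closed_compact.
    exists B; split; first exact: num_real.
    by move=> M BM x /= xB; exact: le_trans (ltW BM).
  by apply: (@closed_comp _ _ (fun x : 'rV[R]_n => `|x|) [set y | y <= B]) => [x _|];
    [exact: norm_continuous|exact: closed_le].
pose P (r : R) (x : 'rV[R]_n) := forall y, `|x - y| < r -> `|f y - f x| <= e.
have AP : \forall r \near 0^'+, A `<=` P r.
  apply: cA => x Ax.
  have /cvgrPdist_lt/(_ (e / 2) (divr_gt0 e0 (ltr0n _ 2)))/nbhs_ballP[d /= d0 dO] := cf x.
  near=> x' r => y xy.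
  have xx' : `|x - x'| < d / 2.
    by rewrite -ball_rVE; near: x'; apply: nbhsx_ballx; exact: divr_gt0.
  have rd : r < d / 2 by near: r; apply: nbhs_right_lt; exact: divr_gt0.
  have fx' : `|f x - f x'| < e / 2.
    by apply: dO; rewrite ball_rVE (lt_trans xx')// ltr_pdivrMr// ltr_pMr// ltr1n.
  have fy : `|f x - f y| < e / 2.
    apply: dO; rewrite ball_rVE (_ : x - y = (x - x') + (x' - y)); last by rewrite addrA subrK.
    by rewrite (le_lt_trans (ler_normD _ _))// [ltRHS]splitr ltrD// (lt_trans xy).
  rewrite (_ : f y - f x' = (f x - f x') - (f x - f y)); last by ring.
  by rewrite (le_trans (ler_normB _ _))// [leRHS]splitr ltW// ltrD.
have [r [/= r0 Pr]] := filter_ex (filterI (nbhs_right_gt 0) AP).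
by exists r => // x y Ax; exact: Pr.
Unshelve. all: by end_near. Qed.

End compactness.

Section test_function_approx.
Context {R : realType} {n : nat}.
Implicit Types (K Omega : set 'rV[R]_n) (x y : 'rV[R]_n) (j : 'I_n).

Lemma exists_lattice_size (h B : R) : 0 < h -> exists N : nat, B <= N%:R * h.
Proof.
move=> h0; exists (Num.bound `|B / h|); rewrite -ler_pdivrMr// ltW//.
by rewrite (le_lt_trans (ler_norm _))// archi_boundP.
Qed.

Lemma norm_le_dist x y : `|y| <= `|x| + `|x - y|.
Proof. by rewrite -[X in `|X| <= _](subKr x) ler_normB. Qed.

(** Smooth cutoff: a lattice approximation of the indicator of a neighborhood
    of K. *)
Lemma smooth_cutoff K (r : R) : compact K -> 0 < r ->
  exists2 chi : 'rV[R]_n -> R, (forall m, times_differentiable m chi) &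
    (forall x y, K x -> `|x - y| < r / 4 -> chi y = 1) /\
    (forall y, chi y != 0 -> exists2 x, K x & `|x - y| < 3 * r / 4).
Proof.
move=> cK r0; have [M M0 KM] := compact_rV_norm_le cK.
(* the mesh r/4 leaves chi equal to 1 up to distance r/4 of K, and supported
   within distance 3r/4 *)
pose F y : R := (`[< exists2 x, K x & `|x - y| < r / 2 >])%:R.
have h0 : 0 < r / 4 by rewrite divr_gt0.
have [N hN] := exists_lattice_size (M + r) h0.
exists (lattice_approx N (r / 4) F).
  by move=> m; exact: times_differentiable_lattice_approx.
split=> [x y Kx xy|y].
  apply/eqP; rewrite -subr_eq0 -normr_le0; apply: lattice_approx_dist => // [|z yz].
    apply: le_trans hN; have := norm_le_dist x y; move: (KM _ Kx); lra.
  rewrite /F; case: asboolP => [_|[]]; first by rewrite subrr normr0.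
  by exists x => //; rewrite (le_lt_trans (ler_distD y _ _))//; lra.
apply: contraPP => nK; apply/negP; rewrite negbK; apply/eqP.
apply: lattice_approx_eq0 => // z yz; rewrite /F; case: asboolP => // -[x Kx xz].
exfalso; apply: nK; exists x => //.
by rewrite (le_lt_trans (ler_distD z _ _))// [`|z - y|]distrC; lra.
Qed.

(** Along direction j a function is recovered from its partial derivative by the
    mean value theorem, starting from a point outside of the support. *)
Lemma directional_bound (f g : 'rV[R]_n -> R) j (B e : R) : 0 <= B ->
  (forall x, is_derive x (unit_rV j) f (g x)) ->
  (forall x, x ord0 j = - B -> f x = 0) ->
  (forall x, `|x| <= B -> `|g x| <= e) ->
  forall x, `|x| <= B -> `|f x| <= e * (2 * B).
Proof.
move=> B0 fg f0 ge x xB.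
pose x0 := x - (x ord0 j + B) *: unit_rV j.
pose c := x ord0 j + B.
have xj : `|x ord0 j| <= B := le_trans (coord_le_norm x j) xB.
have c0 : 0 <= c by move: xj; rewrite ler_norml /c => /andP[]; lra.
have c2 : c <= 2 * B by move: xj; rewrite ler_norml /c => /andP[]; lra.
have dline (t : R) : is_derive t 1 (fun h : R => f (h *: unit_rV j + x0))
    (g (t *: unit_rV j + x0)).
  exact: is_derive_line.
have [|t tc] := @MVT_segment R (fun h : R => f (h *: unit_rV j + x0))
    (fun t => g (t *: unit_rV j + x0)) 0 c c0.
  apply: continuous_subspaceT => t.
  by apply/differentiable_continuous/derivable1_diffP; case: (dline t).
rewrite scale0r add0r (f0 x0); last by rewrite /x0 !mxE !eqxx mulr1; ring.
rewrite !subr0 (_ : c *: unit_rV j + x0 = x); last by rewrite /x0 addrC subrK.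
move=> ->; rewrite normrM (ger0_norm c0).
have gt : `|g (t *: unit_rV j + x0)| <= e.
  apply/ge/rV_norm_le => // i; rewrite /x0 !mxE eqxx/=.
  have [ij|ij] := eqVneq i j; last first.
    rewrite mulr0 mulr0 subr0 add0r; exact: le_trans (coord_le_norm x i) xB.
  rewrite ij !mulr1 ler_norml; move: tc; rewrite in_itv/= /c => /andP[t0 tc].
  by move: xj; rewrite ler_norml => /andP[]; lra.
have e0 : 0 <= e := le_trans (normr_ge0 _) gt.
exact: ler_pM.
Qed.

(** Test functions are dense, for the convergence that matters to a single weak
    derivative, among compactly supported functions with a continuous partial
    derivative in that direction: approximate the derivative, integrate it in
    its direction and cut off. *)
Lemma test_function_approx Omega K (zeta eta : 'rV[R]_n -> R) j (e : R) :
  open Omega -> compact K -> K `<=` Omega -> (forall x, ~ K x -> zeta x = 0) ->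
  (forall x, is_derive x (unit_rV j) zeta (eta x)) -> continuous eta -> 0 < e ->
  exists2 phi, test_function Omega phi &
    forall x, `|phi x - zeta x| <= e /\ `|partial j phi x - eta x| <= e.
Proof.
move=> oO cK KO zeta0 dzeta ceta e0.
have [r r0 rO] := compact_thickening cK oO KO.
have [M M0 KM] := compact_rV_norm_le cK.
have [chi schi [chi1 chi0]] := smooth_cutoff cK r0.
(* K and the support of chi lie inside the cube of half-side B, on one face
   of which the primitive P below starts from 0 *)
pose B := M + r + 1.
have B0 : 0 < B by rewrite /B; lra.
have chi0B x : B < `|x| -> chi x = 0.
  move=> Bx; apply/eqP/negPn/negP => /chi0[y Ky yx].
  by move: (norm_le_dist y x) (KM _ Ky) Bx; rewrite /B; lra.
have cB : compact [set x : 'rV[R]_n | `|x| <= B].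
  apply: bounded_closed_compact.
    exists B; split; first exact: num_real.
    by move=> A BA x /= xB; exact: le_trans (ltW BA).
  apply: (@closed_comp _ _ (fun x : 'rV[R]_n => `|x|) [set y | y <= B]).
    by move=> x _; exact: norm_continuous.
  exact: closed_le.
have chic x : differentiable chi x := times_differentiable_differentiable x (schi 0%N).
have dchic : continuous (partial j chi).
  by move=> x; apply: differentiable_continuous; case: (schi 1%N) => _ /(_ j)[].
have [C1 C10 hC1] := compact_continuous_bounded cB
  (continuous_subspaceT (fun x => differentiable_continuous (chic x))).
have [C2 C20 hC2] := compact_continuous_bounded cB (continuous_subspaceT dchic).
pose C := C1 + C2 + 1.
pose d := e / (C * (2 * B + 1)).
have CB0 : 0 < C * (2 * B + 1) by rewrite mulr_gt0// /C; lra.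
have d0 : 0 < d by rewrite divr_gt0.
have [h h0 hh] := uniform_modulus B ceta d0.
have [N hN] := exists_lattice_size B h0.
have [P sP [dP P0]] := lattice_approx_primitive N h0 eta j (- B).
have Qeta x : `|x| <= B -> `|lattice_approx N h eta x - eta x| <= d.
  move=> xB; apply: lattice_approx_dist => //; first exact: le_trans hN.
  by move=> z xz; exact: hh.
have Pzeta x : `|x| <= B -> `|P x - zeta x| <= d * (2 * B).
  apply: (@directional_bound (fun x => P x - zeta x)
    (fun x => lattice_approx N h eta x - eta x) j B d (ltW B0)) => //.
  move=> y yB; rewrite P0// zeta0 ?subrr// => /KM.
  have := coord_le_norm y j; rewrite yB normrN (gtr0_norm B0) /B.
  lra.
have sphi m : times_differentiable m (fun x => chi x * P x).
  exact: times_differentiableM.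
exists (fun x => chi x * P x).
  have supp : closure [set x | chi x * P x != 0] `<=`
      [set y | exists2 x, K x & `|x - y| < r].
    move=> y /(_ (ball y (r / 4)))[|z [/= + ]].
      by apply: nbhsx_ballx; rewrite divr_gt0.
    rewrite mulf_eq0 negb_or => /andP[/chi0[x Kx xz] _].
    rewrite ball_rVE => yz; exists x => //.
    by rewrite (le_lt_trans (ler_distD z _ _))// [`|z - y|]distrC; lra.
  split; first exact: smoothP.
  - apply: bounded_closed_compact; last exact: closed_closure.
    exists (M + r); split; first exact: num_real.
    move=> A MA y /supp[x Kx xy].
    rewrite /=; move: (norm_le_dist x y) (KM _ Kx) MA; lra.
  - by move=> y /supp[x Kx xy]; exact: rO Kx xy.
have eC : d * C * (2 * B + 1) = e by rewrite /d -mulrA divfK// gt_eqF.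
have [C1C C2C] : C1 <= C /\ C2 <= C by rewrite /C; split; lra.
have C1' : 1 <= C by rewrite /C; lra.
(* chi = 1 near K and zeta = 0 off K, so that the error is chi (P - zeta) and,
   for the derivative, chi (Q - eta) + (P - zeta) d_j chi *)
move=> x; split.
  have [xB|xB] := leP `|x| B; last first.
    rewrite chi0B// mul0r zeta0 ?subrr ?normr0 ?ltW//.
    by move/KM; move: xB; rewrite /B; lra.
  rewrite (_ : _ - _ = chi x * (P x - zeta x)); last first.
    have [Kx|/zeta0 ->] := pselect (K x); last by ring.
    by rewrite (chi1 x x Kx) ?subrr ?normr0 ?divr_gt0//; ring.
  rewrite normrM -eC.
  have h1 := ler_pM (normr_ge0 _) (normr_ge0 _) (hC1 x xB) (Pzeta x xB).
  apply: (le_trans h1); rewrite (_ : d * C * _ = C * (d * (2 * B + 1))); last by ring.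
  apply: ler_pM => //; first by rewrite mulr_ge0 ?(ltW d0)// mulr_ge0 ?(ltW B0).
  by rewrite ler_wpM2l ?ltW//; lra.
have dphi : is_derive x (unit_rV j) (fun y => chi y * P y)
    (chi x * lattice_approx N h eta x + P x * partial j chi x).
  by apply: is_derive_funM => //; exact: is_derive_partial.
rewrite (partial_is_derive dphi).
have eta0 y : ~ K y -> eta y = 0.
  move=> nKy; apply/esym.
  have K0 : \forall z \near y, 0 = zeta z.
    have oK : open (~` K) by apply: closed_openC; exact: compact_closed.
    have := open_nbhs_nbhs (conj oK (nKy : (~` K) y)).
    by apply: filterS => z /zeta0 ->.
  have := near_eq_is_derive K0 (is_derive_cst 0 y (unit_rV j)).
  by case=> _ <-; case: (dzeta y).
have [Kx|nKx] := pselect (K x); last first.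
  rewrite (eta0 x nKx) subr0.
  have [xB|xB] := leP `|x| B; last first.
    rewrite (chi0B x xB) mul0r add0r.
    rewrite (_ : partial j chi x = 0) ?mulr0 ?normr0 ?ltW//.
    apply: partial_is_derive.
    have c0 : \forall z \near x, 0 = chi z.
      near=> z; rewrite chi0B//; near: z.
      apply: (@cvgr_gt _ _ _ _ (fun z : 'rV[R]_n => `|z|)) xB.
      exact: norm_continuous.
    exact: near_eq_is_derive c0 (is_derive_cst 0 x (unit_rV j)).
  have := Qeta x xB; rewrite (eta0 x nKx) subr0 => Qx.
  have := Pzeta x xB; rewrite (zeta0 x nKx) subr0 => Px.
  rewrite (le_trans (ler_normD _ _))// !normrM -eC.
  have h1 := ler_pM (normr_ge0 _) (normr_ge0 _) (le_trans (hC1 x xB) C1C) Qx.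
  have h2 := ler_pM (normr_ge0 _) (normr_ge0 _) Px (le_trans (hC2 x xB) C2C).
  by apply: le_trans (lerD h1 h2) _; rewrite le_eqVlt; apply/orP; left; apply/eqP; ring.
have xB : `|x| <= B by move: (KM _ Kx); rewrite /B; lra.
rewrite (chi1 x x Kx) ?subrr ?normr0 ?divr_gt0//.
rewrite (_ : partial j chi x = 0).
  rewrite mul1r mulr0 addr0; apply: le_trans (Qeta x xB) _.
  rewrite -eC -mulrA ler_peMr ?(ltW d0)//.
  by rewrite -[leLHS]mulr1; apply: ler_pM => //; lra.
apply: partial_is_derive.
have c1 : \forall z \near x, 1 = chi z.
  near=> z; rewrite (chi1 x z Kx)// -ball_rVE; near: z.
  by apply: nbhsx_ballx; exact: divr_gt0.
exact: (near_eq_is_derive c1 (is_derive_cst (1 : R) x (unit_rV j))).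
Unshelve. all: by end_near. Qed.

End test_function_approx.

(** * Measurability and integrability on bounded open sets *)

Section measure_rV.
Context {R : realType}.

Lemma measurable_cube n (q : 'rV[R]_n) (r : R) :
  measurable [set x : 'rV[R]_n | forall i, `|x ord0 i - q ord0 i| < r].
Proof.
rewrite (_ : [set x | _] = \bigcap_(i in [set: 'I_n])
    [set x : 'rV[R]_n | `|x ord0 i - q ord0 i| < r]); last first.
  by apply/seteqP; split=> [x xr i _|x xr i]; [exact: xr|exact: (xr i)].
apply: fin_bigcap_measurable => // i _.
have := @measurable_coord_rV R n i measurableT
  [set t : R | `|t - q ord0 i| < r].
rewrite setTI; apply; apply: open_measurable.
rewrite (_ : [set t | _] = ball (q ord0 i) r); first exact: ball_open.
by apply/seteqP; split => t; rewrite -ball_normE/= distrC.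
Qed.

(** Every open set is a countable union of cubes with rational center and side. *)
Lemma open_measurable_rV n (A : set 'rV[R]_n) : open A -> measurable A.
Proof.
move=> oA; pose qr (q : 'rV[rat]_n) : 'rV[R]_n := map_mx ratr q.
pose cube (z : 'rV[rat]_n * nat) :=
  [set x : 'rV[R]_n | forall i, `|x ord0 i - qr z.1 ord0 i| < z.2.+1%:R^-1].
pose good z : set 'rV[R]_n := if `[< cube z `<=` A >] then cube z else set0.
rewrite (_ : A = \bigcup_z good z).
  apply: countable_bigcupT_measurable; first exact: countableP.
  by move=> z; rewrite /good; case: ifP => [_|//]; exact: measurable_cube.
apply/seteqP; split=> [x Ax|x [z _]]; last first.
  by rewrite /good; case: asboolP => // + zx; apply.
have /nbhs_ballP[r /= r0 rA] := open_nbhs_nbhs (conj oA Ax).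
pose m := Num.bound (2 / r).
have m0 : 0 < m.+1%:R :> R by rewrite ltr0n.
have mr : m.+1%:R^-1 < r / 2.
  rewrite -[r / 2]invrK ltf_pV2 ?posrE ?invr_gt0 ?divr_gt0// invf_div.
  have := @archi_boundP R (2 / r); rewrite divr_ge0 ?(ltW r0)// => /(_ isT) h.
  by rewrite (lt_le_trans h)// ler_nat.
have /choice[q hq] : forall i, exists q : rat, `|x ord0 i - ratr q| < m.+1%:R^-1.
  move=> i; have [|q] := @rat_in_itvoo R (x ord0 i - m.+1%:R^-1) (x ord0 i + m.+1%:R^-1).
    by rewrite ltrBlDr -addrA ltrDl addr_gt0 ?invr_gt0.
  by rewrite in_itv/= => hq; exists q; rewrite distrC ltr_distl.
exists (\row_i q i, m) => //; rewrite /good.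
case: asboolP => [_ i|[]]; first by rewrite !mxE; exact: hq.
move=> y /= yq; apply: rA; rewrite ball_rVE; apply: rV_norm_lt => // i.
have := yq i; rewrite !mxE => yi.
rewrite (le_lt_trans (ler_distD (ratr (q i)) _ _))// [ltRHS]splitr.
by rewrite ltrD//; [apply: lt_trans (hq i) mr|rewrite distrC; apply: lt_trans yi mr].
Qed.

Lemma measurable_cube0 n (M : R) :
  measurable [set x : 'rV[R]_n | forall i, `|x ord0 i| < M].
Proof.
rewrite (_ : [set x | _] = [set x : 'rV[R]_n | forall i,
  `|x ord0 i - (0 : 'rV[R]_n) ord0 i| < M]); first exact: measurable_cube.
by apply/seteqP; split=> x h i; have := h i; rewrite mxE subr0.
Qed.

(** The preimage of a cube under the map adding one coordinate is the product of
    an interval and a cube. *)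
Lemma lebesgue_rV_cube_lty n (M : R) :
  (lebesgue_rV n [set x : 'rV[R]_n | forall i, (`|x ord0 i| < M)%R] < +oo)%E.
Proof.
elim: n => [|n ih] /=; first by rewrite diracE ltry.
rewrite /lebesgue_rV_step /pushforward /=.
rewrite (_ : _ @^-1` _ = `]- M, M[ `*`
    [set x : 'rV[R]_n | forall i, `|x ord0 i| < M]); last first.
  apply/seteqP; split=> [[t x] /= h|[t x] /= [tM xM] i].
    split=> [|i]; last by have := h (lift ord0 i); rewrite cons_rVES.
    by have := h ord0; rewrite cons_rVE0 in_itv/= ltr_norml.
  case: (unliftP ord0 i) => [j ->|->]; first by rewrite cons_rVES; exact: xM.
  by rewrite cons_rVE0; move: tM; rewrite in_itv/= ltr_norml.
rewrite product_measure1E//; last exact: measurable_cube0.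
pose I := `]- M, M[.
have oo : (lebesgue_measure [set` I] < +oo)%E.
  by rewrite lebesgue_measure_itv/=; case: ifP => _; rewrite ltry.
by rewrite lte_mul_pinfty// ge0_fin_numE.
Qed.

Context {n : nat}.
Implicit Types (Omega D : set 'rV[R]_n) (f g : 'rV[R]_n -> R).
Local Notation mu := (lebesgue_rV n).

Lemma bounded_lebesgue_rV_lty D : bounded_set D -> measurable D ->
  (mu D < +oo)%E.
Proof.
move=> [M [_ MD]] mD.
apply: le_lt_trans (lebesgue_rV_cube_lty n (M + 2)).
apply: le_measure; rewrite ?inE//.
  exact: measurable_cube0.
move=> x /(MD (M + 1)) /= xM i.
apply: le_lt_trans (coord_le_norm x i) _.
by rewrite (le_lt_trans (xM _))// ?ltrDl// ltrD2l ltr1n.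
Qed.

Lemma continuous_on_measurable Omega f : open Omega ->
  (forall x, Omega x -> {for x, continuous f}) -> measurable_fun Omega f.
Proof.
move=> oO cf mO; apply: (measurability _ (RGenOpens.measurableE R)) => //.
move=> _ [_ [a [b ->] <-]]; apply: open_measurable_rV.
rewrite openE => x [Ox fx]; apply: filterI; first exact: open_nbhs_nbhs.
apply: (cf x Ox); apply: open_nbhs_nbhs; split => //; exact: interval_open.
Qed.

End measure_rV.

Section Lp_rV.
Context {R : realType} {n : nat} (Omega : set 'rV[R]_n).
Hypotheses (oO : open Omega) (bO : bounded_set Omega).
Implicit Types (f g q : 'rV[R]_n -> R) (p : R).
Local Notation mu := (lebesgue_rV n).

Lemma measurable_Omega : measurable Omega.
Proof. exact: open_measurable_rV. Qed.
#[local] Hint Resolve measurable_Omega : core.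

Lemma lebesgue_Omega_lty : (mu Omega < +oo)%E.
Proof. exact: bounded_lebesgue_rV_lty. Qed.

Lemma inLp_measurable p f : inLp Omega p%:E f -> measurable_fun Omega f.
Proof.
rewrite /inLp inE => /andP[]; rewrite inE/= => mf _.
by apply/(measurable_restrictT _ measurable_Omega).
Qed.

Lemma inLp_integrable_powR p f : 1 <= p -> inLp Omega p%:E f ->
  mu.-integrable Omega (fun x => (`|f x| `^ p)%:E).
Proof.
move=> p1 /(Lfun_integrable p1) h.
have := integrableS measurableT measurable_Omega (@subsetT _ _) h.
by apply: eq_integrable => // x xO; rewrite patchE xO.
Qed.

Lemma inLp_intro p f : 1 <= p -> measurable_fun Omega f ->
  mu.-integrable Omega (fun x => (`|f x| `^ p)%:E) -> inLp Omega p%:E f.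
Proof.
move=> p1 mf fp; rewrite /inLp inE; apply/andP; split.
  by rewrite inE/=; apply/(measurable_restrictT _ measurable_Omega).
rewrite inE/= /finite_norm unlock /Lnorm; apply: poweR_lty.
have /integrableP[_] := (integrable_mkcond _ measurable_Omega).1 fp.
congr (_ < _)%E; apply: eq_integral => x _ /=; rewrite !patchE.
case: ifPn => _; last by rewrite normr0 abse0 powR0// gt_eqF// (lt_le_trans ltr01).
by rewrite gee0_abs// lee_fin powR_ge0.
Qed.

Lemma inLp_integrable p f : 1 <= p -> inLp Omega p%:E f ->
  mu.-integrable Omega (EFin \o f).
Proof.
move=> p1 fp; have mf := inLp_measurable fp.
have i1 : mu.-integrable Omega (EFin \o cst (1 : R)).
  apply/integrableP; split; first by apply/measurable_EFinP; exact: measurable_cst.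
  under eq_integral do rewrite /= normr1.
  by rewrite integral_cst// mul1e lebesgue_Omega_lty.
apply: le_integrable (integrableD _ i1 (inLp_integrable_powR p1 fp)) => //.
  exact/measurable_EFinP.
move=> x Ox /=; rewrite lee_fin [leRHS]ger0_norm ?addr_ge0 ?powR_ge0//.
have [f1|f1] := leP `|f x| 1; first by rewrite (le_trans f1)// lerDl powR_ge0.
by rewrite (le_trans (le1r_powR (ltW f1) p1))// lerDr.
Qed.

Lemma integrable_bounded_mul f q : mu.-integrable Omega (EFin \o f) ->
  measurable_fun Omega q -> (exists C, forall x, Omega x -> `|q x| <= C) ->
  mu.-integrable Omega (EFin \o (fun x => f x * q x)).
Proof.
move=> fi mq [C qC]; apply: (@integrableMl _ _ _ mu Omega _ (EFin \o f) q) => //.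
exists C; split; first exact: num_real.
by move=> M CM x Ox; exact: le_trans (qC x Ox) (ltW CM).
Qed.

Lemma inLp_bounded_mul p f q : 1 <= p -> inLp Omega p%:E f ->
  measurable_fun Omega q -> (exists C, forall x, Omega x -> `|q x| <= C) ->
  inLp Omega p%:E (fun x => q x * f x).
Proof.
move=> p1 fp mq [C qC]; have mf := inLp_measurable fp.
have mqf : measurable_fun Omega (fun x => q x * f x) by exact: measurable_funM.
apply: inLp_intro => //.
apply: le_integrable (integrableZl _ (`|C| `^ p) (inLp_integrable_powR p1 fp)) => //.
  apply/measurable_EFinP; apply: (measurableT_comp (measurable_powR _)).
  exact: measurableT_comp.
move=> x Ox /=; rewrite lee_fin [leLHS]ger0_norm ?powR_ge0// [leRHS]ger0_norm ?mulr_ge0 ?powR_ge0//.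
rewrite -powRM// ge0_ler_powR ?nnegrE ?mulr_ge0//; first exact: le_trans ler01 p1.
by rewrite normrM ler_wpM2r// (le_trans (qC x Ox))// ler_norm.
Qed.

Lemma inLp_bounded p q : 1 <= p -> measurable_fun Omega q ->
  (exists C, forall x, Omega x -> `|q x| <= C) -> inLp Omega p%:E q.
Proof.
move=> p1 mq bq; have : inLp Omega p%:E (fun x => q x * 1).
  apply: inLp_bounded_mul => //; apply: inLp_intro => //.
  under eq_fun do rewrite normr1 powR1.
  apply/integrableP; split; first by apply/measurable_EFinP; exact: measurable_cst.
  under eq_integral do rewrite /= normr1.
  by rewrite integral_cst// mul1e lebesgue_Omega_lty.
by under eq_fun do rewrite mulr1.
Qed.

Lemma inLpD p f g : 1 <= p -> inLp Omega p%:E f -> inLp Omega p%:E g ->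
  inLp Omega p%:E (fun x => f x + g x).
Proof.
move=> p1 fp gp; have p1' : (1 <= p%:E)%E by rewrite lee_fin.
have [_ /(_ _ _ fp gp)] := Lfun_addr_closed mu p1'.
rewrite /inLp (_ : f \_ Omega + g \_ Omega = (fun x => f x + g x) \_ Omega)//.
by apply/funext => x; rewrite fctE !patchE; case: ifP => // _; rewrite addr0.
Qed.

Lemma inLpZ p f c : 1 <= p -> inLp Omega p%:E f ->
  inLp Omega p%:E (fun x => c * f x).
Proof.
move=> p1 fp; apply: (@inLp_bounded_mul p f (cst c)) => //.
by exists `|c|.
Qed.

End Lp_rV.

(** * Weak derivatives against functions of class C^1, and the product rule *)

Section weak_derivative.
Context {R : realType} {n : nat} (Omega : set 'rV[R]_n).
Hypotheses (oO : open Omega) (bO : bounded_set Omega).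
Implicit Types (f g q zeta eta : 'rV[R]_n -> R) (j : 'I_n).
Local Notation mu := (lebesgue_rV n).
#[local] Hint Extern 0 (measurable Omega) => exact: measurable_Omega : core.

Lemma bounded_closure_compact : compact (closure Omega).
Proof.
apply: bounded_closed_compact; last exact: closed_closure.
have [M [Mr MO]] := bO; exists M; split => // A MA x Ox.
have cl : closed [set y : 'rV[R]_n | `|y| <= A].
  apply: (@closed_comp _ _ (fun x : 'rV[R]_n => `|x|) [set y | y <= A]).
    by move=> y _; exact: norm_continuous.
  exact: closed_le.
suff sub : closure Omega `<=` [set y : 'rV[R]_n | `|y| <= A] by exact: sub.
move/closure_id : cl => ->; apply: closure_subset => y Oy; exact: MO.
Qed.

Lemma continuous_bounded q : continuous q ->
  exists C, forall x, Omega x -> `|q x| <= C.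
Proof.
move=> cq; have [C _ qC] := compact_continuous_bounded bounded_closure_compact
  (continuous_subspaceT cq).
by exists C => x Ox; apply: qC; exact: subset_closure.
Qed.

Lemma integrable_continuous_mul f q : mu.-integrable Omega (EFin \o f) ->
  continuous q -> mu.-integrable Omega (EFin \o (fun x => f x * q x)).
Proof.
move=> fi cq; apply: integrable_bounded_mul => //; last exact: continuous_bounded.
by apply: continuous_on_measurable => // x _; exact: cq.
Qed.

Lemma Rintegral_mul_le f q (e : R) : mu.-integrable Omega (EFin \o f) ->
  continuous q -> (forall x, `|q x| <= e) ->
  `|\int[mu]_(x in Omega) (f x * q x)| <= e * \int[mu]_(x in Omega) `|f x|.
Proof.
move=> fi cq qe; have fqi := integrable_continuous_mul fi cq.
have nfi : mu.-integrable Omega (EFin \o (fun x => `|f x|)).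
  by have := integrable_abse fi; apply: eq_integrable.
apply: le_trans (le_normr_Rintegral _ fqi) _ => //.
rewrite -RintegralZl//; apply: le_Rintegral => //.
- by have := integrable_abse fqi; apply: eq_integrable.
- by have := integrableZl (measurable_Omega oO) e nfi; apply: eq_integrable.
- by move=> x _; rewrite normrM mulrC ler_wpM2r.
Qed.

Lemma smooth_continuous f : smooth f -> continuous f.
Proof. by move=> sf x; apply: differentiable_continuous; exact: (sf [::]). Qed.

Lemma smooth_partial_continuous f j : smooth f -> continuous (partial j f).
Proof. by move=> sf x; apply: differentiable_continuous; exact: (sf [:: j]). Qed.

(** Integration by parts is a closed condition for uniform convergence of the
    test function and of its derivative. *)
Lemma weak_partial_C1 (K : set 'rV[R]_n) f g zeta eta j :
  mu.-integrable Omega (EFin \o f) -> mu.-integrable Omega (EFin \o g) ->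
  weak_partial Omega j f g ->
  compact K -> K `<=` Omega -> (forall x, ~ K x -> zeta x = 0) ->
  (forall x, is_derive x (unit_rV j) zeta (eta x)) ->
  continuous zeta -> continuous eta ->
  \int[mu]_(x in Omega) (f x * eta x) = - \int[mu]_(x in Omega) (g x * zeta x).
Proof.
move=> fi gi fg cK KO zeta0 dzeta czeta ceta.
apply/eqP; rewrite -addr_eq0 -normr_le0; apply/ler_addgt0Pr => e e0; rewrite add0r.
set D := _ + _.
pose I := \int[mu]_(x in Omega) `|f x| + \int[mu]_(x in Omega) `|g x|.
have I0 : 0 <= I by apply: addr_ge0; apply: Rintegral_ge0.
pose d := e / (I + 1).
have d0 : 0 < d by rewrite divr_gt0// ltr_wpDl.
have [phi tphi phid] := test_function_approx oO cK KO zeta0 dzeta ceta d0.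
have [sphi _ _] := tphi.
have cphi := smooth_continuous sphi.
have cdphi := @smooth_partial_continuous _ j sphi.
have cB (a b : 'rV[R]_n -> R) : continuous a -> continuous b ->
    continuous (fun x => a x - b x).
  by move=> ca cb x; exact: (continuousB (ca x) (cb x)).
have DE : D = (- \int[mu]_(x in Omega) (f x * (partial j phi x - eta x))) -
    \int[mu]_(x in Omega) (g x * (phi x - zeta x)).
  under [in RHS]eq_Rintegral do rewrite mulrBr.
  under [X in _ - X]eq_Rintegral do rewrite mulrBr.
  rewrite !RintegralB//; try exact: integrable_continuous_mul.
  rewrite (fg _ tphi) /D. ring.
have h1 := Rintegral_mul_le fi (cB _ _ cdphi ceta) (fun x => (phid x).2).
have h2 := Rintegral_mul_le gi (cB _ _ cphi czeta) (fun x => (phid x).1).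
rewrite DE (le_trans (ler_normB _ _))// normrN (le_trans (lerD h1 h2))//.
rewrite -mulrDr -/I /d mulrAC ler_pdivrMr ?ltr_wpDl//.
by rewrite ler_wpM2l ?(ltW e0)// lerDl.
Qed.

Lemma near0_continuous_at (h : 'rV[R]_n -> R) x :
  (\forall y \near x, h y = 0) -> {for x, continuous h}.
Proof.
move=> h0; have e := nbhs_singleton h0; have : h @ x --> (0 : R).
  by apply: (@cvg_near_cst _ R 0 h _ _ h0).
by rewrite -{1}e.
Qed.

(** The product of a test function by a function of class C^1 on Omega is a
    legitimate test function by the previous lemma. *)
Lemma weak_partial_mul q dq f g j :
  mu.-integrable Omega (EFin \o f) -> mu.-integrable Omega (EFin \o g) ->
  weak_partial Omega j f g ->
  (forall x, Omega x -> {for x, continuous q}) ->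
  (forall x, Omega x -> {for x, continuous dq}) ->
  (forall x, Omega x -> is_derive x (unit_rV j) q (dq x)) ->
  weak_partial Omega j (fun x => q x * f x) (fun x => dq x * f x + q x * g x).
Proof.
move=> fi gi fg cq cdq dqE phi tphi.
have [sphi cK KO] := tphi.
set K := closure _ in cK KO.
have cphi := smooth_continuous sphi.
have cdphi := @smooth_partial_continuous _ j sphi.
have dphi x : is_derive x (unit_rV j) phi (partial j phi x).
  by apply: is_derive_partial; exact: (sphi [::]).
have nearK x : ~ K x -> \forall y \near x, ~ K y.
  move=> nK; have oC : open (~` K) by apply: closed_openC; exact: closed_closure.
  exact: open_nbhs_nbhs (conj oC (nK : (~` K) x)).
have phi0 y : ~ K y -> phi y = 0.
  by move=> nK; apply/eqP/negPn/negP => y0; apply: nK; exact: subset_closure.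
have phi0n x : ~ K x -> \forall y \near x, 0 = phi y.
  by move=> /nearK; apply: filterS => y /phi0.
have dphi0 y : ~ K y -> partial j phi y = 0.
  move=> /phi0n h; apply: partial_is_derive.
  exact: (near_eq_is_derive h (is_derive_cst (0 : R) y (unit_rV j))).
have inO (h : 'rV[R]_n -> R) : (forall x, Omega x -> {for x, continuous h}) ->
    (forall y, ~ K y -> h y = 0) -> continuous h.
  move=> ch h0 x; have [Ox|nO] := pselect (Omega x); first exact: ch.
  have nK : ~ K x by move=> /KO.
  by apply: near0_continuous_at; apply: filterS (nearK x nK).
have cz1 : continuous (fun x => phi x * q x).
  by apply: inO => [x Ox|y /phi0 ->]; [exact: (continuousM (cphi x) (cq x Ox))|rewrite mul0r].
have cz2 : continuous (fun x => phi x * dq x).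
  by apply: inO => [x Ox|y /phi0 ->]; [exact: (continuousM (cphi x) (cdq x Ox))|rewrite mul0r].
have cz3 : continuous (fun x => q x * partial j phi x).
  by apply: inO => [x Ox|y /dphi0 ->]; [exact: (continuousM (cq x Ox) (cdphi x))|rewrite mulr0].
have dz x : is_derive x (unit_rV j) (fun x => phi x * q x)
    (phi x * dq x + q x * partial j phi x).
  have [Ox|nO] := pselect (Omega x).
    exact: (is_derive_funM (dphi x) (dqE x Ox)).
  have nK : ~ K x by move=> /KO.
  rewrite phi0// dphi0// mul0r mulr0 addr0.
  have h : \forall y \near x, 0 = phi y * q y.
    by apply: filterS (nearK x nK) => y /phi0 ->; rewrite mul0r.
  exact: (near_eq_is_derive h (is_derive_cst (0 : R) x (unit_rV j))).
have czd : continuous (fun x => phi x * dq x + q x * partial j phi x).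
  by move=> x; exact: (continuousD (cz2 x) (cz3 x)).
have zeta0 x : ~ K x -> phi x * q x = 0 by move=> /phi0 ->; rewrite mul0r.
have I1 := weak_partial_C1 fi gi fg cK KO zeta0 dz cz1 czd.
have D1 : \int[mu]_(x in Omega) (f x * (phi x * dq x + q x * partial j phi x)) =
    \int[mu]_(x in Omega) (f x * (phi x * dq x)) +
    \int[mu]_(x in Omega) (f x * (q x * partial j phi x)).
  under eq_Rintegral do rewrite mulrDr.
  by rewrite RintegralD//; do ?exact: integrable_continuous_mul.
have D2 : \int[mu]_(x in Omega) ((dq x * f x + q x * g x) * phi x) =
    \int[mu]_(x in Omega) (f x * (phi x * dq x)) +
    \int[mu]_(x in Omega) (g x * (phi x * q x)).
  rewrite -RintegralD//; do ?exact: integrable_continuous_mul.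
  by apply: eq_Rintegral => x _; ring.
rewrite D2; under eq_Rintegral do rewrite mulrAC mulrC.
by move: I1; rewrite D1 => I1; rewrite opprD -I1; ring.
Qed.

End weak_derivative.

(** * Comparison at the boundary *)

Section C1_criterion.
Context {R : realType} {n : nat}.
Implicit Types (f : 'rV[R]_n -> R) (g : 'I_n -> 'rV[R]_n -> R) (x v w : 'rV[R]_n).

Lemma is_derive_scale f x v (c d : R) :
  is_derive x v f d -> is_derive x (c *: v) f (c * d).
Proof.
move=> /is_derive_lineP fd; apply: (is_derive_lineP f x (c *: v) (c * d)).2.
rewrite (_ : (fun _ => _) = (fun t : R => (fun h : R => f (h *: v + x)) (c * t + 0))).
  rewrite mulrC; apply: (@is_derive_affine _ (fun h : R => f (h *: v + x)) c 0 0 d).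
  by rewrite mulr0 addr0.
by apply/funext => t /=; rewrite addr0 scalerA mulrC.
Qed.

(** Mean value theorem, one coordinate at a time. *)
Lemma partial_increment f g x (d e : R) : 0 <= e ->
  (forall i y, `|x - y| < d -> is_derive y (unit_rV i) f (g i y)) ->
  (forall i y, `|x - y| < d -> `|g i y - g i x| <= e) ->
  forall w, `|w| < d ->
  `|f (w + x) - f x - \sum_i w ord0 i * g i x| <= e * \sum_i `|w ord0 i|.
Proof.
move=> e0 fg ge w wd.
pose tr (m : nat) : 'rV[R]_n := \row_i (if (i < m)%N then w ord0 i else 0).
suff h m : (m <= n)%N ->
  `|f (tr m + x) - f x - \sum_(i < n | (i < m)%N) w ord0 i * g i x|
    <= e * \sum_(i < n | (i < m)%N) `|w ord0 i|.
  have trn : tr n = w by apply/rowP => i; rewrite mxE ltn_ord.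
  have := h n (leqnn n); rewrite trn.
  by under eq_bigl do rewrite ltn_ord; under [X in _ <= e * X -> _]eq_bigl do rewrite ltn_ord.
elim: m => [|m ih] mn.
  rewrite !big_pred0 ?mulr0 ?subr0//.
  rewrite (_ : tr 0%N = 0) ?add0r ?subrr ?normr0//.
  by apply/rowP => i; rewrite !mxE.
pose k := Ordinal mn.
have trS : tr m.+1 = w ord0 k *: unit_rV k + tr m.
  apply/rowP => i; rewrite !mxE eqxx/= ltnS leq_eqVlt.
  have [im|im] := eqVneq (i : nat) m.
    have -> : i = k by apply/val_inj.
    by rewrite eqxx mulr1 /= ltnn addr0.
  rewrite (_ : (i == k) = false) ?mulr0 ?add0r//.
  by apply/negbTE; apply: contra im => /eqP ->.
have kE (F : 'I_n -> R) : \sum_(i < n | (i < m.+1)%N) F i =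
    F k + \sum_(i < n | (i < m)%N) F i.
  rewrite (bigD1 k)//=; congr (_ + _); apply: eq_bigl => i.
  rewrite ltnS leq_eqVlt; have [im|im] := eqVneq (i : nat) m.
    have -> : i = k by apply/val_inj.
    by rewrite eqxx /= ltnn.
  by rewrite (_ : i != k) ?andbT//; apply: contra im => /eqP ->.
have trd t : 0 <= t <= 1 -> `|x - (t *: (w ord0 k *: unit_rV k) + (tr m + x))| < d.
  move=> /andP[t0 t1]; apply: le_lt_trans wd.
  rewrite addrA opprD addrCA subrr addr0 normrN.
  apply: rV_norm_le => // i; rewrite !mxE eqxx/=.
  have [im|im] := eqVneq (i : nat) m.
    have -> : i = k by apply/val_inj.
    rewrite eqxx mulr1 /= ltnn addr0 normrM ger0_norm//.
    by rewrite (le_trans _ (coord_le_norm w k))// ler_piMl.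
  rewrite (_ : (i == k) = false); last by apply/negbTE; apply: contra im => /eqP ->.
  rewrite !mulr0 add0r; case: ifP => _; first exact: coord_le_norm.
  by rewrite normr0.
pose F t := f (t *: (w ord0 k *: unit_rV k) + (tr m + x)).
pose dF t := w ord0 k * g k (t *: (w ord0 k *: unit_rV k) + (tr m + x)).
have FdF (t : R) : 0 <= t <= 1 -> is_derive t 1 F (dF t).
  by move=> /trd td; apply: is_derive_line; apply: is_derive_scale; exact: fg.
have [||t] := @MVT_segment R F dF 0 1 ler01.
- by move=> t; rewrite in_itv/= => /andP[t0 t1]; apply: FdF; rewrite !ltW.
- apply: continuous_in_subspaceT => t; rewrite inE/= in_itv/= => t01.
  by apply/differentiable_continuous/derivable1_diffP; case: (FdF t t01).
rewrite in_itv/= subr0 mulr1 => t01 Ft.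
have -> : f (tr m.+1 + x) = F 1 by rewrite /F scale1r trS addrA.
rewrite !kE mulrDr.
rewrite (_ : _ - _ - _ = (F 1 - F 0 - w ord0 k * g k x) +
  (f (tr m + x) - f x - \sum_(i < n | (i < m)%N) w ord0 i * g i x)); last first.
  by rewrite /F scale0r add0r; ring.
apply: le_trans (ler_normD _ _) _; apply: lerD; last exact: ih (ltnW mn).
rewrite Ft /dF -mulrBr normrM mulrC ler_wpM2r//; apply: ge; exact: trd.
Qed.

(** Continuous partial derivatives give all the directional ones. *)
Lemma C1_is_derive f g x v :
  (forall i, \forall y \near x, is_derive y (unit_rV i) f (g i y)) ->
  (forall i, {for x, continuous (g i)}) ->
  is_derive x v f (\sum_i v ord0 i * g i x).
Proof.
move=> fg cg.
pose L := \sum_i v ord0 i * g i x.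
pose S := \sum_i `|v ord0 i|.
have S0 : 0 <= S by exact: sumr_ge0.
have cv : h^-1 *: (f (h *: v + x) - f x) @[h --> 0^'] --> L.
  apply/cvgrPdist_le => e e0.
  pose e' := e / (S + 1).
  have e'0 : 0 < e' by rewrite divr_gt0// ltr_wpDl.
  have [d d0 dP] : exists2 d : R, 0 < d & forall y, `|x - y| < d ->
      forall i, is_derive y (unit_rV i) f (g i y) /\ `|g i y - g i x| <= e'.
    pose A i y := is_derive y (unit_rV i) f (g i y) /\ `|g i y - g i x| <= e'.
    have nA i : \forall y \near x, A i y.
      by apply: filterI; [exact: fg|have /cvgrPdistC_le/(_ e' e'0) := cg i].
    have /nbhs_ballP[d d0 dP] : nbhs x [set y | forall i, A i y].
      exact: filter_forall _ nA.
    by exists d => // y xy; apply: dP; rewrite ball_rVE.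
  near=> h.
  have h0 : h != 0 by near: h; exact: nbhs_dnbhs_neq.
  have hv : `|h *: v| < d.
    rewrite normrZ; apply: (@le_lt_trans _ _ (`|h| * (`|v| + 1))).
      by rewrite ler_wpM2l// lerDl.
    rewrite -ltr_pdivlMr ?ltr_wpDl//; near: h; apply: dnbhs0_lt.
    by rewrite divr_gt0// ltr_wpDl.
  have := partial_increment (ltW e'0) (fun i y xy => (dP y xy i).1)
    (fun i y xy => (dP y xy i).2) hv.
  under eq_bigr do rewrite mxE -mulrA.
  under [X in _ <= _ * X]eq_bigr do rewrite mxE normrM.
  rewrite -!mulr_sumr -/L -/S => inc.
  rewrite distrC -(@ler_pM2l _ `|h|) ?normr_gt0// -normrM mulrBr.
  rewrite -[_ *: _]/(_ * _) mulrA divff// mul1r (le_trans inc)//.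
  rewrite mulrCA ler_wpM2l// /e' mulrAC ler_pdivrMr ?ltr_wpDl//.
  by rewrite ler_wpM2l ?(ltW e0)// lerDl.
split; first by apply/cvg_ex; exists L.
exact/cvg_lim.
Unshelve. all: by end_near. Qed.

End C1_criterion.

Lemma cvg_ord_sum {R : realType} {m : nat} {T : Type} {F : set_system T}
    {FF : Filter F} (h : 'I_m -> T -> R) (l : 'I_m -> R) :
  (forall i, h i @ F --> l i) -> \sum_i h i x @[x --> F] --> \sum_i l i.
Proof.
move=> hl; elim: (index_enum _) => [|i s ih].
  by under eq_fun do rewrite big_nil; rewrite big_nil; exact: cvg_cst.
by under eq_fun do rewrite big_cons; rewrite big_cons; apply: cvgD.
Qed.

Lemma continuous_ord_sum {R : realType} {m : nat} {T : topologicalType}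
    (h : 'I_m -> T -> R) (x : T) : (forall i, {for x, continuous (h i)}) ->
  {for x, continuous (fun y => \sum_i h i y)}.
Proof. exact: cvg_ord_sum. Qed.

Section boundary_comparison.
Context {R : realType} {n : nat} (Omega : set 'rV[R]_n) (p : R).
Hypothesis oO : open Omega.
Implicit Types (v psi : sobolev2 Omega p) (x N : 'rV[R]_n).

Lemma sob_continuous_at v x : Omega x -> {for x, continuous v}.
Proof.
move=> Ox; have cv : {within Omega, continuous v}.
  by apply: (continuous_subspaceW _ (@sob_val_cont _ _ _ _ v)); exact: subset_closure.
by move: cv; rewrite continuous_open_subspace// => /(_ x); apply; rewrite inE.
Qed.

Lemma sob_grad_continuous_at v i x : Omega x -> {for x, continuous (sob_grad v i)}.
Proof.
move=> Ox; have cv : {within Omega, continuous (sob_grad v i)}.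
  by apply: (continuous_subspaceW _ (@sob_grad_cont _ _ _ _ v i)); exact: subset_closure.
by move: cv; rewrite continuous_open_subspace// => /(_ x); apply; rewrite inE.
Qed.

Lemma sob_is_derive v x N : Omega x ->
  is_derive x N v (\sum_i N ord0 i * sob_grad v i x).
Proof.
move=> Ox; apply: (@C1_is_derive _ _ v (sob_grad v)) => i; last exact: sob_grad_continuous_at.
have := open_nbhs_nbhs (conj oO Ox); apply: filterS => y Oy.
exact: sob_grad_classical.
Qed.

Lemma within_line_continuous (f : 'rV[R]_n -> R) (A : set 'rV[R]_n) x N (b : R) :
  {within A, continuous f} -> (forall t, 0 <= t <= b -> A (t *: N + x)) ->
  {within `[0, b], continuous (fun t : R => f (t *: N + x))}.
Proof.
move=> /subspace_continuousP cf lA; apply/subspace_continuousP => t /=.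
rewrite in_itv/= => t0b P /(cf _ (lA t t0b)) fP.
have cl : {for t, continuous (fun t : R => t *: N + x)}.
  apply: (@continuousD _ _ _ (fun t : R => t *: N) (fun=> x)); last exact: cst_continuous.
  exact: scalel_continuous.
change (nbhs t [set s : R | `[0, b]%classic s -> P (f (s *: N + x))]).
have h : nbhs t [set s : R | A (s *: N + x) -> P (f (s *: N + x))] := cl _ fP.
apply: filterS h => s /= sP; rewrite in_itv/= => s0b.
exact: sP (lA s s0b).
Qed.

(** Near a boundary point, Omega is swept by short segments that leave it in
    the direction of the outward normal. Hopf's lemma makes v + s psi decrease
    along them, for s large, and it is nonnegative where they hit the boundary. *)
Lemma local_boundary_comparison v psi x0 : C11_boundary Omega ->
  (forall x, boundary Omega x -> 0 <= v x) ->
  (forall x, boundary Omega x -> 0 <= psi x) ->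
  (forall x0 nu, boundary Omega x0 -> outward_normal Omega x0 nu ->
     normal_derivative psi nu x0 < 0) ->
  boundary Omega x0 ->
  exists2 s, 0 <= s & \forall x \near x0, Omega x -> 0 <= v x + s * psi x.
Proof.
move=> C11 v0 psi0 hopf bx0.
have [e [gam chart]] := C11 _ bx0.
have [ee gamN dgam [Lip lip] [r r0 Or]] := chart.
pose N : 'rV[R]_n := \row_i partial i gam x0 - e.
have cgam i : continuous (partial i gam).
  move=> x; have : partial i gam y @[y --> x] --> partial i gam x; last exact.
  apply: (@cvgrPdist_le _ _ _ (nbhs x) _ _ _).2 => eps eps0; near=> y.
  rewrite (le_trans (lip i x y))//.
  have xy : `|x - y| <= eps / (`|Lip| + 1).
    apply/ltW; rewrite -ball_rVE; near: y; apply: nbhsx_ballx.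
    by rewrite divr_gt0// ltr_wpDl.
  apply: (@le_trans _ _ ((`|Lip| + 1) * `|x - y|)).
    by rewrite ler_wpM2r// (le_trans (ler_norm _))// lerDl.
  by rewrite mulrC -ler_pdivlMr// ltr_wpDl.
have dgamN x w : is_derive x w gam (\sum_i w ord0 i * partial i gam x).
  apply: (@C1_is_derive _ _ gam (fun i => partial i gam)) => i; last exact: cgam.
  by apply: (@nearW _ (nbhs x)) => y; exact: is_derive_partial.
have gam_e x : \sum_i e ord0 i * partial i gam x = 0.
  have c0 : is_derive x e gam 0.
    apply/is_derive_lineP; rewrite (_ : (fun _ => _) = cst (gam x)); first exact: is_derive_cst.
    by apply/funext => h; rewrite addrC gamN.
  by have [_ <-] := dgamN x e; have [_ ->] := c0.
pose NN := \sum_i N ord0 i * N ord0 i.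
have NE i : N ord0 i = partial i gam x0 - e ord0 i by rewrite !mxE.
have NN0 : 0 < NN.
  rewrite lt_neqAle sumr_ge0 ?andbT; last by move=> i _; rewrite -expr2 sqr_ge0.
  apply/eqP => NN0.
  have N0 i : N ord0 i = 0.
    have sq (j : 'I_n) : true -> 0 <= N ord0 j * N ord0 j by rewrite -expr2 sqr_ge0.
    by have /eqP := psumr_eq0P sq (esym NN0) (i := i) isT; rewrite mulf_eq0 orbb => /eqP.
  have : \sum_i e ord0 i * N ord0 i = 0 by apply: big1 => i _; rewrite N0 mulr0.
  under eq_bigr do rewrite NE mulrBr.
  rewrite sumrB gam_e sub0r => /eqP; rewrite oppr_eq0.
  by rewrite -[\sum_i _]/(dotr e e) ee oner_eq0.
pose S := \sum_i N ord0 i * sob_grad psi i x0.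
have S0 : S < 0.
  have := hopf x0 ((Num.sqrt (dotr N N))^-1 *: N) bx0.
  have onu : outward_normal Omega x0 ((Num.sqrt (dotr N N))^-1 *: N) by exists e, gam.
  move=> /(_ onu); rewrite /normal_derivative.
  under eq_bigr do rewrite mxE -mulrA.
  by rewrite -mulr_sumr -/S pmulr_rlt0// invr_gt0 sqrtr_gt0.
(* s makes the derivative of v + s psi along N negative at x0 *)
pose s := (`|\sum_i N ord0 i * sob_grad v i x0| + 1) / - S.
have s0 : 0 <= s by rewrite divr_ge0 ?addr_ge0// oppr_ge0 ltW.
pose D x := \sum_i N ord0 i * (sob_grad v i x + s * sob_grad psi i x).
have DE x : D x = \sum_i N ord0 i * sob_grad v i x + s * \sum_i N ord0 i * sob_grad psi i x.
  by rewrite /D mulr_sumr -big_split/=; apply: eq_bigr => i _; ring.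
have D0 : D x0 < 0.
  rewrite DE -/S /s invrN mulrN mulNr divfK ?lt_eqF// opprD addrA.
  by have := ler_norm (\sum_i N ord0 i * sob_grad v i x0); lra.
exists s => //.
have cx0 : closure Omega x0 by case: bx0.
have cD : {within closure Omega, continuous D}.
  move=> x; apply: cvg_ord_sum => i; apply: cvgM; first exact: cvg_cst.
  apply: cvgD; first exact: (@sob_grad_cont _ _ _ _ v i).
  by apply: cvgM; [exact: cvg_cst|exact: (@sob_grad_cont _ _ _ _ psi i)].
have [r1 r10 Dr1] : exists2 r1, 0 < r1 &
    forall x, closure Omega x -> `|x0 - x| < r1 -> D x < 0.
  have /subspace_continuousP/(_ x0 cx0)/cvgr_lt/(_ 0 D0) := cD.
  by move=> /nbhs_ballP[d d0 dP]; exists d => // x Ox x0x; apply: dP; rewrite ?ball_rVE.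
(* G is negative exactly in Omega, near x0, and increases along N *)
pose G x := gam x - dotr x e.
pose dG x := \sum_i N ord0 i * (partial i gam x - e ord0 i).
have GdG x : is_derive x N G (dG x).
  have de : is_derive x N (fun x => dotr x e) (\sum_i N ord0 i * e ord0 i).
    apply/is_derive_lineP.
    rewrite (_ : (fun _ => _) = (fun h : R => id (dotr N e * h + dotr x e))).
      by rewrite -[X in is_derive _ _ _ X]mul1r; exact: is_derive_affine.
    apply/funext => h; rewrite /dotr mulr_suml -big_split/=; apply: eq_bigr => i _.
    by rewrite !mxE; ring.
  have := is_deriveB (dgamN x N) de; rewrite -sumrB.
  by move=> /is_derive_eq; apply; apply: eq_bigr => i _; rewrite mulrBr.
have dG0 : dG x0 = NN by apply: eq_bigr => i _; rewrite NE.
have cdG : continuous dG.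
  move=> x; apply: (@continuous_ord_sum _ _ _
    (fun i x => N ord0 i * (partial i gam x - e ord0 i)) x) => i.
  apply: (@continuousM _ _ (cst (N ord0 i))); first exact: cst_continuous.
  by apply: (@continuousB _ _ _ _ (cst (e ord0 i))); [exact: cgam|exact: cst_continuous].
have [r2 r20 Gr2] : exists2 r2, 0 < r2 & forall x, `|x0 - x| < r2 -> NN / 2 < dG x.
  have h : NN / 2 < dG x0 by rewrite dG0 ltr_pdivrMr// ltr_pMr// ltr1n.
  have /cvgr_gt/(_ _ h) := cdG x0.
  by move=> /nbhs_ballP[d d0 dP]; exists d => // x x0x; apply: dP; rewrite ball_rVE.
(* t1 bounds the time needed to leave Omega along N from a point near x0 *)
pose rho := Num.min r (Num.min r1 r2).
have rho0 : 0 < rho by rewrite !lt_min r0 r10 r20.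
have [rhor rhor1 rhor2] : [/\ rho <= r, rho <= r1 & rho <= r2].
  by split; rewrite !ge_min lexx ?orbT.
have N1 : 0 < `|N| + 1 by rewrite ltr_wpDl.
pose t1 := rho / 2 / (`|N| + 1).
have t10 : 0 < t1 by rewrite !divr_gt0.
have seg x t : `|x0 - x| < rho / 2 -> 0 <= t <= t1 -> `|x0 - (t *: N + x)| < rho.
  move=> x0x /andP[t0 tt1]; rewrite opprD addrCA (le_lt_trans (ler_normD _ _))//.
  rewrite normrN normrZ ger0_norm// [ltRHS]splitr ler_ltD//.
  apply: (@le_trans _ _ (t1 * (`|N| + 1))); last by rewrite /t1 divfK// gt_eqF.
  by apply: ler_pM => //; rewrite lerDl.
have nOx0 : ~ Omega x0.
  by move=> Ox0; case: bx0 => _; apply; exact: open_nbhs_nbhs (conj oO Ox0).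
have Gx0 : 0 <= G x0.
  rewrite subr_ge0 leNgt; apply/negP => h; apply: nOx0.
  by apply/(Or x0 _) => //; exact: ballxx.
have cG : {for x0, continuous G}.
  apply: (@continuousB _ _ _ gam (fun x => dotr x e)).
    exact/differentiable_continuous.
  apply: (@continuous_ord_sum _ _ _ (fun i x => x ord0 i * e ord0 i)) => i.
  apply: (@continuousM _ _ (fun x : 'rV[R]_n => x ord0 i)); last exact: cst_continuous.
  exact: coord_continuous.
have Gt : - (NN / 2 * t1) < G x0.
  by rewrite (lt_le_trans _ Gx0)// oppr_lt0 mulr_gt0// divr_gt0.
have nG : nbhs x0 [set x | - (NN / 2 * t1) < G x] by have /cvgr_gt/(_ _ Gt) := cG.
have nB : nbhs x0 (ball x0 (rho / 2)) by apply: nbhsx_ballx; exact: divr_gt0.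
apply: filterS (filterI nG nB) => x [/= Gx]; rewrite ball_rVE => x0x Ox.
pose g t := G (t *: N + x).
have dg (t : R) : is_derive t 1 g (dG (t *: N + x)) by exact: is_derive_line.
have cg : continuous g.
  by move=> t; apply/differentiable_continuous/derivable1_diffP; case: (dg t).
have inO t : 0 <= t <= t1 -> Omega (t *: N + x) <-> g t < 0.
  move=> /(seg x t x0x) h; rewrite /g /G subr_lt0; apply: Or.
  by rewrite ball_rVE (lt_le_trans h).
have dGpos t : 0 <= t <= t1 -> NN / 2 < dG (t *: N + x).
  by move=> /(seg x t x0x) h; apply: Gr2; exact: lt_le_trans h rhor2.
have g0 : g 0 < 0 by apply/inO; rewrite ?lexx ?(ltW t10)// scale0r add0r.
have gt1 : 0 < g t1.
  have [|c] := @MVT_segment R g (fun t => dG (t *: N + x)) 0 t1 (ltW t10).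
    exact: continuous_subspaceT.
  rewrite in_itv/= => /dGpos dc; rewrite subr0 => /eqP; rewrite subr_eq => /eqP ->.
  have := Gx; rewrite -[x in G x]add0r -[0 in X in G X](scale0r N) -/(g 0).
  have : NN / 2 * t1 < dG (c *: N + x) * t1 by rewrite ltr_pM2r.
  by lra.
have [||c] := @IVT R g 0 t1 0 (ltW t10).
- exact: continuous_subspaceT.
- by rewrite ge_min le_max (ltW g0) (ltW gt1) orbT.
rewrite in_itv/= => /andP[c0 ct1] gc.
have {}c0 : 0 < c.
  by rewrite lt_neqAle c0 andbT; apply/eqP => c0'; rewrite -c0' in gc; move: g0; rewrite gc ltxx.
have Oc t : 0 <= t < c -> Omega (t *: N + x).
  move=> /andP[t0 tc]; apply/inO; first by rewrite t0 (le_trans (ltW tc)).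
  have [|d] := @MVT_segment R g (fun t => dG (t *: N + x)) t c (ltW tc).
    exact: continuous_subspaceT.
  rewrite in_itv/= => /andP[td dc] gE.
  have : 0 < dG (d *: N + x).
    rewrite (lt_trans _ (dGpos d _)) ?divr_gt0//.
    by rewrite (le_trans t0 td) (le_trans dc ct1).
  move=> dpos; have : 0 < dG (d *: N + x) * (c - t) by rewrite mulr_gt0// subr_gt0.
  by rewrite -gE gc sub0r oppr_gt0.
have clc : closure Omega (c *: N + x).
  apply: (@closed_cvg _ _ (c^'-) _ (fun t : R => t *: N + x) (closure Omega)).
  - exact: closed_closure.
  - near=> t; apply: subset_closure; apply: Oc.
    apply/andP; split; last by near: t; exact: nbhs_left_lt.
    by apply: ltW; near: t; exact: nbhs_left_gt.
  apply: cvg_at_left_filter.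
  apply: (@continuousD _ _ _ (fun t : R => t *: N) (fun=> x)); last exact: cst_continuous.
  exact: scalel_continuous.
have bc : boundary Omega (c *: N + x).
  split => // /interior_subset Oy.
  have := (inO c _).1 Oy; rewrite gc ltxx (ltW c0) ct1 => h.
  by have := h isT.
have clt t : 0 <= t <= c -> closure Omega (t *: N + x).
  move=> /andP[t0]; rewrite le_eqVlt => /predU1P[->//|tc].
  by apply: subset_closure; apply: Oc; rewrite t0.
pose V y := v y + s * psi y.
have cV : {within closure Omega, continuous V}.
  move=> y; apply: cvgD; first exact: (@sob_val_cont _ _ _ _ v).
  by apply: cvgM; [exact: cvg_cst|exact: (@sob_val_cont _ _ _ _ psi)].
have dV y : Omega y -> is_derive y N V (D y).
  move=> Oy; rewrite DE; apply: is_derive_funD; first exact: sob_is_derive.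
  have := is_derive_funM (is_derive_cst s y N) (sob_is_derive psi N Oy).
  by rewrite mulr0 addr0.
have [||t] := @MVT_segment R (fun t => V (t *: N + x)) (fun t => D (t *: N + x)) 0 c (ltW c0).
- move=> t; rewrite in_itv/= => /andP[t0 tc]; apply: is_derive_line.
  by apply: dV; apply: Oc; rewrite (ltW t0).
- exact: within_line_continuous cV clt.
rewrite in_itv/= subr0 scale0r add0r => tc Vc.
have Vc0 : 0 <= V (c *: N + x) by apply: addr_ge0; [exact: v0|rewrite mulr_ge0// psi0].
have : D (t *: N + x) * c <= 0.
  rewrite pmulr_lle0// ltW// Dr1//; first exact: clt.
  apply: lt_le_trans rhor1; apply: seg => //.
  by move: tc => /andP[-> tc]; rewrite (le_trans tc).
by rewrite -Vc -/(V x); lra.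
Unshelve. all: by end_near. Qed.

(** The local bounds are uniform by compactness, since they only improve when s
    increases. *)
Lemma boundary_comparison v psi : bounded_set Omega -> C11_boundary Omega ->
  (forall x, boundary Omega x -> 0 <= v x) ->
  (forall x, boundary Omega x -> 0 <= psi x) -> (forall x, Omega x -> 0 < psi x) ->
  (forall x0 nu, boundary Omega x0 -> outward_normal Omega x0 nu ->
     normal_derivative psi nu x0 < 0) ->
  exists2 s, 0 <= s & forall x, Omega x -> - (s * psi x) <= v x.
Proof.
move=> bO C11 v0 psi0 psi1 hopf.
have /compact_near_coveringP cK := bounded_closure_compact bO.
pose P (s : R) (x : 'rV[R]_n) := Omega x -> - (s * psi x) <= v x.
have loc x0 : closure Omega x0 ->
    exists2 s, 0 <= s & \forall x \near x0, Omega x -> 0 <= v x + s * psi x.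
  move=> cx0; have [Ox0|nO] := pselect (Omega x0); last first.
    by apply: local_boundary_comparison => //; split => // /interior_subset.
  have p0 := psi1 _ Ox0.
  exists (2 * (`|v x0| + 1) / psi x0); first by rewrite divr_ge0 ?(ltW p0)// mulr_ge0// addr_ge0.
  have n1 : nbhs x0 [set x | psi x0 / 2 < psi x].
    have h : psi x0 / 2 < psi x0 by rewrite ltr_pdivrMr// ltr_pMr// ltr1n.
    by have /cvgr_gt/(_ _ h) := @sob_continuous_at psi x0 Ox0.
  have n2 : nbhs x0 [set x | - (`|v x0| + 1) < v x].
    have h : - (`|v x0| + 1) < v x0.
      by have := ler_norm (- v x0); rewrite normrN; lra.
    by have /cvgr_gt/(_ _ h) := @sob_continuous_at v x0 Ox0.
  apply: filterS (filterI n1 n2) => x [/= h1 h2] _.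
  have : `|v x0| + 1 <= 2 * (`|v x0| + 1) / psi x0 * psi x.
    rewrite mulrAC ler_pdivlMr// [2 * _]mulrC -mulrA ler_wpM2l ?addr_ge0//.
    by lra.
  by lra.
have : \forall s \near +oo, closure Omega `<=` P s.
  apply: cK => x0 /loc[s0 s00 h].
  near=> x s.
  have hx : Omega x -> 0 <= v x + s0 * psi x by near: x.
  move=> Ox; have := hx Ox.
  have s0s : s0 <= s.
    by near: s; apply: nbhs_pinfty_ge; exact: num_real.
  have : s0 * psi x <= s * psi x by rewrite ler_wpM2r// ltW// psi1.
  by rewrite /=; lra.
move=> h; have [s [/= s0 Ps]] := filter_ex (filterI (nbhs_pinfty_ge (num_real (0 : R))) h).
by exists s => // x Ox; apply: Ps => //; exact: subset_closure.
Unshelve. all: by end_near. Qed.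

End boundary_comparison.

(** * Compactly supported functions of two Sobolev functions *)

Lemma near_eq_continuous {R : realType} {T : topologicalType} (f g : T -> R) (x : T) :
  (\forall y \near x, f y = g y) -> {for x, continuous f} -> {for x, continuous g}.
Proof.
move=> fg cf; have gx := nbhs_singleton fg.
have : g @ x --> f x by apply: cvg_trans cf; exact: near_eq_cvg.
by rewrite gx.
Qed.

Section sobolev_build.
Context {R : realType} {n : nat} (Omega : set 'rV[R]_n) (p : R).
Hypotheses (oO : open Omega) (bO : bounded_set Omega) (p1 : 1 <= p).
Implicit Types (v psi : sobolev2 Omega p) (f g q w P Q : 'rV[R]_n -> R).
Local Notation mu := (lebesgue_rV n).

Definition ext0 f : 'rV[R]_n -> R := fun x => if x \in Omega then f x else 0.

Lemma ext0E f x : Omega x -> ext0 f x = f x.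
Proof. by move=> Ox; rewrite /ext0 mem_set. Qed.

Lemma ext0_out f x : ~ Omega x -> ext0 f x = 0.
Proof. by move=> nO; rewrite /ext0 memNset. Qed.

Lemma eq_inLp f g : (forall x, Omega x -> f x = g x) ->
  inLp Omega p%:E f -> inLp Omega p%:E g.
Proof.
move=> fg; rewrite /inLp (_ : f \_ Omega = g \_ Omega)//.
by apply/funext => x; rewrite !patchE; case: ifPn => // /set_mem /fg.
Qed.

Lemma eq_weak_partial i f f' g g' : (forall x, Omega x -> f x = f' x) ->
  (forall x, Omega x -> g x = g' x) ->
  weak_partial Omega i f g -> weak_partial Omega i f' g'.
Proof.
move=> ff gg fg phi tphi.
transitivity (\int[mu]_(x in Omega) (f x * partial i phi x)).
  by apply: eq_Rintegral => x /set_mem Ox; rewrite ff.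
by rewrite fg//; congr (- _); apply: eq_Rintegral => x /set_mem Ox; rewrite gg.
Qed.

Lemma near_Omega x : Omega x -> \forall y \near x, Omega y.
Proof. by move=> Ox; exact: open_nbhs_nbhs (conj oO Ox). Qed.

Section support.
Variables (K : set 'rV[R]_n).
Hypotheses (cK : compact K) (KO : K `<=` Omega).

Lemma ext0_continuous f : (forall x, Omega x -> {for x, continuous f}) ->
  (forall x, Omega x -> ~ K x -> f x = 0) -> continuous (ext0 f).
Proof.
move=> cf f0 x; have [Ox|nO] := pselect (Omega x).
  have e : \forall y \near x, f y = ext0 f y.
    by have := near_Omega Ox; apply: filterS => y Oy; rewrite ext0E.
  exact: near_eq_continuous e (cf x Ox).
apply: near0_continuous_at.
have oC : open (~` K) by apply: closed_openC; exact: compact_closed.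
have nK : (~` K) x by move=> /KO.
have := open_nbhs_nbhs (conj oC nK); apply: filterS => y nKy.
by have [Oy|nOy] := pselect (Omega y); [rewrite ext0E// f0|rewrite ext0_out].
Qed.

Lemma supported_bounded f : (forall x, Omega x -> {for x, continuous f}) ->
  (forall x, Omega x -> ~ K x -> f x = 0) ->
  measurable_fun Omega f /\ exists C, forall x, Omega x -> `|f x| <= C.
Proof.
move=> cf f0; split; first exact: continuous_on_measurable.
have [C hC] := continuous_bounded bO (ext0_continuous cf f0).
by exists C => x Ox; rewrite -(ext0E f Ox); exact: hC.
Qed.

Lemma sob_grad_integrable v i : mu.-integrable Omega (EFin \o sob_grad v i).
Proof. exact: inLp_integrable p1 (sob_grad_Lp v i). Qed.

Lemma sob_hess_integrable v i j : mu.-integrable Omega (EFin \o sob_hess v i j).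
Proof. exact: inLp_integrable p1 (sob_hess_Lp v i j). Qed.

Lemma weak_partialD f f' g g' i :
  (forall q, continuous q -> mu.-integrable Omega (EFin \o (fun x => f x * q x))) ->
  (forall q, continuous q -> mu.-integrable Omega (EFin \o (fun x => f' x * q x))) ->
  (forall q, continuous q -> mu.-integrable Omega (EFin \o (fun x => g x * q x))) ->
  (forall q, continuous q -> mu.-integrable Omega (EFin \o (fun x => g' x * q x))) ->
  weak_partial Omega i f g -> weak_partial Omega i f' g' ->
  weak_partial Omega i (fun x => f x + f' x) (fun x => g x + g' x).
Proof.
move=> fi fi' gi gi' fg fg' phi tphi; have [sphi _ _] := tphi.
have c1 := smooth_continuous sphi; have c2 := @smooth_partial_continuous _ _ _ i sphi.
have mO := measurable_Omega oO.
under eq_Rintegral do rewrite mulrDl.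
under [in RHS]eq_Rintegral do rewrite mulrDl.
rewrite !RintegralD//; [|exact: gi|exact: gi'|exact: fi|exact: fi'].
by rewrite fg// fg'// opprD.
Qed.

(** If w has the gradient P grad v + Q grad psi with P and Q of class C^1 and
    everything is supported in K, then w belongs to W^{2,p}. The weak gradient
    of w is obtained from that of psi by the product rule applied to
    w = (w / psi) psi. *)
Lemma sobolev_build v psi w P Q (dP dQ : 'I_n -> 'rV[R]_n -> R) :
  (forall x, Omega x -> 0 < psi x) ->
  (forall x, Omega x -> {for x, continuous w}) ->
  (forall x, Omega x -> {for x, continuous P}) ->
  (forall x, Omega x -> {for x, continuous Q}) ->
  (forall j x, Omega x -> {for x, continuous (dP j)}) ->
  (forall j x, Omega x -> {for x, continuous (dQ j)}) ->
  (forall i x, Omega x ->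
    is_derive x (unit_rV i) w (P x * sob_grad v i x + Q x * sob_grad psi i x)) ->
  (forall i x, Omega x -> is_derive x (unit_rV i) P (dP i x)) ->
  (forall i x, Omega x -> is_derive x (unit_rV i) Q (dQ i x)) ->
  (forall x, Omega x -> ~ K x -> [/\ w x = 0, P x = 0 & Q x = 0]) ->
  (forall j x, Omega x -> ~ K x -> dP j x = 0 /\ dQ j x = 0) ->
  exists W : sobolev2 Omega p,
    [/\ forall x, Omega x -> W x = w x, forall x, ~ Omega x -> W x = 0,
        forall i x, Omega x ->
          sob_grad W i x = P x * sob_grad v i x + Q x * sob_grad psi i x &
        forall i j x, Omega x ->
          sob_hess W i j x = dP j x * sob_grad v i x + P x * sob_hess v i j x
            + (dQ j x * sob_grad psi i x + Q x * sob_hess psi i j x)].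
Proof.
move=> psi0 cw cP cQ cdP cdQ dw dPE dQE s0 ds0.
pose wi i x := P x * sob_grad v i x + Q x * sob_grad psi i x.
pose wij i j x := dP j x * sob_grad v i x + P x * sob_hess v i j x
            + (dQ j x * sob_grad psi i x + Q x * sob_hess psi i j x).
have w0 x : Omega x -> ~ K x -> w x = 0 by move=> Ox /(s0 x Ox)[].
have P0 x : Omega x -> ~ K x -> P x = 0 by move=> Ox /(s0 x Ox)[].
have Q0 x : Omega x -> ~ K x -> Q x = 0 by move=> Ox /(s0 x Ox)[].
have dP0 j x : Omega x -> ~ K x -> dP j x = 0 by move=> Ox /(ds0 j x Ox)[].
have dQ0 j x : Omega x -> ~ K x -> dQ j x = 0 by move=> Ox /(ds0 j x Ox)[].
have wi0 i x : Omega x -> ~ K x -> wi i x = 0.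
  by move=> Ox nK; rewrite /wi P0// Q0// !mul0r addr0.
have cwi i x : Omega x -> {for x, continuous (wi i)}.
  move=> Ox; apply: (@continuousD _ _ _ (fun x => P x * sob_grad v i x)).
    by apply: (@continuousM _ _ P); [exact: cP|exact: sob_grad_continuous_at].
  by apply: (@continuousM _ _ Q); [exact: cQ|exact: sob_grad_continuous_at].
have [mw bw] := supported_bounded cw w0.
have [mP bP] := supported_bounded cP P0.
have [mQ bQ] := supported_bounded cQ Q0.
have wLp : inLp Omega p%:E w by exact: inLp_bounded.
have wiLp i : inLp Omega p%:E (wi i).
  by have [] := supported_bounded (cwi i) (wi0 i); exact: inLp_bounded.
have wijLp i j : inLp Omega p%:E (wij i j).
  have [mdP bdP] := supported_bounded (cdP j) (dP0 j).
  have [mdQ bdQ] := supported_bounded (cdQ j) (dQ0 j).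
  apply: inLpD => //; apply: inLpD => //; apply: inLp_bounded_mul => //.
  - exact: sob_grad_Lp.
  - exact: sob_hess_Lp.
  - exact: sob_grad_Lp.
  - exact: sob_hess_Lp.
have e0 f x : Omega x -> f x = ext0 f x by move=> Ox; rewrite ext0E.
have wweak i : weak_partial Omega i w (wi i).
  pose r x := w x / psi x.
  pose dr x := w x * (- (psi x) ^- 2 * sob_grad psi i x) + (psi x)^-1 * wi i x.
  have cV x : Omega x -> {for x, continuous (fun x => (psi x)^-1)}.
    move=> Ox; apply: (@continuousV _ _ psi); first by rewrite gt_eqF// psi0.
    exact: sob_continuous_at.
  have cr x : Omega x -> {for x, continuous r}.
    by move=> Ox; apply: (@continuousM _ _ w); [exact: cw|exact: cV].
  have cdr x : Omega x -> {for x, continuous dr}.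
    move=> Ox; apply: (@continuousD _ _ _ (fun x => w x * (- (psi x) ^- 2 * sob_grad psi i x))).
      apply: (@continuousM _ _ w); first exact: cw.
      apply: (@continuousM _ _ (fun x => - (psi x) ^- 2)); last exact: sob_grad_continuous_at.
      apply: (@continuousN _ _ _ (fun x => (psi x) ^- 2)).
      rewrite (_ : (fun x => (psi x) ^- 2) = fun x => (psi x)^-1 * (psi x)^-1).
        by apply: (@continuousM _ _ (fun x => (psi x)^-1)); exact: cV.
      by apply/funext => y; rewrite -expr2 exprVn.
    by apply: (@continuousM _ _ (fun x => (psi x)^-1)); [exact: cV|exact: cwi].
  have drE x : Omega x -> is_derive x (unit_rV i) r (dr x).
    move=> Ox; have dV := @is_derive_funV _ _ psi x (unit_rV i) _
      (lt0r_neq0 (psi0 x Ox)) (sob_grad_classical psi i Ox).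
    exact: (is_derive_funM (dw i x Ox) dV).
  have := weak_partial_mul oO bO (inLp_integrable oO bO p1 (sob_val_Lp psi))
    (sob_grad_integrable psi i) (@sob_grad_weak _ _ _ _ psi i) cr cdr drE.
  apply: eq_weak_partial => x Ox; have := psi0 x Ox => px.
    by rewrite /r divfK// gt_eqF.
  by rewrite /dr /r; field; rewrite gt_eqF.
have wiweak i j : weak_partial Omega j (wi i) (wij i j).
  have hv := weak_partial_mul oO bO (sob_grad_integrable v i)
    (sob_hess_integrable v i j) (@sob_hess_weak _ _ _ _ v i j) cP (cdP j) (dPE j).
  have hp := weak_partial_mul oO bO (sob_grad_integrable psi i)
    (sob_hess_integrable psi i j) (@sob_hess_weak _ _ _ _ psi i j) cQ (cdQ j) (dQE j).
  have [mdP bdP] := supported_bounded (cdP j) (dP0 j).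
  have [mdQ bdQ] := supported_bounded (cdQ j) (dQ0 j).
  have ic f q : inLp Omega p%:E f -> continuous q ->
      mu.-integrable Omega (EFin \o (fun x => f x * q x)).
    move=> fp cq; apply: integrable_continuous_mul => //.
    exact: inLp_integrable fp.
  apply: weak_partialD hv hp => q cq; apply: ic => //.
  - by apply: inLp_bounded_mul => //; exact: sob_grad_Lp.
  - by apply: inLp_bounded_mul => //; exact: sob_grad_Lp.
  - apply: inLpD => //; apply: inLp_bounded_mul => //.
      exact: sob_grad_Lp.
    exact: sob_hess_Lp.
  - apply: inLpD => //; apply: inLp_bounded_mul => //.
      exact: sob_grad_Lp.
    exact: sob_hess_Lp.
unshelve eexists (@Sobolev2 R n Omega p (ext0 w) (fun i => ext0 (wi i)) (wij)
  (eq_inLp (e0 w) wLp) (fun i => eq_inLp (e0 (wi i)) (wiLp i)) wijLp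
  (fun i => eq_weak_partial (e0 w) (e0 (wi i)) (wweak i))
  (fun i j => eq_weak_partial (e0 (wi i)) (fun x _ => erefl) (wiweak i j))
  _ _ _).
- by apply: continuous_subspaceT; exact: ext0_continuous.
- by move=> i; apply: continuous_subspaceT; apply: ext0_continuous (cwi i) (wi0 i).
- move=> i x Ox /=; rewrite (ext0E _ Ox).
  have e : \forall y \near x, w y = ext0 w y.
    by have := near_Omega Ox; apply: filterS => y Oy; rewrite ext0E.
  exact: near_eq_is_derive e (dw i x Ox).
split => /= [x Ox|x nO|i x Ox|//]; first exact: ext0E.
- exact: ext0_out.
- exact: ext0E.
Qed.

End support.
End sobolev_build.

(** * The scalar comparison lemma *)

Section continuity_rules.
Context {R : realType} {T : topologicalType}.
Implicit Types (f g : T -> R) (x : T).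

Lemma for_continuousD f g x : {for x, continuous f} -> {for x, continuous g} ->
  {for x, continuous (fun y => f y + g y)}.
Proof. by move=> cf cg; apply: cvgD. Qed.

Lemma for_continuousM f g x : {for x, continuous f} -> {for x, continuous g} ->
  {for x, continuous (fun y => f y * g y)}.
Proof. by move=> cf cg; apply: cvgM. Qed.

Lemma for_continuousN f x : {for x, continuous f} ->
  {for x, continuous (fun y => - f y)}.
Proof. by move=> cf; apply: cvgN. Qed.

Lemma for_continuousV f x : f x != 0 -> {for x, continuous f} ->
  {for x, continuous (fun y => (f y)^-1)}.
Proof. by move=> f0 cf; apply: cvgV. Qed.

Lemma for_continuousX f k x : {for x, continuous f} ->
  {for x, continuous (fun y => f y ^+ k)}.
Proof.
elim: k => [|k ih] cf; first exact: cst_continuous.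
suff -> : (fun y => f y ^+ k.+1) = (fun y => f y * f y ^+ k).
  by apply: for_continuousM => //; exact: ih.
by apply/funext => y; rewrite exprS.
Qed.

Lemma for_continuous_cst (c : R) x : {for x, continuous (fun _ : T => c)}.
Proof. exact: cst_continuous. Qed.

Lemma for_continuous_comp f (F : R -> R) x : {for x, continuous f} ->
  continuous F -> {for x, continuous (fun y => F (f y))}.
Proof. by move=> cf cF; apply: continuous_comp => //; exact: cF. Qed.

End continuity_rules.

Section min_power.
Context {R : realType}.
Implicit Types t : R.

Lemma min0_continuous : continuous (fun t : R => Num.min t 0).
Proof. by move=> t; apply: continuous_min => //; exact: cst_continuous. Qed.

(** The cube of the negative part is of class C^2, which is what the truncation
    of a function of W^{2,p} needs. *)
Lemma is_derive_min0X k t :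
  is_derive t 1 (fun u : R => Num.min u 0 ^+ k.+2) (k.+2%:R * Num.min t 0 ^+ k.+1).
Proof.
have [t0|t0|->] := ltgtP t 0.
- have e : \forall u \near t, u ^+ k.+2 = Num.min u 0 ^+ k.+2.
    by near=> u; rewrite min_l// ltW//; near: u; exact: lt_nbhsl.
  apply: (near_eq_is_derive e).
  have := is_derive_funX k.+2 (is_derive_id t (1 : R)); rewrite mulr1.
  exact.
- have e : \forall u \near t, 0 = Num.min u 0 ^+ k.+2.
    by near=> u; rewrite min_r ?expr0n// ltW//; near: u; exact: lt_nbhsr.
  rewrite expr0n mulr0.
  exact: (near_eq_is_derive e (is_derive_cst (0 : R) t 1)).
- rewrite ?minxx expr0n mulr0.
  pose F (u : R) := Num.min u 0 ^+ k.+2.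
  have cv : h^-1 *: (F (h *: 1 + 0) - F 0) @[h --> 0^'] --> (0 : R).
    apply/cvgr0Pnorm_le => e e0; near=> h.
    have h0 : h != 0 by near: h; exact: nbhs_dnbhs_neq.
    rewrite /F minxx expr0n subr0 addr0 [_ *: 1]mulr1 normrZ normfV normrX.
    have hm : `|Num.min h 0| <= `|h| by rewrite /Num.min; case: ifP => _; rewrite ?normr0.
    have h1 : `|h| <= 1 by near: h; apply: dnbhs0_le.
    have he : `|h| <= e by near: h; apply: dnbhs0_le.
    rewrite ler_pdivrMl ?normr_gt0//.
    apply: (@le_trans _ _ (`|h| ^+ k.+2)); first exact: lerXn2r.
    rewrite exprS ler_wpM2l// exprS; apply: le_trans he.
    by rewrite ler_piMr// exprn_ile1.
  by split; [apply/cvg_ex; exists 0|exact/cvg_lim].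
Unshelve. all: by end_near. Qed.

End min_power.

Section barrier.
Context {R : realType}.

(** With psi = q^2, Psi = q^2 + t q and z = v + k Psi, this is L w for the
    1-homogeneous concave function w = min(z, 0)^3 / Psi^2 of (v, Psi). By
    homogeneity the only contribution of the zeroth-order coefficient beyond L v
    and L psi comes from Psi - rho psi. *)
Lemma operator_truncation (n : nat) (a : 'I_n -> 'I_n -> R) (b : 'I_n -> R) (c : R)
    (V : R) (Vi : 'I_n -> R) (Vij : 'I_n -> 'I_n -> R)
    (pi : 'I_n -> R) (pij : 'I_n -> 'I_n -> R) (k t q : R) : 0 < q -> 0 < t ->
  let iq := q^-1 in let psi := q ^+ 2 in let Psi := q ^+ 2 + t * q in
  let I := Psi^-1 in let rho := 1 + t / 2 * iq in let m := V + k * Psi in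
  let B := 3 * k * (m ^+ 2 * I ^+ 2) - 2 * (m ^+ 3 * I ^+ 3) in
  let P := 3 * (m ^+ 2 * I ^+ 2) in let Q := rho * B in
  let xi i := Vi i + k * (rho * pi i) - m * I * (rho * pi i) in
  let dP j := 6 * m * I ^+ 2 * xi j in
  let dQ j := - (t / 4) * iq ^+ 3 * pi j * B +
    rho * (k * dP j - 6 * m ^+ 2 * I ^+ 3 * xi j) in
  \sum_i \sum_j a i j * (dP j * Vi i + P * Vij i j + (dQ j * pi i + Q * pij i j))
  + \sum_i b i * (P * Vi i + Q * pi i) + c * (m ^+ 3 * I ^+ 2) =
  P * (\sum_i \sum_j a i j * Vij i j + \sum_i b i * Vi i + c * V)
  + B * (rho * (\sum_i \sum_j a i j * pij i j + \sum_i b i * pi i + c * psi)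
         - t / 4 * iq ^+ 3 * (\sum_i \sum_j a i j * pi i * pi j) + c * (t * q / 2))
  + 6 * m * I ^+ 2 * (\sum_i \sum_j a i j * xi i * xi j).
Proof.
move=> q0 t0 iq psi Psi I rho m B P Q xi dP dQ.
have E2 : \sum_i \sum_j a i j * (dP j * Vi i + P * Vij i j + (dQ j * pi i + Q * pij i j)) =
    P * (\sum_i \sum_j a i j * Vij i j) + Q * (\sum_i \sum_j a i j * pij i j)
    - B * (t / 4) * iq ^+ 3 * (\sum_i \sum_j a i j * pi i * pi j)
    + 6 * m * I ^+ 2 * (\sum_i \sum_j a i j * xi i * xi j).
  rewrite !mulr_sumr -sumrN -!big_split/=; apply: eq_bigr => i _.
  rewrite !mulr_sumr -sumrN -!big_split/=; apply: eq_bigr => j _.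
  rewrite /dQ /dP /Q; have -> : Vi i = xi i - k * (rho * pi i) + m * I * (rho * pi i).
    by rewrite /xi; ring.
  move: (xi i) (xi j) (B) (P) => X Y B0 P0.
  by ring.
have E1 : \sum_i b i * (P * Vi i + Q * pi i) =
    P * (\sum_i b i * Vi i) + Q * (\sum_i b i * pi i).
  by rewrite !mulr_sumr -big_split/=; apply: eq_bigr => i _; ring.
have E0 : m ^+ 3 * I ^+ 2 = P * V + B * (rho * psi) + B * (t * q / 2).
  rewrite /P /B (_ : V = m - k * Psi); last by rewrite /m; ring.
  have -> : rho * psi = Psi - t * q / 2 by rewrite /rho /psi /Psi /iq; field; rewrite gt_eqF.
  have PsiI : Psi * I = 1 by rewrite /I divff// gt_eqF// addr_gt0 ?exprn_gt0 ?mulr_gt0.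
  have -> : I ^+ 3 = I ^+ 2 * I by rewrite exprSr.
  transitivity (m ^+ 3 * I ^+ 2 * (3 - 2 * (Psi * I))); last by ring.
  by rewrite PsiI; ring.
by rewrite E2 E1 E0 /Q; ring.
Qed.

End barrier.

Section closed_sublevel.
Context {R : realType} {T : topologicalType}.

Lemma closed_within_le (A : set T) (f g : T -> R) : closed A ->
  {within A, continuous f} -> {within A, continuous g} ->
  closed [set x | A x /\ f x <= g x].
Proof.
move=> cA cf cg x clx.
have Ax : A x.
  have -> : A = closure A by apply/closure_id.
  by apply: closure_subset clx => y [].
split=> //; rewrite leNgt; apply/negP => gf.
have /subspace_continuousP/(_ x Ax) cgf : {within A, continuous (fun y => f y - g y)}.
  by move=> y; apply: cvgB; [exact: cf|exact: cg].
have pos : 0 < f x - g x by rewrite subr_gt0.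
have nU : nbhs x [set y | A y -> 0 < f y - g y].
  by have /cvgr_gt/(_ _ pos) := cgf.
have [y [[Ay fgy] /= /(_ Ay)]] := clx _ nU.
by rewrite subr_gt0 ltNge fgy.
Qed.

End closed_sublevel.

Section truncated_barrier.
Context {R : realType} {n : nat} (Omega : set 'rV[R]_n) (p : R).
Hypotheses (oO : open Omega) (bO : bounded_set Omega) (p1 : 1 <= p).
Variables (v psi : sobolev2 Omega p) (k t s : R).
Hypotheses (k0 : 0 < k) (t0 : 0 < t).
Hypothesis psi_gt0 : forall x, Omega x -> 0 < psi x.
Hypothesis psi_bd : forall x, boundary Omega x -> psi x = 0.
Hypothesis v_ge : forall x, Omega x -> - (s * psi x) <= v x.
Implicit Types (x : 'rV[R]_n) (i j : 'I_n).

Let q x := Num.sqrt (psi x).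
Let Psi x := q x ^+ 2 + t * q x.
Let z x := v x + k * Psi x.
Let m x := Num.min (z x) 0.
Let I x := (Psi x)^-1.
Let rho x := 1 + t / 2 * (q x)^-1.
Let B x := 3 * k * (m x ^+ 2 * I x ^+ 2) - 2 * (m x ^+ 3 * I x ^+ 3).
Let P x := 3 * (m x ^+ 2 * I x ^+ 2).
Let Q x := rho x * B x.
Let w x := m x ^+ 3 * I x ^+ 2.
Let xi i x := sob_grad v i x + k * (rho x * sob_grad psi i x)
  - m x * I x * (rho x * sob_grad psi i x).
Let dP j x := 6 * m x * I x ^+ 2 * xi j x.
Let dQ j x := - (t / 4) * (q x)^-1 ^+ 3 * sob_grad psi j x * B x +
    rho x * (k * dP j x - 6 * m x ^+ 2 * I x ^+ 3 * xi j x).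

(** The term t q dominates s q^2 near the boundary, so z is positive there. *)
Let K := [set x | closure Omega x /\ k * t <= s * q x].

Let q_gt0 x : Omega x -> 0 < q x.
Proof. by move=> /psi_gt0; rewrite sqrtr_gt0. Qed.

Let Psi_gt0 x : Omega x -> 0 < Psi x.
Proof. by move=> /q_gt0 q0; rewrite addr_gt0 ?exprn_gt0 ?mulr_gt0. Qed.

Let cq : {within closure Omega, continuous q}.
Proof.
move=> x; apply: (@cvg_comp _ _ _ psi Num.sqrt _ (nbhs (psi x))).
  exact: (@sob_val_cont _ _ _ _ psi).
exact: sqrt_continuous.
Qed.

Let cK : compact K.
Proof.
have -> : K = [set x | closure Omega x /\ cst (k * t) x <= s * q x] by [].
apply: (subclosed_compact _ (bounded_closure_compact bO)); last by move=> x [].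
apply: closed_within_le; first exact: closed_closure.
  by apply: continuous_subspaceT; exact: cst_continuous.
by move=> x; apply: cvgM; [exact: cvg_cst|exact: cq].
Qed.

Let KO : K `<=` Omega.
Proof.
move=> x [cx]; apply: contraPP => nO.
rewrite /q psi_bd; last by split => // /interior_subset.
by rewrite sqrtr0 mulr0; apply/negP; rewrite -ltNge mulr_gt0.
Qed.

Let m_out x : Omega x -> ~ K x -> m x = 0.
Proof.
move=> Ox nK; rewrite /m min_r// /z.
have q0 := q_gt0 Ox.
have qq : psi x = q x ^+ 2 by rewrite sqr_sqrtr// ltW// psi_gt0.
have h : s * q x < k * t.
  by rewrite ltNge; apply/negP => h; apply: nK; split => //; exact: subset_closure.
have := v_ge Ox; rewrite qq => vx.
have h2 : s * q x ^+ 2 <= k * t * q x.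
  by rewrite expr2 mulrA ler_wpM2r// ltW.
have h3 : 0 <= k * q x ^+ 2 by rewrite mulr_ge0 ?sqr_ge0 ?ltW.
by rewrite /Psi; nra.
Qed.

Let dq x i : Omega x -> is_derive x (unit_rV i) q ((2 * q x)^-1 * sob_grad psi i x).
Proof.
move=> Ox; apply: is_derive_fun_comp; first exact: (sob_grad_classical psi i Ox).
by apply: is_derive1_sqrt; exact: psi_gt0.
Qed.

Let dPsi x i : Omega x -> is_derive x (unit_rV i) Psi (rho x * sob_grad psi i x).
Proof.
move=> Ox; have q0 := q_gt0 Ox.
have := is_derive_funD (is_derive_funX 2 (dq i Ox))
  (is_derive_funM (is_derive_cst t x (unit_rV i)) (dq i Ox)).
by move=> /is_derive_eq; apply; rewrite /rho /cst; field; rewrite gt_eqF.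
Qed.

Let dz x i : Omega x -> is_derive x (unit_rV i) z
  (sob_grad v i x + k * (rho x * sob_grad psi i x)).
Proof.
move=> Ox; have := is_derive_funD (sob_grad_classical v i Ox)
  (is_derive_funM (is_derive_cst k x (unit_rV i)) (dPsi i Ox)).
by move=> /is_derive_eq; apply; rewrite /cst; ring.
Qed.

Let dI x i : Omega x -> is_derive x (unit_rV i) I (- I x ^+ 2 * (rho x * sob_grad psi i x)).
Proof.
move=> Ox; rewrite /I exprVn; apply: is_derive_funV; last exact: dPsi.
by rewrite gt_eqF ?Psi_gt0.
Qed.

Let dmX l x i : Omega x -> is_derive x (unit_rV i) (fun y => m y ^+ l.+2)
  (l.+2%:R * m x ^+ l.+1 * (sob_grad v i x + k * (rho x * sob_grad psi i x))).
Proof.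
move=> Ox; exact: (is_derive_fun_comp (dz i Ox) (is_derive_min0X l (z x))).
Qed.

Let dmI x i l h : Omega x -> is_derive x (unit_rV i) (fun y => m y ^+ l.+2 * I y ^+ h)
  (m x ^+ l.+2 * (h%:R * I x ^+ h.-1 * (- I x ^+ 2 * (rho x * sob_grad psi i x)))
   + I x ^+ h * (l.+2%:R * m x ^+ l.+1 * (sob_grad v i x + k * (rho x * sob_grad psi i x)))).
Proof.
move=> Ox; exact: (is_derive_funM (dmX l i Ox) (is_derive_funX h (dI i Ox))).
Qed.

Let dw i x : Omega x ->
  is_derive x (unit_rV i) w (P x * sob_grad v i x + Q x * sob_grad psi i x).
Proof.
move=> Ox; have := dmI i 1 2 Ox => /is_derive_eq; apply.
by rewrite /P /Q /B /=; ring.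
Qed.

Let dPE i x : Omega x -> is_derive x (unit_rV i) P (dP i x).
Proof.
move=> Ox; have := is_derive_funM (is_derive_cst (3 : R) x (unit_rV i)) (dmI i 0 2 Ox).
by move=> /is_derive_eq; apply; rewrite /dP /xi /cst/=; ring.
Qed.

Let dB i x : Omega x -> is_derive x (unit_rV i) B
  (k * dP i x - 6 * m x ^+ 2 * I x ^+ 3 * xi i x).
Proof.
move=> Ox; have := is_derive_funD
  (is_derive_funM (is_derive_cst (3 * k : R) x (unit_rV i)) (dmI i 0 2 Ox))
  (is_derive_funM (is_derive_cst (- 2 : R) x (unit_rV i)) (dmI i 1 3 Ox)).
rewrite (_ : (fun y => _) = B); last by apply/funext => y; rewrite /cst /B; ring.
by move=> /is_derive_eq; apply; rewrite /dP /xi /cst/=; ring.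
Qed.

Let drho i x : Omega x -> is_derive x (unit_rV i) rho
  (- (t / 4) * (q x)^-1 ^+ 3 * sob_grad psi i x).
Proof.
move=> Ox; have q0 := q_gt0 Ox.
have qn : q x != 0 by rewrite gt_eqF.
have := is_derive_funD (is_derive_cst (1 : R) x (unit_rV i))
  (is_derive_funM (is_derive_cst (t / 2) x (unit_rV i)) (is_derive_funV qn (dq i Ox))).
by move=> /is_derive_eq; apply; rewrite /cst; field; rewrite gt_eqF.
Qed.

Let dQE i x : Omega x -> is_derive x (unit_rV i) Q (dQ i x).
Proof.
move=> Ox; have := is_derive_funM (drho i Ox) (dB i Ox).
by move=> /is_derive_eq; apply; rewrite /dQ; ring.
Qed.

Let cqa x : Omega x -> {for x, continuous q}.
Proof.
move=> Ox; apply: for_continuous_comp; first exact: sob_continuous_at.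
exact: sqrt_continuous.
Qed.

Let cPsi x : Omega x -> {for x, continuous Psi}.
Proof.
move=> /cqa cqx; apply: for_continuousD; first exact: for_continuousX.
by apply: for_continuousM => //; exact: for_continuous_cst.
Qed.

Let cI x : Omega x -> {for x, continuous I}.
Proof.
by move=> Ox; apply: for_continuousV; [rewrite gt_eqF ?Psi_gt0|exact: cPsi].
Qed.

Let cm x : Omega x -> {for x, continuous m}.
Proof.
move=> Ox; apply: (@for_continuous_comp _ _ z (fun u => Num.min u 0)).
  apply: for_continuousD; first exact: sob_continuous_at.
  by apply: for_continuousM; [exact: for_continuous_cst|exact: cPsi].
exact: min0_continuous.
Qed.

Let crho x : Omega x -> {for x, continuous rho}.
Proof.
move=> Ox; apply: for_continuousD; first exact: for_continuous_cst.
apply: for_continuousM; first exact: for_continuous_cst.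
by apply: for_continuousV; [rewrite gt_eqF ?q_gt0|exact: cqa].
Qed.

Let cmI x l h : Omega x -> {for x, continuous (fun y => m y ^+ l * I y ^+ h)}.
Proof.
move=> Ox; apply: for_continuousM; apply: for_continuousX; [exact: cm|exact: cI].
Qed.

Let cP x : Omega x -> {for x, continuous P}.
Proof.
by move=> Ox; apply: for_continuousM; [exact: for_continuous_cst|exact: cmI].
Qed.

Let cB x : Omega x -> {for x, continuous B}.
Proof.
move=> Ox; apply: for_continuousD.
  by apply: for_continuousM; [exact: for_continuous_cst|exact: cmI].
apply: for_continuousN.
by apply: for_continuousM; [exact: for_continuous_cst|exact: cmI].
Qed.

Let cpsii x i : Omega x -> {for x, continuous (fun y => rho y * sob_grad psi i y)}.
Proof.
by move=> Ox; apply: for_continuousM; [exact: crho|exact: sob_grad_continuous_at].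
Qed.

Let cxi x i : Omega x -> {for x, continuous (xi i)}.
Proof.
move=> Ox; apply: for_continuousD.
  apply: for_continuousD; first exact: sob_grad_continuous_at.
  by apply: for_continuousM; [exact: for_continuous_cst|exact: cpsii].
apply: for_continuousN; apply: for_continuousM; last exact: cpsii.
by apply: for_continuousM; [exact: cm|exact: cI].
Qed.

Let cdP j x : Omega x -> {for x, continuous (dP j)}.
Proof.
move=> Ox; apply: for_continuousM; last exact: cxi.
apply: for_continuousM; last by apply: for_continuousX; exact: cI.
by apply: for_continuousM; [exact: for_continuous_cst|exact: cm].
Qed.

Let cdQ j x : Omega x -> {for x, continuous (dQ j)}.
Proof.
move=> Ox; apply: for_continuousD.
  apply: for_continuousM; last exact: cB.
  apply: for_continuousM; last exact: sob_grad_continuous_at.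
  apply: for_continuousM; first exact: for_continuous_cst.
  apply: for_continuousX; apply: for_continuousV; last exact: cqa.
  by rewrite gt_eqF ?q_gt0.
apply: for_continuousM; first exact: crho.
apply: for_continuousD.
  by apply: for_continuousM; [exact: for_continuous_cst|exact: cdP].
apply: for_continuousN; apply: for_continuousM; last exact: cxi.
apply: for_continuousM; last by apply: for_continuousX; exact: cI.
by apply: for_continuousM; [exact: for_continuous_cst|apply: for_continuousX; exact: cm].
Qed.

(** The truncation min(z, 0)^3 / Psi^2 is an admissible function for the scalar
    maximum principle. *)
Lemma truncated_barrier : exists W : sobolev2 Omega p,
  [/\ forall x, boundary Omega x -> W x = 0,
      forall x, Omega x -> 0 <= W x -> 0 <= z x,
      forall (L : operator R n) x, Omega x -> 0 <= z x -> op_apply L W x = 0 &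
      forall (L : operator R n) x, Omega x -> z x < 0 ->
        op_apply L W x = P x * op_apply L v x
          + B x * (rho x * op_apply L psi x - t / 4 * (q x)^-1 ^+ 3 *
              (\sum_i \sum_j coef2 L i j x * sob_grad psi i x * sob_grad psi j x)
              + coef0 L x * (t * q x / 2))
          + 6 * m x * I x ^+ 2 *
              (\sum_i \sum_j coef2 L i j x * xi i x * xi j x)].
Proof.
have z0 x : m x = 0 -> [/\ w x = 0, P x = 0 & Q x = 0].
  by rewrite /w /P /Q /B => ->; rewrite !expr0n/= !(mul0r, mulr0, subrr).
have dz0 j x : m x = 0 -> dP j x = 0 /\ dQ j x = 0.
  by rewrite /dQ /dP /B => ->; rewrite !expr0n/= !(mul0r, mulr0, subrr, addr0).
have cw x : Omega x -> {for x, continuous w} by move=> Ox; exact: cmI.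
have cQ x : Omega x -> {for x, continuous Q}.
  by move=> Ox; apply: for_continuousM; [exact: crho|exact: cB].
have [W [W1 W0 Wg Wh]] := sobolev_build oO bO p1 cK KO psi_gt0 cw cP cQ
  cdP cdQ dw dPE dQE (fun x Ox nK => z0 x (m_out Ox nK))
  (fun j x Ox nK => dz0 j x (m_out Ox nK)).
exists W; split.
- by move=> x [_ nO]; apply: W0 => Ox; apply: nO; exact: open_nbhs_nbhs (conj oO Ox).
- move=> x Ox; rewrite W1// => w0; rewrite leNgt; apply/negP => zx.
  move: w0; apply/negP; rewrite -ltNge /w /m min_l ?ltW// nmulr_rlt0 ?exprn_gt0 ?invr_gt0 ?Psi_gt0//.
  by rewrite exprS nmulr_rlt0// exprn_even_gt0//= lt_eqF.
- move=> L x Ox zx; have m0 : m x = 0 by rewrite /m min_r.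
  have [w0 P0 Q0] := z0 x m0.
  rewrite /op_apply W1// w0 mulr0 addr0 !big1 ?addr0// => i _.
    by rewrite Wg// P0 Q0 !mul0r addr0 mulr0.
  rewrite big1// => j _; have [dP0 dQ0] := dz0 j x m0.
  by rewrite Wh// P0 Q0 dP0 dQ0 !mul0r !addr0 mulr0.
move=> L x Ox zx; have mz : m x = z x by rewrite /m min_l// ltW.
have qq : psi x = q x ^+ 2 by rewrite sqr_sqrtr// ltW// psi_gt0.
have := operator_truncation (fun i j => coef2 L i j x) (fun i => coef1 L i x)
  (coef0 L x) (v x) (fun i => sob_grad v i x) (fun i j => sob_hess v i j x)
  (fun i => sob_grad psi i x) (fun i j => sob_hess psi i j x) k (q_gt0 Ox) t0.
cbv zeta beta; rewrite -/(Psi x) -/(z x) -mz -qq -/(I x) -/(rho x) -/(B x) -/(P x) => <-.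
rewrite /op_apply W1//; congr (_ + _ + _).
  by apply: eq_bigr => i _; apply: eq_bigr => j _; rewrite Wh.
by apply: eq_bigr => i _; rewrite Wg.
Qed.

End truncated_barrier.

Lemma ae_onS3 {R : realType} {n : nat} (Omega : set 'rV[R]_n)
    (P1 P2 P3 Q : 'rV[R]_n -> Prop) :
  (forall x, Omega x -> P1 x -> P2 x -> P3 x -> Q x) ->
  ae_on Omega P1 -> ae_on Omega P2 -> ae_on Omega P3 -> ae_on Omega Q.
Proof.
move=> h; rewrite /ae_on; apply: filterS3 => x h1 h2 h3 Ox.
by apply: h => //; [exact: h1|exact: h2|exact: h3].
Qed.

Section scalar_comparison.
Context {R : realType} {n : nat} (Omega : set 'rV[R]_n) (p : R).
Hypotheses (oO : open Omega) (bO : bounded_set Omega) (p1 : 1 <= p).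
Variables (c0 C0 T : R) (L : operator R n).
Hypotheses (c0_gt0 : 0 < c0) (T_gt0 : 0 < T) (ellL : elliptic Omega c0 C0 T L).
Hypothesis wmpL : scalar_wmp Omega p L.
Variables (v psi : sobolev2 Omega p) (f : 'rV[R]_n -> R) (s : R).
Hypothesis psi_gt0 : forall x, Omega x -> 0 < psi x.
Hypothesis psi_bd : forall x, boundary Omega x -> psi x = 0.
Hypothesis grad_psi_bd : forall x, boundary Omega x -> exists i, sob_grad psi i x != 0.
Hypothesis psi_eq : ae_on Omega (fun x => - op_apply L psi x = f x).
Hypothesis f_ge0 : ae_on Omega (fun x => 0 <= f x).
Hypothesis f_pos : forall K, compact K -> K `<=` Omega ->
  exists2 g0, 0 < g0 & ae_on Omega (fun x => K x -> g0 <= f x).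
Hypothesis v_ge : forall x, Omega x -> - (s * psi x) <= v x.

Let q x := Num.sqrt (psi x).

Let quad_ge0 (xi : 'I_n -> R) x : Omega x ->
  c0 * (\sum_i xi i ^+ 2) <= \sum_i \sum_j coef2 L i j x * xi i * xi j.
Proof.
move=> Ox; have [_ _ _ /(_ x (\row_i xi i) Ox) /andP[h _] _] := ellL.
move: h; rewrite /dotr; under eq_bigr do rewrite mxE -expr2.
by under [X in _ <= X -> _]eq_bigr do (under eq_bigr do rewrite !mxE).
Qed.

(** The set where psi is too large for the strict concavity of its square root
    to absorb the zeroth-order coefficient. *)
Let K := [set x | closure Omega x /\ c0 * (\sum_i sob_grad psi i x ^+ 2) <= 2 * T * psi x ^+ 2].

Let cK : compact K.
Proof.
have cpsi : {within closure Omega, continuous (fun x => 2 * T * psi x ^+ 2)}.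
  move=> x; apply: cvgM; first exact: cvg_cst.
  have -> : (fun x => psi x ^+ 2) = (fun x => psi x * psi x) by apply/funext => y; rewrite expr2.
  by rewrite expr2; apply: cvgM; exact: (@sob_val_cont _ _ _ _ psi).
apply: (subclosed_compact _ (bounded_closure_compact bO)); last by move=> x [].
apply: closed_within_le; [exact: closed_closure| |exact: cpsi].
move=> x; apply: cvgM; first exact: cvg_cst.
apply: cvg_ord_sum => i.
have -> : (fun x => sob_grad psi i x ^+ 2) = (fun x => sob_grad psi i x * sob_grad psi i x).
  by apply/funext => y; rewrite expr2.
by rewrite expr2; apply: cvgM; exact: (@sob_grad_cont _ _ _ _ psi i).
Qed.

Let KO : K `<=` Omega.
Proof.
move=> x [cx]; apply: contraPP => nO.
have bx : boundary Omega x by split => // /interior_subset.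
rewrite psi_bd// expr0n mulr0; apply/negP; rewrite -ltNge mulr_gt0//.
have [i gi] := grad_psi_bd bx; rewrite (bigD1 i)//= ltr_pwDl//.
  by rewrite lt_neqAle sqr_ge0 andbT eq_sym sqrf_eq0.
by apply: sumr_ge0 => j _; exact: sqr_ge0.
Qed.

(** Psi = psi + t sqrt(psi) satisfies - L Psi >= th f, for every th < 1 and t
    small: near the boundary the gradient of psi does not vanish and the concave
    perturbation helps; elsewhere f is bounded below. *)
Let perturbation (th : R) : 0 <= th -> th < 1 -> exists2 t0, 0 < t0 &
  forall t, 0 < t -> t <= t0 -> ae_on Omega (fun x =>
    (1 + t / 2 * (q x)^-1) * op_apply L psi x - t / 4 * (q x)^-1 ^+ 3 *
      (\sum_i \sum_j coef2 L i j x * sob_grad psi i x * sob_grad psi j x)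
      + coef0 L x * (t * q x / 2) <= - (th * f x)).
Proof.
move=> th0 th1; have [g0 g00 fg0] := f_pos cK KO.
have cq : {within K, continuous q}.
  have h : {within K, continuous psi}.
    by apply: (continuous_subspaceW _ (@sob_val_cont _ _ _ _ psi)) => x [].
  move=> x; apply: (@cvg_comp _ _ _ psi Num.sqrt _ (nbhs (psi x))); first exact: h.
  exact: sqrt_continuous.
have [M M0 qM] := compact_continuous_bounded cK cq.
have TM : 0 < T * (M + 1) by rewrite mulr_gt0// ltr_wpDl.
(* on K the term T t q / 2 has to be at most (1 - th) f *)
exists (2 * ((1 - th) * g0) / (T * (M + 1))).
  by rewrite divr_gt0// mulr_gt0// mulr_gt0// subr_gt0.
move=> t t_gt0 tt0.
apply: ae_onS3 psi_eq f_ge0 fg0 => x Ox e fx gx.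
have {e} -> : op_apply L psi x = - f x by rewrite -e opprK.
have qx : 0 < q x by rewrite sqrtr_gt0 psi_gt0.
have iq : 0 < (q x)^-1 by rewrite invr_gt0.
have psiq : psi x = q x ^+ 2 by rewrite sqr_sqrtr// ltW// psi_gt0.
have cT : coef0 L x <= T.
  by have [_ _ _ _ /(_ x Ox)[_ h]] := ellL; exact: le_trans (ler_norm _) h.
have A := quad_ge0 (fun i => sob_grad psi i x) Ox.
set AA := \sum_i \sum_j _ in A *.
set S := \sum_i _ in A.
have S0 : 0 <= S by apply: sumr_ge0 => i _; exact: sqr_ge0.
have tq0 : 0 < t * q x / 2 by rewrite !mulr_gt0// invr_gt0.
have c1 : coef0 L x * (t * q x / 2) <= T * (t * q x / 2) by rewrite ler_wpM2r// ltW.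
have rf : (1 + t / 2 * (q x)^-1) * - f x <= - f x.
  have : 0 <= t / 2 * (q x)^-1 * f x by rewrite !mulr_ge0// ?invr_ge0 ltW.
  by lra.
have t4 : 0 < t / 4 * (q x)^-1 ^+ 3 by rewrite mulr_gt0 ?exprn_gt0// divr_gt0.
have thf : th * f x <= f x by rewrite ler_piMl// ltW.
have [Kx|nK] := pselect (K x).
  have A0 : 0 <= t / 4 * (q x)^-1 ^+ 3 * AA.
    by rewrite mulr_ge0 ?(ltW t4)// (le_trans _ A)// mulr_ge0// ltW.
  have c2 : T * (t * q x / 2) <= (1 - th) * g0.
    have qxM : q x <= M + 1.
      by have := qM x Kx; rewrite ger0_norm ?(ltW qx)//; lra.
    have h : t * (T * (M + 1)) <= 2 * ((1 - th) * g0) by rewrite -ler_pdivlMr.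
    have : T * t * q x <= T * t * (M + 1) by rewrite ler_wpM2l// mulr_ge0// ltW.
    by lra.
  have c3 : (1 - th) * g0 <= (1 - th) * f x by rewrite ler_wpM2l ?gx// subr_ge0 ltW.
  by lra.
have nK' : 2 * T * q x ^+ 4 < c0 * S.
  rewrite ltNge; apply/negP => h; apply: nK; split; first exact: subset_closure.
  by rewrite psiq -exprM.
have : t / 4 * (q x)^-1 ^+ 3 * (2 * T * q x ^+ 4) <= t / 4 * (q x)^-1 ^+ 3 * AA.
  by rewrite ler_wpM2l ?(ltW t4)// (le_trans (ltW nK')).
have -> : t / 4 * (q x)^-1 ^+ 3 * (2 * T * q x ^+ 4) = T * (t * q x / 2).
  by field; rewrite gt_eqF.
by lra.
Qed.

(** Maximum principle localized to the set v < 0, where alone the differential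
    inequality is assumed: the maximum principle on Omega is applied to the
    truncated barrier, which vanishes where z >= 0 and hence wherever v >= 0.
    The perturbation parameter t tends to 0, then the constant kap to k. *)
Lemma scalar_comparison (k : R) : 0 <= k ->
  ae_on Omega (fun x => v x < 0 -> - (k * f x) <= - op_apply L v x) ->
  forall x, Omega x -> - (k * psi x) <= v x.
Proof.
move=> k0 Lv.
have main (kap : R) : k < kap -> forall x, Omega x -> - (kap * psi x) <= v x.
  move=> kkap; have kap0 : 0 < kap := le_lt_trans k0 kkap.
  have [|t0 t00 pert] := @perturbation (k / kap) (divr_ge0 k0 (ltW kap0)).
    by rewrite ltr_pdivrMr// mul1r.
  have step t : 0 < t -> t <= t0 -> forall x, Omega x ->
      0 <= v x + kap * (q x ^+ 2 + t * q x).
    move=> t_gt0 tt0.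
    have [W [W0 Wz Lz Lnz]] := truncated_barrier oO bO p1 kap0 t_gt0 psi_gt0 psi_bd v_ge.
    move=> x Ox; apply: Wz => //; apply: (wmpL _ Ox); split; last by move=> y /W0 ->.
    apply: ae_onS3 (pert t t_gt0 tt0) f_ge0 Lv => y Oy py fy vy.
    have qy : 0 < q y by rewrite sqrtr_gt0 psi_gt0.
    have Psi0 : 0 < q y ^+ 2 + t * q y by rewrite addr_gt0 ?exprn_gt0 ?mulr_gt0.
    have [zy|zy] := leP 0 (v y + kap * (q y ^+ 2 + t * q y)); first by rewrite Lz.
    rewrite Lnz//.
    have vy0 : v y < 0.
      by apply: le_lt_trans zy; rewrite lerDl mulr_ge0 ?ltW.
    have {}vy : op_apply L v y <= k * f y by have := vy vy0; rewrite lerN2.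
    rewrite -/(q y) min_l ?(ltW zy)//.
    have I0 : 0 < (q y ^+ 2 + t * q y)^-1 by rewrite invr_gt0.
    set I := (_ ^-1) in I0 *; move: zy; set z := v y + _ => zy.
    set quad' := \sum_i \sum_j (coef2 _ _ _ _ * (_ - _) * _).
    have quad0 : 0 <= quad'.
      apply: le_trans (quad_ge0 _ Oy); rewrite mulr_ge0 ?(ltW c0_gt0)//.
      by apply: sumr_ge0 => i _; exact: sqr_ge0.
    move: py; set E := _ + coef0 L y * _ => py.
    (* the coefficient of E exceeds kap times that of L v, and kap E absorbs
       L v <= k f *)
    have zI : 0 <= z ^+ 2 * I ^+ 2 by rewrite mulr_ge0 ?sqr_ge0.
    have zI3 : z ^+ 3 * I ^+ 3 <= 0.
      rewrite -exprMn; have : z * I <= 0 by rewrite pmulr_lle0// ltW.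
      by move: (z * I) => u u0; rewrite exprS mulr_le0_ge0// sqr_ge0.
    have zI2 : 6 * z * I ^+ 2 * quad' <= 0.
      rewrite mulr_le0_ge0// mulr_le0_ge0 ?sqr_ge0//.
      by rewrite nmulr_lle0 ?ltW// ?ltr0n// mulr_ge0_le0// ltW.
    have kf0 : 0 <= k / kap * f y by rewrite mulr_ge0// divr_ge0// ltW.
    have E0 : E <= 0 by apply: le_trans py _; rewrite oppr_le0.
    have e1 : - 2 * (z ^+ 3 * I ^+ 3) * E <= 0.
      by rewrite mulr_ge0_le0// mulNr oppr_ge0 mulr_ge0_le0.
    have e2 : 3 * kap * (z ^+ 2 * I ^+ 2) * E
        <= 3 * kap * (z ^+ 2 * I ^+ 2) * - (k / kap * f y).
      by rewrite ler_wpM2l// mulr_ge0// mulr_ge0// ltW.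
    have e3 : 3 * kap * (z ^+ 2 * I ^+ 2) * - (k / kap * f y) =
        - (3 * (z ^+ 2 * I ^+ 2) * (k * f y)) by field; rewrite gt_eqF.
    have e4 : 3 * (z ^+ 2 * I ^+ 2) * op_apply L v y
        <= 3 * (z ^+ 2 * I ^+ 2) * (k * f y) by rewrite ler_wpM2l// mulr_ge0.
    by rewrite mulrBl; lra.
  move=> x Ox; have qx : 0 < q x by rewrite sqrtr_gt0 psi_gt0.
  have psiq : psi x = q x ^+ 2 by rewrite sqr_sqrtr// ltW// psi_gt0.
  rewrite -subr_ge0 opprK; apply/ler_addgt0Pr => e e0.
  have d0 : 0 < kap * q x by rewrite mulr_gt0.
  pose t := Num.min t0 (e / (kap * q x)).
  have t_gt0 : 0 < t by rewrite lt_min t00 divr_gt0.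
  have te : t * (kap * q x) <= e by rewrite -ler_pdivlMr// ge_min lexx orbT.
  have tt0 : t <= t0 by rewrite ge_min lexx.
  by have := step t t_gt0 tt0 x Ox; rewrite psiq; lra.
move=> x Ox; rewrite -subr_ge0 opprK; apply/ler_addgt0Pr => e e0.
have px := psi_gt0 Ox.
have kk : k < k + e / psi x by rewrite ltrDl divr_gt0.
by have := main _ kk x Ox; rewrite mulrDl divfK ?gt_eqF//; lra.
Qed.

End scalar_comparison.

(** * Powers, the principal curve and its region *)

Section powers.
Context {R : realType}.
Implicit Types (a b c s t x y : R).

Lemma powR_le_inj (g a b : R) : 0 < g -> 0 <= a -> 0 <= b -> a `^ g <= b `^ g -> a <= b.
Proof.
move=> g0 a0 b0; apply: contraTT; rewrite -!ltNge => ba.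
by rewrite gt0_ltr_powR.
Qed.

Lemma powR_lt_inj (g a b : R) : 0 < g -> 0 <= a -> 0 <= b -> a `^ g < b `^ g -> a < b.
Proof.
move=> g0 a0 b0; apply: contraTT; rewrite -!leNgt => ba.
by rewrite ge0_ler_powR// ltW.
Qed.

Lemma powR_invK (g c : R) : 0 < g -> 0 <= c -> (c `^ g^-1) `^ g = c.
Proof. by move=> g0 c0; rewrite -powRrM mulVf ?gt_eqF// powRr1. Qed.

Lemma powR_split (a s : R) : 0 < s -> s = s `^ a * s `^ (1 - a).
Proof.
move=> s0; rewrite -powRD ?(gt_eqF s0) ?implybT//.
by rewrite addrC subrK powRr1// ltW.
Qed.

(** At criticality the two power-type inequalities, composed, are homogeneous of
    degree one, so that y < 1 makes them incompatible. *)
Lemma critical_inequalities (a1 a2 b1 b2 t s x y : R) :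
  a1 < 1 -> a2 < 1 -> 0 < b1 -> 0 < b2 -> b1 * b2 = (1 - a1) * (1 - a2) ->
  0 <= t -> 0 <= s -> 0 <= x -> x <= 1 -> 0 <= y -> y < 1 ->
  t <= x * t `^ a1 * s `^ b1 -> s <= y * s `^ a2 * t `^ b2 -> t = 0 /\ s = 0.
Proof.
move=> a11 a21 b10 b20 crit t0 s0 x0 x1 y0 y1 ht hs.
have [s00|s00] := eqVneq s 0.
  split=> //; apply/le_anti; rewrite t0 andbT.
  by move: ht; rewrite s00 powR0 ?gt_eqF// mulr0.
exfalso; have {}s0 : 0 < s by rewrite lt_neqAle eq_sym s00.
have {}t0 : 0 < t.
  rewrite lt_neqAle t0 andbT; apply/eqP => t00; move: hs.
  by rewrite -t00 powR0 ?gt_eqF// mulr0 leNgt s0.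
have a1' : 0 < 1 - a1 by rewrite subr_gt0.
have a2' : 0 < 1 - a2 by rewrite subr_gt0.
have t1 : t `^ (1 - a1) <= s `^ b1.
  have ta : 0 < t `^ a1 by rewrite powR_gt0.
  rewrite -(ler_pM2l ta) -powR_split//; apply: le_trans ht _.
  by rewrite -mulrA ler_piMl// mulr_ge0// powR_ge0.
have s1 : s `^ (1 - a2) <= y * t `^ b2.
  have sa : 0 < s `^ a2 by rewrite powR_gt0.
  by rewrite -(ler_pM2l sa) -powR_split// (le_trans hs)// mulrCA mulrA.
have : (s `^ (1 - a2)) `^ (1 - a1) <= (y * t `^ b2) `^ (1 - a1).
  by rewrite ge0_ler_powR ?nnegrE ?powR_ge0 ?mulr_ge0 ?powR_ge0// ltW.
rewrite powRM ?powR_ge0// powRAC -!powRrM.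
have : y `^ (1 - a1) * (t `^ (1 - a1)) `^ b2 <= y `^ (1 - a1) * (s `^ b1) `^ b2.
  apply: ler_wpM2l; first exact: powR_ge0.
  by apply: ge0_ler_powR; rewrite ?nnegrE ?powR_ge0// ltW.
rewrite -!powRrM crit [b2 * _]mulrC => h1 h2.
have S0 : 0 < s `^ ((1 - a1) * (1 - a2)) by rewrite powR_gt0.
have := le_trans h2 h1; rewrite -[leLHS]mul1r ler_pM2r// leNgt.
have : y `^ (1 - a1) < 1 `^ (1 - a1) by rewrite gt0_ltr_powR ?nnegrE.
by rewrite powR1 => ->.
Qed.

Lemma powR_large (g C : R) : 0 < g -> exists2 S, 0 < S & forall s, S <= s -> C <= s `^ g.
Proof.
move=> g0; exists ((`|C| + 1) `^ g^-1); first by rewrite powR_gt0// ltr_wpDl.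
move=> s Ss; apply: (@le_trans _ _ (`|C| + 1)); first by have := ler_norm C; lra.
have C1 : 0 <= `|C| + 1 by rewrite addr_ge0.
rewrite -[leLHS](powR_invK g0 C1) ge0_ler_powR ?nnegrE ?powR_ge0 ?(ltW g0)//.
exact: le_trans (powR_ge0 _ _) Ss.
Qed.

Lemma powR_base_continuous (g a : R) : 0 < a -> {for a, continuous (fun x => x `^ g)}.
Proof.
move=> a0; apply/differentiable_continuous/derivable1_diffP.
by apply: derivable_powR; rewrite in_itv/= a0.
Qed.

End powers.

Section curve.
Context {R : realType} {n : nat} (S : system R n) (Lambda0 : R).
Hypotheses (Lambda0_gt0 : 0 < Lambda0).
Hypotheses (alpha1_lt1 : alpha1 S < 1) (alpha2_lt1 : alpha2 S < 1).
Hypotheses (beta1_gt0 : 0 < beta1 S) (beta2_gt0 : 0 < beta2 S).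
Implicit Types (lm : R * R) (l m : R).

Let g1 := (Num.sqrt (beta1 S * (1 - alpha1 S)))^-1.
Let g2 := (Num.sqrt (beta2 S * (1 - alpha2 S)))^-1.

Let g1_gt0 : 0 < g1.
Proof. by rewrite invr_gt0 sqrtr_gt0 mulr_gt0// subr_gt0. Qed.

Let g2_gt0 : 0 < g2.
Proof. by rewrite invr_gt0 sqrtr_gt0 mulr_gt0// subr_gt0. Qed.

Definition below_curve l m := [/\ 0 <= l, 0 <= m & curve_expr S (l, m) < Lambda0].

Lemma curve_exprE l m : curve_expr S (l, m) = l `^ g1 * m `^ g2.
Proof. by []. Qed.

(** One moves up to the curve along a vertical line, after a shift to the right
    if l = 0, where that line would miss the curve. *)
Lemma curve_point_above l m : below_curve l m -> exists l1 m1,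
  [/\ 0 < l1, 0 < m1, l <= l1, m < m1 & curve_expr S (l1, m1) = Lambda0].
Proof.
case; rewrite curve_exprE => l0 m0 lm.
have [l00|l00] := eqVneq l 0.
  have m1 : 0 < m + 1 by rewrite ltr_wpDl.
  have c0 : 0 < Lambda0 / (m + 1) `^ g2 by rewrite divr_gt0// powR_gt0.
  exists ((Lambda0 / (m + 1) `^ g2) `^ g1^-1), (m + 1); split => //.
  - by rewrite powR_gt0.
  - by rewrite l00 powR_ge0.
  - by rewrite ltrDl.
  - by rewrite curve_exprE powR_invK ?(ltW c0)// divfK// gt_eqF// powR_gt0.
have {}l0 : 0 < l by rewrite lt_neqAle eq_sym l00.
have lg : 0 < l `^ g1 by rewrite powR_gt0.
have c0 : 0 < Lambda0 / l `^ g1 by rewrite divr_gt0.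
exists l, ((Lambda0 / l `^ g1) `^ g2^-1); split => //.
- by rewrite powR_gt0.
- apply: (@powR_lt_inj _ g2) => //; first exact: powR_ge0.
  by rewrite powR_invK ?(ltW c0)// ltr_pdivlMr// mulrC.
- by rewrite curve_exprE powR_invK ?(ltW c0)// mulrC divfK// gt_eqF.
Qed.

Lemma curve_point_below l m : 0 <= l -> 0 <= m -> Lambda0 <= curve_expr S (l, m) ->
  exists l1 m1, [/\ 0 < l1, 0 < m1, l1 <= l, m1 <= m & curve_expr S (l1, m1) = Lambda0].
Proof.
rewrite curve_exprE => l0 m0 lm.
have {}l0 : 0 < l.
  rewrite lt_neqAle l0 andbT; apply/eqP => l00; move: lm.
  by rewrite -l00 powR0 ?gt_eqF// mul0r leNgt Lambda0_gt0.
have lg : 0 < l `^ g1 by rewrite powR_gt0.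
have c0 : 0 < Lambda0 / l `^ g1 by rewrite divr_gt0.
exists l, ((Lambda0 / l `^ g1) `^ g2^-1); split => //.
- by rewrite powR_gt0.
- apply: (@powR_le_inj _ g2) => //; first exact: powR_ge0.
  by rewrite powR_invK ?(ltW c0)// ler_pdivrMr// mulrC.
- by rewrite curve_exprE powR_invK ?(ltW c0)// mulrC divfK// gt_eqF.
Qed.

Lemma curve_nonempty : exists l1 m1, [/\ 0 < l1, 0 < m1 & curve_expr S (l1, m1) = Lambda0].
Proof.
have [|l1 [m1 [l10 m10 _ _ e]]] := @curve_point_above 0 0; last by exists l1, m1.
by split => //; rewrite curve_exprE powR0 ?mul0r// gt_eqF.
Qed.

Let small_factor (g h c e : R) : 0 < g -> 0 < h -> 0 < c -> 0 < e ->
  exists2 d, 0 < d & d <= e /\ d `^ g * c `^ h < Lambda0.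
Proof.
move=> g0 h0 c0 e0.
have ch : 0 < c `^ h by rewrite powR_gt0.
have k0 : 0 < Lambda0 / 2 / c `^ h by rewrite !divr_gt0.
exists (Num.min e ((Lambda0 / 2 / c `^ h) `^ g^-1)).
  by rewrite lt_min e0 powR_gt0.
split; first by rewrite ge_min lexx.
apply: (@le_lt_trans _ _ (Lambda0 / 2)); last by rewrite ltr_pdivrMr// ltr_pMr// ltr1n.
rewrite -ler_pdivlMr// -[leRHS](powR_invK g0 (ltW k0)).
rewrite ge0_ler_powR ?nnegrE ?powR_ge0 ?(ltW g0)//.
  by rewrite le_min (ltW e0) powR_ge0.
by rewrite ge_min lexx orbT.
Qed.

(** The closure adds the two half-axes and the curve itself; the half-axes are
    reached because the defining expression vanishes on them. *)
Lemma closure_region1P (C1 : set (R * R)) l m :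
  C1 = [set lm | [/\ 0 < lm.1, 0 < lm.2 & curve_expr S lm = Lambda0]] ->
  (closure (region1 S Lambda0) `\` C1) (l, m) <-> below_curve l m.
Proof.
move=> ->; split=> [[clR nC]|[l0 m0 lm]].
- have fst_ge0 : 0 <= l.
    rewrite leNgt; apply/negP => l0.
    have U : nbhs (l, m) [set z : R * R | z.1 < 0].
      have cf : {for (l, m), continuous (fun z : R * R => z.1)} by exact: cvg_fst.
      by have /cvgr_lt/(_ _ l0) := cf.
    by have [z [[z0 _ _] /=]] := clR _ U; rewrite ltNge ltW.
  have snd_ge0 : 0 <= m.
    rewrite leNgt; apply/negP => m0.
    have U : nbhs (l, m) [set z : R * R | z.2 < 0].
      have cf : {for (l, m), continuous (fun z : R * R => z.2)} by exact: cvg_snd.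
      by have /cvgr_lt/(_ _ m0) := cf.
    by have [z [[_ z0 _] /=]] := clR _ U; rewrite ltNge ltW.
  split => //; rewrite ltNge; apply/negP => le.
  have lpos : 0 < l.
    rewrite lt_neqAle fst_ge0 andbT; apply/eqP => l00; move: le.
    by rewrite curve_exprE -l00 powR0 ?gt_eqF// mul0r leNgt Lambda0_gt0.
  have mpos : 0 < m.
    rewrite lt_neqAle snd_ge0 andbT; apply/eqP => m00; move: le.
    by rewrite curve_exprE -m00 powR0 ?gt_eqF// mulr0 leNgt Lambda0_gt0.
  have lt : Lambda0 < curve_expr S (l, m).
    by rewrite lt_neqAle le andbT; apply/eqP => e; apply: nC; split.
  have cv : {for (l, m), continuous (curve_expr S)}.
    apply: for_continuousM.
      apply: (@continuous_comp _ _ _ fst (fun a => a `^ g1)); first exact: cvg_fst.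
      exact: powR_base_continuous.
    apply: (@continuous_comp _ _ _ snd (fun a => a `^ g2)); first exact: cvg_snd.
    exact: powR_base_continuous.
  have U : nbhs (l, m) [set z | Lambda0 < curve_expr S z].
    by have /cvgr_gt/(_ _ lt) := cv.
  by have [z [[_ _ zL] /=]] := clR _ U; rewrite ltNge ltW.
- split; last by case=> _ _ e; move: lm; rewrite e ltxx.
  move=> U /nbhs_ballP[e /= e0 eU].
  have ehalf : 0 < e / 2 by rewrite divr_gt0.
  have inU a b : 0 <= a - l <= e / 2 -> 0 <= b - m <= e / 2 -> U (a, b).
    move=> /andP[a0 ae] /andP[b0 be]; apply: eU; split => /=; rewrite -ball_normE/=.
      by rewrite distrC ger0_norm//; lra.
    by rewrite distrC ger0_norm//; lra.
  have [l00|l00] := eqVneq l 0.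
    have m1 : 0 < m + e / 2 by rewrite ltr_wpDl.
    have [d d0 [de dL]] := small_factor g1_gt0 g2_gt0 m1 ehalf.
    exists (d, m + e / 2); split; first by split.
    by apply: inU; rewrite ?l00 ?subr0 ?(ltW d0)// addrAC subrr add0r lexx ltW.
  have {}l0 : 0 < l by rewrite lt_neqAle eq_sym l00.
  have [m00|m00] := eqVneq m 0.
    have [d d0 [de dL]] := small_factor g2_gt0 g1_gt0 l0 ehalf.
    exists (l, d); split; first by split => //; rewrite curve_exprE mulrC.
    by apply: inU; rewrite ?m00 ?subr0 ?(ltW d0)// subrr lexx ltW.
  have {}m0 : 0 < m by rewrite lt_neqAle eq_sym m00.
  exists (l, m); split; first by split.
  by apply: inU; rewrite subrr lexx ltW.
Qed.

Lemma closure_region2E l m :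
  closure (region2 S Lambda0) (l, m) <-> closure (region1 S Lambda0) (l, - m).
Proof.
pose flip (z : R * R) := (z.1, - z.2).
have cflip (z : R * R) : {for z, continuous flip}.
  have c1 : {for z, continuous (fun z : R * R => z.1)} by exact: cvg_fst.
  have c2 : {for z, continuous (fun z : R * R => - z.2)}.
    by apply: for_continuousN; exact: cvg_snd.
  exact: (cvg_pair c1 c2).
split=> cl U nU.
- have [z [zR zU]] := cl _ (cflip (l, m) _ nU).
  by exists (flip z).
- have nU' : nbhs (flip (l, - m)) U by rewrite /flip/= opprK.
  have [z [zR zU]] := cl _ (cflip (l, - m) _ nU').
  exists (flip z); split => //.
  by rewrite /region2/= opprK; case: z zR {zU}.
Qed.

End curve.

(** * Signed powers and the two equations *)

Section signed_power.
Context {R : realType}.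
Implicit Types g w : R.

Lemma signed_pow_gt0 g w : 0 <= g -> 0 < w -> signed_pow g w = w `^ g.
Proof.
move=> g0 w0; rewrite /signed_pow; case: eqP => [->|/eqP g1]; first by rewrite powRr0.
by rewrite gtr0_norm// mulrC mulr_powRB1// ?ltW// lt_neqAle eq_sym g1.
Qed.

Lemma signed_powN g w : 0 < g -> signed_pow g (- w) = - signed_pow g w.
Proof. by move=> g0; rewrite /signed_pow gt_eqF// normrN mulrN. Qed.

Lemma signed_pow_ge0 g w : 0 <= w -> 0 <= signed_pow g w.
Proof. by move=> w0; rewrite /signed_pow; case: ifP => // _; rewrite mulr_ge0// powR_ge0. Qed.

Lemma signed_pow_ge g w b : 0 < g -> 0 <= b -> - b <= w -> - (b `^ g) <= signed_pow g w.
Proof.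
move=> g0 b0 bw; have [w0|w0] := leP 0 w.
  by rewrite (le_trans _ (signed_pow_ge0 _ w0))// oppr_le0 powR_ge0.
have nw : 0 < - w by rewrite oppr_gt0.
rewrite -[w]opprK signed_powN// (signed_pow_gt0 (ltW g0) nw) lerN2.
by rewrite ge0_ler_powR ?nnegrE ?(ltW g0)// ?(ltW nw)// lerNl.
Qed.

(** The change of sign between lam and the abscissa l of the first quadrant for
    which lam |u|^(al - 1) u = l |u|^al wherever u < 0. *)
Definition own_sign (al l lam : R) : Prop :=
  (al = 0 /\ lam = l) \/ (0 < al /\ lam = - l).

Lemma own_sign_pow al l lam w : own_sign al l lam -> 0 < w ->
  lam * signed_pow al (- w) = l * w `^ al.
Proof.
move=> [[-> ->]|[al0 ->]] w0; first by rewrite /signed_pow eqxx powRr0.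
by rewrite signed_powN// (signed_pow_gt0 (ltW al0) w0) mulrNN.
Qed.

End signed_power.

Section sob_scale.
Context {R : realType} {n : nat} (Omega : set 'rV[R]_n) (p : R).
Hypotheses (oO : open Omega) (bO : bounded_set Omega) (p1 : 1 <= p).

Lemma weak_partialZ (c : R) (f g : 'rV[R]_n -> R) i :
  inLp Omega p%:E f -> inLp Omega p%:E g ->
  weak_partial Omega i f g -> weak_partial Omega i (fun x => c * f x) (fun x => c * g x).
Proof.
move=> fp gp fg phi tphi; have [sphi _ _] := tphi.
have c1 := smooth_continuous sphi; have c2 := @smooth_partial_continuous _ _ _ i sphi.
under eq_Rintegral do rewrite -mulrA.
under [in RHS]eq_Rintegral do rewrite -mulrA.
have fi := inLp_integrable oO bO p1 fp; have gi := inLp_integrable oO bO p1 gp.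
rewrite !RintegralZl ?fg ?mulrN//; try exact: measurable_Omega.
- exact: integrable_continuous_mul.
- exact: integrable_continuous_mul.
Qed.

Lemma sob_scale (c : R) (v : sobolev2 Omega p) : exists W : sobolev2 Omega p,
  (forall x, W x = c * v x) /\ forall L x, op_apply L W x = c * op_apply L v x.
Proof.
unshelve eexists (@Sobolev2 R n Omega p (fun x => c * v x)
  (fun i x => c * sob_grad v i x) (fun i j x => c * sob_hess v i j x)
  (inLpZ oO c p1 (sob_val_Lp v)) (fun i => inLpZ oO c p1 (sob_grad_Lp v i))
  (fun i j => inLpZ oO c p1 (sob_hess_Lp v i j))
  (fun i => weak_partialZ c (sob_val_Lp v) (sob_grad_Lp v i) (@sob_grad_weak _ _ _ _ v i))
  (fun i j => weak_partialZ c (sob_grad_Lp v i) (sob_hess_Lp v i j)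
     (@sob_hess_weak _ _ _ _ v i j)) _ _ _).
- by move=> x; apply: cvgM; [exact: cvg_cst|exact: (@sob_val_cont _ _ _ _ v)].
- by move=> i x; apply: cvgM; [exact: cvg_cst|exact: (@sob_grad_cont _ _ _ _ v i)].
- move=> i x Ox.
  have := is_derive_funM (is_derive_cst c x (unit_rV i)) (sob_grad_classical v i Ox).
  by rewrite mulr0 addr0.
split=> // L x; rewrite /op_apply/= !mulrDr !mulr_sumr; congr (_ + _ + _); last by ring.
  apply: eq_bigr => i _; rewrite mulr_sumr; apply: eq_bigr => j _; ring.
by apply: eq_bigr => i _; ring.
Qed.

End sob_scale.

(** Each equation of the system is treated separately, the other unknown being
    a datum: phi and psi are the principal eigenfunctions, with - L phi =
    l1 a phi^al psi^be. *)
Section one_equation.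
Context {R : realType} {n : nat} (Omega : set 'rV[R]_n) (p : R).
Hypotheses (oO : open Omega) (bO : bounded_set Omega) (p1 : 1 <= p).
Hypothesis C11 : C11_boundary Omega.
Variables (c0 C0 T : R) (L : operator R n).
Hypotheses (c0_gt0 : 0 < c0) (T_gt0 : 0 < T) (ellL : elliptic Omega c0 C0 T L).
Hypotheses (wmpL : scalar_wmp Omega p L) (smpL : scalar_smp Omega p L).
Variables (a : 'rV[R]_n -> R) (al be l1 : R) (phi psi : sobolev2 Omega p).
Hypothesis a_pos : (0 < ess_inf_on Omega a)%E.
Hypotheses (al_ge0 : 0 <= al) (be_gt0 : 0 < be) (l1_gt0 : 0 < l1).
Hypothesis phi_gt0 : forall x, Omega x -> 0 < phi x.
Hypothesis psi_gt0 : forall x, Omega x -> 0 < psi x.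
Hypothesis phi_bd : forall x, boundary Omega x -> phi x = 0.
Hypothesis phi_eq : ae_on Omega (fun x => - op_apply L phi x =
  l1 * a x * signed_pow al (phi x) * signed_pow be (psi x)).

Let f x := l1 * a x * phi x `^ al * psi x `^ be.

Lemma weight_lower_bound : exists2 a0, 0 < a0 & ae_on Omega (fun x => a0 <= a x).
Proof.
have h := ess_inf_le (lebesgue_rV n) (patch (cst +oo%E) Omega (EFin \o a)).
move: a_pos h; rewrite /ess_inf_on; case: (ess_inf _ _) => [r|_|] //.
- rewrite lte_fin => r0 h; exists r => //; move: h; apply: filterS => x + Ox.
  by rewrite /patch mem_set// lee_fin.
- move=> h; exists 1 => //; move: h; apply: filterS => x + Ox.
  by rewrite /patch mem_set.
Qed.

Let phi_f : ae_on Omega (fun x => - op_apply L phi x = f x).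
Proof.
apply: (ae_onS3 _ phi_eq phi_eq phi_eq) => x Ox e _ _.
by rewrite e (signed_pow_gt0 al_ge0 (phi_gt0 Ox)) (signed_pow_gt0 (ltW be_gt0) (psi_gt0 Ox)).
Qed.

Let weight_ge0 : ae_on Omega (fun x => 0 <= a x).
Proof.
have [a0 a00 h] := weight_lower_bound.
by apply: (ae_onS3 _ h h h) => x _ ax _ _; exact: le_trans (ltW a00) ax.
Qed.

Let f_ge0 : ae_on Omega (fun x => 0 <= f x).
Proof.
apply: (ae_onS3 _ weight_ge0 weight_ge0 weight_ge0) => x _ ax _ _.
by rewrite /f !mulr_ge0 ?powR_ge0// ltW.
Qed.

Let f_pos K : compact K -> K `<=` Omega ->
  exists2 g0, 0 < g0 & ae_on Omega (fun x => K x -> g0 <= f x).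
Proof.
move=> cK KO; have [a0 a00 h] := weight_lower_bound.
have cont (u : sobolev2 Omega p) : {within K, continuous u}.
  apply: (continuous_subspaceW _ (@sob_val_cont _ _ _ _ u)).
  by move=> x /KO; exact: subset_closure.
have [c1 c10 h1] := compact_pos_min cK (cont phi) (fun x Kx => phi_gt0 (KO x Kx)).
have [c2 c20 h2] := compact_pos_min cK (cont psi) (fun x Kx => psi_gt0 (KO x Kx)).
exists (l1 * a0 * c1 `^ al * c2 `^ be).
  by rewrite !mulr_gt0 ?powR_gt0.
apply: (ae_onS3 _ h h h) => x Ox ax _ _ Kx.
have p1' : c1 `^ al <= phi x `^ al.
  by apply: ge0_ler_powR; rewrite ?nnegrE ?h1// ltW// phi_gt0.
have p2' : c2 `^ be <= psi x `^ be.
  by apply: ge0_ler_powR; rewrite ?nnegrE ?h2// ltW// psi_gt0.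
apply: ler_pM => //; rewrite ?powR_ge0//; first by rewrite !mulr_ge0 ?powR_ge0// ltW.
apply: ler_pM => //; rewrite ?powR_ge0//; first by rewrite !mulr_ge0// ltW.
by rewrite ler_wpM2l// ltW.
Qed.

Let phi_super : scalar_supersolution L phi.
Proof.
split; last by move=> x /phi_bd ->.
apply: (ae_onS3 _ phi_f f_ge0 f_ge0) => x _ e fx _.
by rewrite -oppr_ge0 e.
Qed.

Let hopf x0 nu : boundary Omega x0 -> outward_normal Omega x0 nu ->
  normal_derivative phi nu x0 < 0.
Proof.
move=> bx onu; have [z|[_ h]] := smpL phi_super; last by apply: h => //; exact: phi_bd.
have [cx _] := bx; have [y [Oy _]] := cx _ (filterT : nbhs x0 setT).
by have := phi_gt0 Oy; rewrite z// ltxx.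
Qed.

Let grad_phi_bd x : boundary Omega x -> exists i, sob_grad phi i x != 0.
Proof.
move=> bx; have [e [gam ch]] := C11 bx.
apply/not_existsP => h.
have onu : outward_normal Omega x ((Num.sqrt (dotr (\row_i partial i gam x - e)
  (\row_i partial i gam x - e)))^-1 *: (\row_i partial i gam x - e)).
  by exists e, gam.
have := hopf bx onu; rewrite /normal_derivative big1 ?ltxx// => i _.
by have /negP/negPn/eqP -> := h i; rewrite mulr0.
Qed.

(** Some multiple of phi works by Hopf's lemma, and the infimum of those that work
    is attained because the condition is closed in t. *)
Lemma optimal_lower_bound (u : sobolev2 Omega p) :
  (forall x, boundary Omega x -> 0 <= u x) ->
  exists t, [/\ 0 <= t, forall x, Omega x -> - (t * phi x) <= u x &
    forall t', 0 <= t' -> (forall x, Omega x -> - (t' * phi x) <= u x) -> t <= t'].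
Proof.
move=> u0.
have [t1 t10 ht1] : exists2 s, 0 <= s & forall x, Omega x -> - (s * phi x) <= u x.
  by apply: boundary_comparison => // x /phi_bd ->.
pose A := [set t | 0 <= t /\ forall x, Omega x -> - (t * phi x) <= u x].
have iA : has_inf A by split; [exists t1|exists 0 => t []].
exists (inf A); split.
- by apply: lb_le_inf => [|t []//]; exists t1.
- move=> x Ox; rewrite lerNl -ler_pdivrMr ?phi_gt0//.
  apply: lb_le_inf; first by exists t1.
  by move=> t [t0 /(_ x Ox)]; rewrite ler_pdivrMr ?phi_gt0// lerNl.
- by move=> t' t'0 ht'; apply: ge_inf; [case: iA|split].
Qed.

(** Where u < 0, the sign of lambda makes the right-hand side at least
    - l a (t phi)^al (r psi)^be, whatever the sign of the other unknown. *)
Lemma bound_improvement (u w : sobolev2 Omega p) (l lam t r : R) :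
  0 <= l -> own_sign al l lam -> 0 <= t -> 0 <= r ->
  (forall x, Omega x -> - (t * phi x) <= u x) ->
  (forall x, Omega x -> - (r * psi x) <= w x) ->
  ae_on Omega (fun x => lam * a x * signed_pow al (u x) * signed_pow be (w x)
    <= - op_apply L u x) ->
  forall x, Omega x -> - (l / l1 * t `^ al * r `^ be * phi x) <= u x.
Proof.
move=> l0 lamE t0 r0 ut wr super.
apply: (scalar_comparison oO bO p1 c0_gt0 T_gt0 ellL wmpL phi_gt0 phi_bd
  grad_phi_bd phi_f f_ge0 f_pos ut).
  by rewrite !mulr_ge0 ?powR_ge0 ?invr_ge0// ltW.
apply: (ae_onS3 _ super weight_ge0 weight_ge0) => x Ox ux ax _ u0.
apply: le_trans ux; have nu : 0 < - u x by rewrite oppr_gt0.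
have -> : lam * a x * signed_pow al (u x) * signed_pow be (w x) =
    l * (- u x) `^ al * a x * signed_pow be (w x).
  by rewrite -(own_sign_pow lamE nu) opprK; ring.
have -> : l / l1 * t `^ al * r `^ be * f x =
    l * (t * phi x) `^ al * a x * (r * psi x) `^ be.
  rewrite /f !powRM ?(ltW (phi_gt0 Ox)) ?(ltW (psi_gt0 Ox))//.
  by field; rewrite gt_eqF.
have h1 : (- u x) `^ al <= (t * phi x) `^ al.
  apply: ge0_ler_powR; rewrite ?nnegrE ?(ltW nu)//.
    by rewrite mulr_ge0// ltW// phi_gt0.
  by rewrite lerNl ut.
have h2 := signed_pow_ge be_gt0 (mulr_ge0 r0 (ltW (psi_gt0 Ox))) (wr x Ox).
have h3 : 0 <= l * (- u x) `^ al * a x by rewrite !mulr_ge0 ?powR_ge0.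
apply: le_trans (ler_wpM2l h3 h2).
rewrite mulrN lerN2 ler_wpM2r ?powR_ge0// ler_wpM2r// ler_wpM2l//.
Qed.

Lemma supersolution_neg_pos (u w : sobolev2 Omega p) (l lam s : R) :
  own_sign al l lam -> 0 < s -> l1 <= - l * s `^ be ->
  (forall x, u x = -1 * phi x) -> (forall x, op_apply L u x = -1 * op_apply L phi x) ->
  (forall x, w x = s * psi x) ->
  ae_on Omega (fun x => lam * a x * signed_pow al (u x) * signed_pow be (w x)
    <= - op_apply L u x).
Proof.
move=> lamE s0 ls uE LuE wE.
apply: (ae_onS3 _ phi_f weight_ge0 weight_ge0) => x Ox fx ax _.
have px := phi_gt0 Ox; have qx := psi_gt0 Ox.
rewrite LuE mulN1r fx uE wE mulN1r (signed_pow_gt0 (ltW be_gt0) (mulr_gt0 s0 qx)).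
rewrite (_ : lam * a x * _ = l * phi x `^ al * a x); last first.
  by rewrite -(own_sign_pow lamE px); ring.
rewrite powRM ?(ltW s0) ?(ltW px) ?(ltW qx)// /f -subr_ge0.
rewrite (_ : _ - _ = (- l * s `^ be - l1) * (a x * phi x `^ al * psi x `^ be)); last by ring.
by rewrite mulr_ge0 ?subr_ge0// !mulr_ge0 ?powR_ge0.
Qed.

Lemma supersolution_neg_neg (u w : sobolev2 Omega p) (l lam : R) :
  own_sign al l lam -> l1 <= l ->
  (forall x, u x = -1 * phi x) -> (forall x, op_apply L u x = -1 * op_apply L phi x) ->
  (forall x, w x = -1 * psi x) ->
  ae_on Omega (fun x => lam * a x * signed_pow al (u x) * signed_pow be (w x)
    <= - op_apply L u x).
Proof.
move=> lamE ls uE LuE wE.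
apply: (ae_onS3 _ phi_f weight_ge0 weight_ge0) => x Ox fx ax _.
have px := phi_gt0 Ox; have qx := psi_gt0 Ox.
rewrite LuE mulN1r fx uE wE !mulN1r (signed_powN _ be_gt0) (signed_pow_gt0 (ltW be_gt0) qx).
rewrite (_ : lam * a x * _ = l * phi x `^ al * a x); last first.
  by rewrite -(own_sign_pow lamE px); ring.
rewrite /f -subr_ge0.
rewrite (_ : _ - _ = (l - l1) * (a x * phi x `^ al * psi x `^ be)); last by ring.
by rewrite mulr_ge0 ?subr_ge0// !mulr_ge0 ?powR_ge0.
Qed.

Lemma supersolution_pos_neg (u w : sobolev2 Omega p) (lam s : R) :
  0 < s -> - lam * s `^ al <= s * l1 ->
  (forall x, u x = s * phi x) -> (forall x, op_apply L u x = s * op_apply L phi x) ->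
  (forall x, w x = -1 * psi x) ->
  ae_on Omega (fun x => lam * a x * signed_pow al (u x) * signed_pow be (w x)
    <= - op_apply L u x).
Proof.
move=> s0 ls uE LuE wE.
apply: (ae_onS3 _ phi_f weight_ge0 weight_ge0) => x Ox fx ax _.
have px := phi_gt0 Ox; have qx := psi_gt0 Ox.
rewrite LuE -mulrN fx uE wE !mulN1r (signed_powN _ be_gt0) (signed_pow_gt0 (ltW be_gt0) qx)
  (signed_pow_gt0 al_ge0 (mulr_gt0 s0 px)).
rewrite powRM ?(ltW s0) ?(ltW px) ?(ltW qx)// /f -subr_ge0.
rewrite (_ : _ - _ = (s * l1 - - lam * s `^ al) * (a x * phi x `^ al * psi x `^ be)); last by ring.
by rewrite mulr_ge0 ?subr_ge0// !mulr_ge0 ?powR_ge0.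
Qed.

End one_equation.

(** * The weak maximum principle for the system *)

Section system_wmp.
Context {R : realType} {n : nat} (p : R) (Omega : set 'rV[R]_n).
Variables (S : system R n) (c0 C0 T Lambda0 : R).
Hypotheses (p1 : 1 <= p) (bO : bounded_set Omega) (oO : open Omega).
Hypotheses (C11 : C11_boundary Omega) (c0_gt0 : 0 < c0) (T_gt0 : 0 < T).
Hypotheses (ell1 : elliptic Omega c0 C0 T (op1 S)) (ell2 : elliptic Omega c0 C0 T (op2 S)).
Hypotheses (wmp1 : scalar_wmp Omega p (op1 S)) (wmp2 : scalar_wmp Omega p (op2 S)).
Hypotheses (smp1 : scalar_smp Omega p (op1 S)) (smp2 : scalar_smp Omega p (op2 S)).
Hypotheses (a_pos : (0 < ess_inf_on Omega (weight1 S))%E).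
Hypotheses (b_pos : (0 < ess_inf_on Omega (weight2 S))%E).
Hypotheses (al1_ge0 : 0 <= alpha1 S) (al1_lt1 : alpha1 S < 1).
Hypotheses (al2_ge0 : 0 <= alpha2 S) (al2_lt1 : alpha2 S < 1).
Hypotheses (be1_gt0 : 0 < beta1 S) (be2_gt0 : 0 < beta2 S) (L0 : 0 < Lambda0).
Hypothesis curveE : curve1 Omega p S =
  [set lm | [/\ 0 < lm.1, 0 < lm.2 & curve_expr S lm = Lambda0]].
Hypothesis critical : beta1 S * beta2 S = (1 - alpha1 S) * (1 - alpha2 S).

Lemma principal_eigenfunctions (l1 m1 : R) : 0 < l1 -> 0 < m1 ->
  curve_expr S (l1, m1) = Lambda0 -> exists phi psi : sobolev2 Omega p,
  [/\ forall x, Omega x -> 0 < phi x, forall x, Omega x -> 0 < psi x,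
      forall x, boundary Omega x -> phi x = 0, forall x, boundary Omega x -> psi x = 0 &
      is_solution S (l1, m1) phi psi].
Proof.
move=> l10 m10 e.
have : curve1 Omega p S (l1, m1) by rewrite curveE; split.
move=> [phi [psi [sol pos]]]; exists phi, psi; split => //.
- by move=> x /pos[].
- by move=> x /pos[].
- by case: sol => _ _ bd x /bd[].
- by case: sol => _ _ bd x /bd[].
Qed.

(** On the empty domain every pair would be a principal eigenvalue. *)
Lemma Omega_nonempty : exists x, Omega x.
Proof.
have [l1 [m1 [l10 m10 e]]] := curve_nonempty L0 al1_lt1 al2_lt1 be1_gt0 be2_gt0.
have [phi [psi [_ _ phi0 psi0 _]]] := principal_eigenfunctions l10 m10 e.
apply: contrapT => /forallNP nO.
have : curve1 Omega p S (-1, 1).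
  exists phi, psi; split; last by move=> x /nO.
  by split; [apply: aeW => x /nO|apply: aeW => x /nO|move=> x bx; split; auto].
by rewrite curveE => -[/=]; rewrite oppr_gt0 ltr10.
Qed.

(** The optimal multiples t and s of the eigenfunctions bounding (u, v) from below
    satisfy the two critical inequalities, hence vanish. *)
Lemma WMP_below_curve (l m lam mu : R) :
  own_sign (alpha1 S) l lam -> own_sign (alpha2 S) m mu ->
  below_curve S Lambda0 l m -> WMP Omega p S (lam, mu).
Proof.
move=> lamE muE below u v [eu ev bd].
have [l0 m0 _] := below.
have [l1 [m1 [l10 m10 ll mm e]]] :=
  curve_point_above L0 al1_lt1 al2_lt1 be1_gt0 be2_gt0 below.
have [phi [psi [phi_gt0 psi_gt0 phi_bd psi_bd [ephi epsi _]]]] :=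
  principal_eigenfunctions l10 m10 e.
have u0 x : boundary Omega x -> 0 <= u x by move=> /bd[].
have v0 x : boundary Omega x -> 0 <= v x by move=> /bd[].
have [t [t0 ut tmin]] := optimal_lower_bound oO bO C11 smp1 a_pos
  al1_ge0 be1_gt0 l10 phi_gt0 psi_gt0 phi_bd ephi u0.
have [s [s0 vs smin]] := optimal_lower_bound oO bO C11 smp2 b_pos
  al2_ge0 be2_gt0 m10 psi_gt0 phi_gt0 psi_bd epsi v0.
have ht : t <= l / l1 * t `^ alpha1 S * s `^ beta1 S.
  apply: tmin; first by rewrite !mulr_ge0 ?powR_ge0 ?invr_ge0// ltW.
  exact: (bound_improvement oO bO p1 C11 c0_gt0 T_gt0 ell1 wmp1 smp1 a_pos
    al1_ge0 be1_gt0 l10 phi_gt0 psi_gt0 phi_bd ephi l0 lamE t0 s0 ut vs eu).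
have hs : s <= m / m1 * s `^ alpha2 S * t `^ beta2 S.
  apply: smin; first by rewrite !mulr_ge0 ?powR_ge0 ?invr_ge0// ltW.
  exact: (bound_improvement oO bO p1 C11 c0_gt0 T_gt0 ell2 wmp2 smp2 b_pos
    al2_ge0 be2_gt0 m10 psi_gt0 phi_gt0 psi_bd epsi m0 muE s0 t0 vs ut ev).
have x0 : 0 <= l / l1 by rewrite divr_ge0// ltW.
have x1 : l / l1 <= 1 by rewrite ler_pdivrMr// mul1r.
have y0 : 0 <= m / m1 by rewrite divr_ge0// ltW.
have y1 : m / m1 < 1 by rewrite ltr_pdivrMr// mul1r.
have [t00 s00] := critical_inequalities al1_lt1 al2_lt1 be1_gt0 be2_gt0 critical
  t0 s0 x0 x1 y0 y1 ht hs.
move=> x Ox; split.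
  by have := ut x Ox; rewrite t00 mul0r oppr0.
by have := vs x Ox; rewrite s00 mul0r oppr0.
Qed.

(** Both inequalities hold for large s because be > 0 and al < 1. *)
Lemma counterexample_scale (al be l l1 m1 mu : R) : al < 1 -> 0 < be -> l < 0 ->
  0 < m1 -> exists2 s, 0 < s & l1 <= - l * s `^ be /\ - mu * s `^ al <= s * m1.
Proof.
move=> al1 be0 l0 m10; have nl : 0 < - l by rewrite oppr_gt0.
have al1' : 0 < 1 - al by rewrite subr_gt0.
have [S1 S10 h1] := @powR_large _ be (l1 / - l) be0.
have [S2 S20 h2] := @powR_large _ (1 - al) (- mu / m1) al1'.
pose s := Num.max S1 S2.
have s0 : 0 < s by rewrite lt_max S10.
have {}h1 : l1 / - l <= s `^ be by apply: h1; rewrite le_max lexx.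
have {}h2 : - mu / m1 <= s `^ (1 - al) by apply: h2; rewrite le_max lexx orbT.
exists s => //; split; first by rewrite mulrC -ler_pdivrMr.
rewrite [X in _ <= X * _](powR_split al s0) -mulrA mulrC ler_wpM2l ?powR_ge0//.
by rewrite -ler_pdivrMr.
Qed.

(** A negative l is excluded by (- phi, s psi), a negative m by (s phi, - psi)
    and a point on or above the curve by (- phi, - psi). *)
Lemma below_curve_WMP (l m lam mu : R) :
  own_sign (alpha1 S) l lam -> own_sign (alpha2 S) m mu ->
  WMP Omega p S (lam, mu) -> below_curve S Lambda0 l m.
Proof.
move=> lamE muE wmp.
have [x Ox] := Omega_nonempty.
have [l0|l0] := ltP l 0.
  exfalso.
  have [l1 [m1 [l10 m10 e]]] := curve_nonempty L0 al1_lt1 al2_lt1 be1_gt0 be2_gt0.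
  have [phi [psi [phi_gt0 psi_gt0 phi_bd psi_bd [ephi epsi _]]]] :=
    principal_eigenfunctions l10 m10 e.
  have [s s0 [s1 s2]] := @counterexample_scale (alpha2 S) (beta1 S) l l1 m1 mu
    al2_lt1 be1_gt0 l0 m10.
  have [u [uE LuE]] := sob_scale oO bO p1 (-1) phi.
  have [w [wE LwE]] := sob_scale oO bO p1 s psi.
  have sup : is_supersolution S (lam, mu) u w.
    split.
    - exact: (supersolution_neg_pos a_pos al1_ge0 be1_gt0 phi_gt0 psi_gt0
        ephi lamE s0 s1 uE (LuE _) wE).
    - exact: (supersolution_pos_neg b_pos al2_ge0 be2_gt0 psi_gt0 phi_gt0
        epsi s0 s2 wE (LwE _) uE).
    - by move=> y bx; rewrite uE wE phi_bd// psi_bd// !mulr0.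
  have [+ _] := wmp u w sup x Ox.
  by rewrite uE mulN1r oppr_ge0 leNgt phi_gt0.
have [m0|m0] := ltP m 0.
  exfalso.
  have [l1 [m1 [l10 m10 e]]] := curve_nonempty L0 al1_lt1 al2_lt1 be1_gt0 be2_gt0.
  have [phi [psi [phi_gt0 psi_gt0 phi_bd psi_bd [ephi epsi _]]]] :=
    principal_eigenfunctions l10 m10 e.
  have [s s0 [s1 s2]] := @counterexample_scale (alpha1 S) (beta2 S) m m1 l1 lam
    al1_lt1 be2_gt0 m0 l10.
  have [u [uE LuE]] := sob_scale oO bO p1 s phi.
  have [w [wE LwE]] := sob_scale oO bO p1 (-1) psi.
  have sup : is_supersolution S (lam, mu) u w.
    split.
    - exact: (supersolution_pos_neg a_pos al1_ge0 be1_gt0 phi_gt0 psi_gt0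
        ephi s0 s2 uE (LuE _) wE).
    - exact: (supersolution_neg_pos b_pos al2_ge0 be2_gt0 psi_gt0 phi_gt0
        epsi muE s0 s1 wE (LwE _) uE).
    - by move=> y bx; rewrite uE wE phi_bd// psi_bd// !mulr0.
  have [_] := wmp u w sup x Ox.
  by rewrite wE mulN1r oppr_ge0 leNgt psi_gt0.
split => //; rewrite ltNge; apply/negP => le.
have [l1 [m1 [l10 m10 ll mm e]]] := curve_point_below L0 al1_lt1 al2_lt1 be1_gt0 be2_gt0 l0 m0 le.
have [phi [psi [phi_gt0 psi_gt0 phi_bd psi_bd [ephi epsi _]]]] :=
  principal_eigenfunctions l10 m10 e.
have [u [uE LuE]] := sob_scale oO bO p1 (-1) phi.
have [w [wE LwE]] := sob_scale oO bO p1 (-1) psi.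
have sup : is_supersolution S (lam, mu) u w.
  split.
  - exact: (supersolution_neg_neg a_pos al1_ge0 be1_gt0 phi_gt0 psi_gt0
      ephi lamE ll uE (LuE _) wE).
  - exact: (supersolution_neg_neg b_pos al2_ge0 be2_gt0 psi_gt0 phi_gt0
      epsi muE mm wE (LwE _) uE).
  - by move=> y bx; rewrite uE wE phi_bd// psi_bd// !mulr0.
have [+ _] := wmp u w sup x Ox.
by rewrite uE mulN1r oppr_ge0 leNgt phi_gt0.
Qed.

Lemma WMP_iff_below_curve (l m lam mu : R) :
  own_sign (alpha1 S) l lam -> own_sign (alpha2 S) m mu ->
  below_curve S Lambda0 l m <-> WMP Omega p S (lam, mu).
Proof. by move=> lamE muE; split; [exact: WMP_below_curve|exact: below_curve_WMP]. Qed.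

End system_wmp.

Lemma opp_setE {R : realType} (E : set (R * R)) l m : opp_set E (l, m) <-> E (- l, - m).
Proof.
split=> [[[a b] Eab [<- <-]]|h]; first by rewrite !opprK.
by exists (- l, - m) => //; congr (_, _); exact: opprK.
Qed.

Theorem theorem1p2 (R : realType) (n : nat) (p : R) (Omega : set 'rV[R]_n)
  (Sys : system R n) (c0 C0 T Lambda0 : R)
  (n_ge1 : (1 <= n)%N) (p_gt_n : n%:R < p)
  (Omega_bounded : bounded_set Omega) (Omega_open : open Omega)
  (Omega_C11 : C11_boundary Omega)
  (c0_gt0 : 0 < c0) (C0_gt0 : 0 < C0) (T_gt0 : 0 < T)
  (ell1 : elliptic Omega c0 C0 T (op1 Sys))
  (ell2 : elliptic Omega c0 C0 T (op2 Sys))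
  (wmp1 : scalar_wmp Omega p (op1 Sys)) (wmp2 : scalar_wmp Omega p (op2 Sys))
  (smp1 : scalar_smp Omega p (op1 Sys)) (smp2 : scalar_smp Omega p (op2 Sys))
  (a_Lp : inLp Omega p%:E (weight1 Sys)) (b_Lp : inLp Omega p%:E (weight2 Sys))
  (a_pos : (0 < ess_inf_on Omega (weight1 Sys))%E)
  (b_pos : (0 < ess_inf_on Omega (weight2 Sys))%E)
  (alpha1_bounds : 0 <= alpha1 Sys < 1) (alpha2_bounds : 0 <= alpha2 Sys < 1)
  (beta1_gt0 : 0 < beta1 Sys) (beta2_gt0 : 0 < beta2 Sys)
  (* the known description of the principal curve *)
  (Lambda0_gt0 : 0 < Lambda0)
  (curveE : curve1 Omega p Sys =
    [set lm | [/\ 0 < lm.1, 0 < lm.2 & curve_expr Sys lm = Lambda0]])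
  (critical : beta1 Sys * beta2 Sys = (1 - alpha1 Sys) * (1 - alpha2 Sys))
  (lambda mu : R) :
  [/\ 0 < alpha1 Sys -> 0 < alpha2 Sys ->
        (opp_set (closure (region1 Sys Lambda0) `\` curve1 Omega p Sys) (lambda, mu)
         <-> WMP Omega p Sys (lambda, mu)),
      alpha1 Sys = 0 -> 0 < alpha2 Sys ->
        ((closure (region2 Sys Lambda0) `\` curve2 Omega p Sys) (lambda, mu)
         <-> WMP Omega p Sys (lambda, mu)) &
      alpha2 Sys = 0 -> 0 < alpha1 Sys ->
        (opp_set (closure (region2 Sys Lambda0) `\` curve2 Omega p Sys) (lambda, mu)
         <-> WMP Omega p Sys (lambda, mu))].
Proof.
have p1 : 1 <= p by apply: le_trans (ltW p_gt_n); rewrite ler1n.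
have /andP[al1_ge0 al1_lt1] := alpha1_bounds.
have /andP[al2_ge0 al2_lt1] := alpha2_bounds.
have region1P l m := closure_region1P Lambda0_gt0 al1_lt1 al2_lt1 beta1_gt0
  beta2_gt0 l m curveE.
have region2P l m : (closure (region2 Sys Lambda0) `\` curve2 Omega p Sys) (l, m) <->
    below_curve Sys Lambda0 l (- m).
  by rewrite -region1P; split=> -[/closure_region2E cl nC]; split.
have iffP l m := WMP_iff_below_curve p1 Omega_bounded Omega_open Omega_C11 c0_gt0
  T_gt0 ell1 ell2 wmp1 wmp2 smp1 smp2 a_pos b_pos al1_ge0 al1_lt1 al2_ge0 al2_lt1
  beta1_gt0 beta2_gt0 Lambda0_gt0 curveE critical (l := l) (m := m) (lam := lambda) (mu := mu).
have negE al x : 0 < al -> own_sign al (- x) x by move=> al0; right; rewrite opprK.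
have posE al x : al = 0 -> own_sign al x x by move=> al0; left.
split=> [al1 al2|al1 al2|al2 al1].
- by rewrite opp_setE region1P; apply: iffP; exact: negE.
- by rewrite region2P; apply: iffP; [exact: posE|exact: negE].
- by rewrite opp_setE region2P opprK; apply: iffP; [exact: negE|exact: posE].
Qed.
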